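(* Assume that $b\in\mathbb{C}$ and $a,c,c-a\in\mathbb{C}\setminus\mathbb{Z}_{\leqslant 0}$. Set $\eta=xy$, and let $0<\eta_1\leqslant\eta_2<\infty$ be fixed. For $k\geqslant 0$ let $$c_k^{(1)}(\eta)=(-1)^k\sum_{\substack{m,n\geqslant0\\ m+2n=k}}\frac{(a)_{m+n}(a-c+1)_m(b)_n}{m!\,n!}(-\eta)^n,\qquad c_k^{(2)}(\eta)=\sum_{\substack{m,n\geqslant0\\ m+n=k}}\frac{(c-a)_m(a)_n(b)_n(1-a)_{m-n}}{m!\,n!}(-\eta)^n.$$ (1) Under the conditions that $y$ is bounded away from the points $a+\ell$ $(\ell\in\mathbb{Z}_{\geqslant0})$ and that $$y\to\infty,\quad|\arg(1-x)|<\pi,\quad|\arg(-y)|<\pi,\quad\eta_1\leqslant|\eta|\leqslant\eta_2,$$ we have the asymptotic expansion $$\Phi_1[a,b;c;x,y]=\frac{\Gamma(c)}{\Gamma(c-a)}(-y)^{-a}\sum_{k=0}^{N-1}c_k^{(1)}(\eta)y^{-k}+\frac{\Gamma(c)}{\Gamma(a)}y^{a-c}e^{y}\sum_{k=0}^{N-1}c_k^{(2)}(\eta)y^{-k}+\mathcal{O}\left(|y|^{-\Re(a)-N}+|y|^{\Re(a-c)-N}e^{\Re(y)}\right),$$ where $N$ is any integer such that $N\geqslant\max\{1,|a|,|a-c|\}$. (2) Under the condition that $$y\to+\infty,\quad|\arg(1-x)|<\pi,\quad\eta_1\leqslant|\eta|\leqslant\eta_2,$$ we have the asymptotic expansion 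$$\Phi_1[a,b;c;x,y]\sim\frac{\Gamma(c)}{\Gamma(a)}y^{a-c}e^{y}\sum_{k=0}^{\infty}c_k^{(2)}(\eta)y^{-k}.$$
   Context: $(\alpha)_n=\Gamma(\alpha+n)/\Gamma(\alpha)$, also for negative integers $n$; powers take principal values; $\sim$ denotes a Poincar\'e-type asymptotic expansion. When $a$ is a positive integer, the product $(-1)^n(a)_n(1-a)_{m-n}$ is understood by continuity as $(1-a-n)_m$. ''Bounded away'' means that the distance to the set of points is at least a fixed positive constant. The Humbert function $\Phi_1$ is defined for $|x|<1$, $y\in\mathbb{C}$ by $$\Phi_1[a,b;c;x,y]=\sum_{m,n=0}^{\infty}\frac{(a)_{m+n}(b)_m}{(c)_{m+n}}\frac{x^m}{m!}\frac{y^n}{n!},$$ and is continued analytically to all $x\in\mathbb{C}\setminus[1,\infty)$, $y\in\mathbb{C}$ by $$\Phi_1[a,b;c;x,y]=\sum_{n=0}^{\infty}\frac{(a)_n}{(c)_n}\,{}_2F_1\left[\begin{matrix}a+n,b\\ c+n\end{matrix};x\right]\frac{y^n}{n!}$$ (principal branch of ${}_2F_1$). *)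

(* Defs.v *)
From Stdlib Require Import Reals Lra Lia ZArith ClassicalEpsilon.
From Coquelicot Require Import Coquelicot.

Open Scope R_scope.
Open Scope C_scope.

Definition Cexp (z : C) : C :=
  (exp (Re z) * cos (Im z), exp (Re z) * sin (Im z))%R.

(* Principal argument, in (-PI, PI]; the value at 0 is meaningless. *)
Definition Arg (z : C) : R :=
  if Rle_dec 0 (Im z) then acos (Re z / Cmod z) else (- acos (Re z / Cmod z))%R.

Definition Clog (z : C) : C := (ln (Cmod z), Arg z).

Definition Cpower (z w : C) : C := Cexp (w * Clog z).

(* |arg z| < PI, i.e. z lies in the plane cut along (-oo, 0]. *)
Definition slit_plane (z : C) : Prop := z <> 0 /\ (Rabs (Arg z) < PI)%R.

Definition not_nonpos_int (z : C) : Prop :=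
  forall n : nat, z <> RtoC (- INR n).

Definition CLim_seq (u : nat -> C) : C :=
  (real (Lim_seq (fun n => Re (u n))), real (Lim_seq (fun n => Im (u n)))).

Definition CSeries (u : nat -> C) : C :=
  (Series (fun n => Re (u n)), Series (fun n => Im (u n))).

Fixpoint poch (alpha : C) (n : nat) : C :=
  match n with
  | O => 1
  | S k => poch alpha k * (alpha + INR k)
  end.

(* Gauss' product formula n! n^z / (z (z+1) ... (z+n)). *)
Definition Gamma_seq (z : C) (n : nat) : C :=
  INR (fact n) * Cpower (INR n) z / poch z (S n).

Definition Gamma (z : C) : C := CLim_seq (Gamma_seq z).

(* (alpha)_n for n in Z.  For n = -j < 0 the quotient
   Gamma(alpha - j) / Gamma(alpha) is 1 / ((alpha-j) ... (alpha-1)).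
   The product form also gives the continuous extension of
   Gamma(alpha + n) / Gamma(alpha) to parameters at which Gamma has poles;
   see [poch_Gamma], [pochZ_Gamma] and [pochZ_reflect]. *)
Definition pochZ (alpha : C) (n : Z) : C :=
  match n with
  | Z0 => 1
  | Zpos p => poch alpha (Pos.to_nat p)
  | Zneg p => / poch (alpha - INR (Pos.to_nat p)) (Pos.to_nat p)
  end.

Definition Gauss_series (a b c x : C) : C :=
  CSeries (fun n => poch a n * poch b n / poch c n * x ^ n / INR (fact n)).

Definition holomorphic_at (f : C -> C) (z : C) : Prop :=
  @ex_derive C_AbsRing C_NormedModule f z.

Definition is_2F1_continuation (a b c : C) (F : C -> C) : Prop :=
  (forall x, slit_plane (1 - x) -> holomorphic_at F x) /\
  (forall x, (Cmod x < 1)%R -> F x = Gauss_series a b c x).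

(* Principal branch: the Gauss series in the unit disc, and elsewhere its
   (unique) holomorphic continuation to the plane cut along [1, +oo). *)
Definition hyp2F1 (a b c x : C) : C :=
  if Rlt_dec (Cmod x) 1 then Gauss_series a b c x
  else epsilon (inhabits (fun _ : C => RtoC 0)) (is_2F1_continuation a b c) x.

(* The double series converges absolutely for |x| < 1, hence may be summed
   as an iterated series. *)
Definition Phi1_series (a b c x y : C) : C :=
  CSeries (fun m => CSeries (fun n =>
    poch a (m + n) * poch b m / poch c (m + n)
    * (x ^ m / INR (fact m)) * (y ^ n / INR (fact n)))).

Definition Phi1 (a b c x y : C) : C :=
  if Rlt_dec (Cmod x) 1 then Phi1_series a b c x y
  else CSeries (fun n =>
    poch a n / poch c n * hyp2F1 (a + INR n) b (c + INR n) x
    * (y ^ n / INR (fact n))).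

(* The sum over m + 2 n = k, indexed by n. *)
Definition coef1 (a b c : C) (k : nat) (eta : C) : C :=
  (-1) ^ k *
  sum_n (fun n => let m := (k - 2 * n)%nat in
    poch a (m + n) * poch (a - c + 1) m * poch b n
    / (INR (fact m) * INR (fact n)) * (- eta) ^ n) (Nat.div k 2).

(* The sum over m + n = k, indexed by n. *)
Definition coef2 (a b c : C) (k : nat) (eta : C) : C :=
  sum_n (fun n => let m := (k - n)%nat in
    poch (c - a) m * poch a n * poch b n
    * pochZ (1 - a) (Z.of_nat m - Z.of_nat n)
    / (INR (fact m) * INR (fact n)) * (- eta) ^ n) k.

Lemma INR_C_S (n : nat) : RtoC (INR (S n)) = INR n + 1.
Proof. now rewrite S_INR, RtoC_plus. Qed.

Lemma poch_add (z : C) (m n : nat) :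
  poch z (m + n) = poch z m * poch (z + INR m) n.
Proof.
  induction n as [|n IH].
  - rewrite Nat.add_0_r; simpl; ring.
  - rewrite Nat.add_succ_r; simpl poch; rewrite IH, plus_INR, RtoC_plus; ring.
Qed.

Lemma poch_S_l (z : C) (n : nat) : poch z (S n) = z * poch (z + 1) n.
Proof. change (S n) with (1 + n)%nat; rewrite poch_add; simpl; ring. Qed.

Lemma not_nonpos_int_add (z : C) (n : nat) :
  not_nonpos_int z -> z + INR n <> 0.
Proof.
  intros hz h; apply (hz n).
  rewrite RtoC_opp. replace z with (z + INR n - INR n) by ring.
  rewrite h; ring.
Qed.

Lemma not_nonpos_int_succ (z : C) : not_nonpos_int z -> not_nonpos_int (z + 1).
Proof.
  intros hz n h; apply (hz (S n)).
  replace z with (z + 1 - 1) by ring.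
  rewrite h, S_INR, !RtoC_opp, RtoC_plus; ring.
Qed.

Lemma poch_neq_0 (z : C) (n : nat) : not_nonpos_int z -> poch z n <> 0.
Proof.
  intros hz; induction n as [|n IH]; simpl.
  - exact C1_nz.
  - apply Cmult_neq_0; [exact IH | now apply not_nonpos_int_add].
Qed.

Lemma poch_reflect (a : C) (n : nat) :
  poch (1 - a - INR n) n = (-1) ^ n * poch a n.
Proof.
  induction n as [|n IH]; [simpl; ring|].
  rewrite poch_S_l, INR_C_S.
  replace (1 - a - (INR n + 1) + 1) with (1 - a - INR n) by ring.
  rewrite IH; simpl; ring.
Qed.

Lemma pochZ_nat (z : C) (n : nat) : pochZ z (Z.of_nat n) = poch z n.
Proof. destruct n; [reflexivity|]. simpl pochZ. now rewrite SuccNat2Pos.id_succ. Qed.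

Lemma pochZ_opp (z : C) (n : nat) :
  pochZ z (- Z.of_nat n) = / poch (z - INR n) n.
Proof.
  destruct n; [simpl; field; exact C1_nz|].
  simpl pochZ. now rewrite SuccNat2Pos.id_succ.
Qed.

Lemma pochZ_reflect (a : C) (m n : nat) : not_nonpos_int a ->
  (-1) ^ n * poch a n * pochZ (1 - a) (Z.of_nat m - Z.of_nat n)
  = poch (1 - a - INR n) m.
Proof.
  intros ha. destruct (le_lt_dec n m) as [h|h].
  - replace m with (n + (m - n))%nat by lia. set (j := (m - n)%nat).
    replace (Z.of_nat (n + j) - Z.of_nat n)%Z with (Z.of_nat j) by lia.
    rewrite pochZ_nat, poch_add, poch_reflect.
    f_equal; f_equal; ring.
  - replace n with (m + (n - m))%nat by lia. set (j := (n - m)%nat).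
    replace (Z.of_nat m - Z.of_nat (m + j))%Z with (- Z.of_nat j)%Z by lia.
    rewrite pochZ_opp, <- poch_reflect, poch_add.
    replace (1 - a - INR (m + j) + INR m) with (1 - a - INR j)
      by (rewrite plus_INR, RtoC_plus; ring).
    field. rewrite poch_reflect.
    apply Cmult_neq_0; [|now apply poch_neq_0].
    apply Cpow_nz. intros h1; inversion h1; lra.
Qed.

Lemma Cexp_add (z w : C) : Cexp (z + w) = Cexp z * Cexp w.
Proof.
  destruct z as [p q], w as [r s]; unfold Cexp, Cmult; simpl.
  rewrite exp_plus, cos_plus, sin_plus; f_equal; ring.
Qed.

Lemma Clog_pos (r : R) : (0 < r)%R -> Clog r = RtoC (ln r).
Proof.
  intros hr; unfold Clog, Arg; rewrite Cmod_R, Rabs_pos_eq by lra; simpl.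
  destruct (Rle_dec 0 0); [|lra].
  replace (r / r)%R with 1%R by (field; lra). now rewrite acos_1.
Qed.

Lemma Cpower_pos (r : R) (z : C) : (0 < r)%R -> Cpower r z = Cexp (z * ln r).
Proof. intros hr; unfold Cpower; now rewrite Clog_pos. Qed.

Lemma Cpower_pos_succ (r : R) (z : C) : (0 < r)%R ->
  Cpower r (z + 1) = Cpower r z * r.
Proof.
  intros hr; rewrite !Cpower_pos by easy.
  replace ((z + 1) * ln r) with (z * ln r + ln r) by ring.
  rewrite Cexp_add; f_equal. unfold Cexp; simpl.
  rewrite cos_0, sin_0, exp_ln by easy. unfold RtoC; f_equal; ring.
Qed.

Lemma exp_bound1 (p : R) : (Rabs p <= 1/2)%R -> (0 <= exp p - 1 - p <= 2 * p²)%R.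
Proof.
  intros hp. apply Rabs_le_between in hp. unfold Rsqr. split.
  - pose proof (exp_ineq1_le p); lra.
  - pose proof (exp_ineq1_le (- p)). rewrite exp_Ropp in H.
    pose proof (exp_pos p).
    assert (exp p * (1 - p) <= 1)%R.
    { apply Rmult_le_reg_r with (/ exp p)%R; [now apply Rinv_0_lt_compat|].
      replace (exp p * (1 - p) * / exp p)%R with (1 - p)%R by (field; lra). lra. }
    assert (1 <= (1 + p + 2 * (p * p)) * (1 - p))%R by nra.
    nra.
Qed.

Lemma sin_abs_le (q : R) : (Rabs (sin q) <= Rabs q)%R.
Proof.
  destruct (MVT_gen sin 0 q cos) as [x [_ h]].
  - intros; apply is_derive_sin.
  - intros; apply continuity_sin.
  - rewrite sin_0, !Rminus_0_r in h. rewrite h, Rabs_mult.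
    pose proof (Rabs_pos q). 
    assert (Rabs (cos x) <= 1)%R by (apply Rabs_le, COS_bound). nra.
Qed.

Lemma cos_bound1 (q : R) : (Rabs (cos q - 1) <= q²/2)%R.
Proof.
  replace q with (2 * (q / 2))%R at 1 by field.
  rewrite cos_2a_sin.
  replace (1 - 2 * sin (q/2) * sin (q/2) - 1)%R with (- (2 * Rsqr (sin (q/2))))%R
    by (unfold Rsqr; ring).
  pose proof (sin_abs_le (q/2)) as h. apply Rsqr_le_abs_1 in h.
  rewrite Rabs_Ropp, Rabs_pos_eq; [|pose proof (Rle_0_sqr (sin (q/2))); lra].
  unfold Rsqr in *; lra.
Qed.

Lemma sin_bound1 (q : R) : (Rabs q <= 1)%R -> (Rabs (sin q - q) <= q²)%R.
Proof.
  intros hq.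
  destruct (MVT_gen (fun x => sin x - x)%R 0 q (fun x => cos x - 1)%R) as [x [hx h]].
  - intros; auto_derive; [easy|ring].
  - intros; apply continuity_pt_minus; [apply continuity_sin|apply continuity_pt_id].
  - cbv beta in h. rewrite sin_0, !Rminus_0_r in h. rewrite h, Rabs_mult.
    pose proof (cos_bound1 x).
    assert (Rabs x <= Rabs q)%R.
    { unfold Rmin, Rmax in hx; destruct (Rle_dec 0 q); split_Rabs; lra. }
    rewrite (Rsqr_abs x) in H. rewrite (Rsqr_abs q). unfold Rsqr in *.
    pose proof (Rabs_pos q); pose proof (Rabs_pos x). pose proof (Rabs_pos (cos x - 1)). nra.
Qed.

Lemma Cmod_le_abs (z : C) : (Cmod z <= Rabs (Re z) + Rabs (Im z))%R.
Proof.
  destruct z as [p q]. replace (p, q) with (RtoC p + Ci * RtoC q).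
  - eapply Rle_trans; [apply Cmod_triangle|].
    rewrite Cmod_mult, !Cmod_R. replace (Cmod Ci) with 1%R.
    + unfold RtoC, Ci; simpl. rewrite !Rmult_0_l, !Rmult_1_l.
      right; f_equal; f_equal; ring.
    + unfold Cmod, Ci; simpl. rewrite <- sqrt_1 at 1; f_equal; ring.
  - unfold Ci, RtoC, Cplus, Cmult; simpl; f_equal; ring.
Qed.

Lemma Cexp_bound (w : C) : (Cmod w <= 1/2)%R ->
  (Cmod (Cexp w - 1 - w)%C <= 8 * (Cmod w)²)%R.
Proof.
  intros hw. destruct w as [p q].
  assert (hp : (Rabs p <= Cmod (p, q))%R) by apply (re_le_Cmod (p, q)).
  assert (hq : (Rabs q <= Cmod (p, q))%R).
  { eapply Rle_trans; [apply Rmax_r|apply (Rmax_Cmod (p, q))]. }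
  set (r := Cmod (p, q)) in *.
  eapply Rle_trans; [apply Cmod_le_abs|]. unfold Cexp; simpl.
  destruct (exp_bound1 p) as [e1 e2]; [lra|].
  pose proof (cos_bound1 q) as hc.
  assert (hs := sin_bound1 q ltac:(lra)).
  pose proof (sin_abs_le q) as hs'.
  replace (exp p * cos q + - (1) + - p)%R
    with ((exp p - 1 - p) + exp p * (cos q - 1))%R by ring.
  replace (exp p * sin q + - 0 + - q)%R
    with ((exp p - 1) * sin q + (sin q - q))%R by ring.
  rewrite (Rsqr_abs p) in e2. rewrite (Rsqr_abs q) in hc, hs.
  assert (hE : (exp p <= 2)%R).
  { unfold Rsqr in *. pose proof (Rabs_pos p). split_Rabs; nra. }
  assert (hE1 : (Rabs (exp p - 1) <= 2 * Rabs p)%R).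
  { unfold Rsqr in *. pose proof (Rabs_pos p). split_Rabs; nra. }
  pose proof (exp_pos p).
  eapply Rle_trans; [apply Rplus_le_compat; apply Rabs_triang|].
  rewrite !Rabs_mult, (Rabs_pos_eq (exp p)), (Rabs_pos_eq (exp p - 1 - p)) by lra.
  unfold Rsqr in *.
  pose proof (Rabs_pos p); pose proof (Rabs_pos q).
  pose proof (Rabs_pos (cos q - 1)); pose proof (Rabs_pos (sin q)).
  pose proof (Rabs_pos (exp p - 1)).
  assert (exp p * Rabs (cos q - 1) <= r * r)%R by nra.
  assert (Rabs (exp p - 1) * Rabs (sin q) <= 2 * (r * r))%R.
  { apply Rle_trans with ((2 * Rabs p) * Rabs q)%R;
      [apply Rmult_le_compat; lra | nra]. }
  nra.
Qed.

Lemma ln_succ_bounds (n : nat) : (1 <= n)%nat ->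
  (/ (INR n + 1) <= ln ((INR n + 1) / INR n) <= / INR n)%R.
Proof.
  intros hn. apply le_INR in hn; simpl in hn.
  set (x := INR n) in *. split.
  - replace ((x + 1) / x)%R with (/ (x / (x + 1)))%R by (field; lra).
    assert (0 < x / (x + 1))%R by (apply Rdiv_lt_0_compat; lra).
    rewrite ln_Rinv by easy.
    pose proof (exp_ineq1_le (ln (x / (x + 1)))) as h. rewrite exp_ln in h by easy.
    replace (/ (x + 1))%R with (1 - x / (x + 1))%R by (field; lra). lra.
  - assert (0 < (x + 1) / x)%R by (apply Rdiv_lt_0_compat; lra).
    pose proof (exp_ineq1_le (ln ((x + 1) / x))) as h. rewrite exp_ln in h by easy.
    replace (/ x)%R with ((x + 1) / x - 1)%R by (field; lra). lra.
Qed.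

Lemma Gamma_seq_S (z : C) (n : nat) : (1 <= n)%nat -> not_nonpos_int z ->
  Gamma_seq z (S n) - Gamma_seq z n =
  Gamma_seq z n * ((INR n + 1) / (z + (INR n + 1))
    * (Cexp (z * ln ((INR n + 1) / INR n)) - 1 - z / (INR n + 1))).
Proof.
  intros hn hz. assert (hn' := hn). apply le_INR in hn'; simpl in hn'.
  assert (h0 : z + (INR n + 1) <> 0).
  { rewrite <- INR_C_S. now apply not_nonpos_int_add. }
  assert (h1 : RtoC (INR n) + 1 <> 0).
  { rewrite <- RtoC_plus. intros h. apply RtoC_inj in h. lra. }
  assert (hp := poch_neq_0 z (S n) hz).
  unfold Gamma_seq.
  change (poch z (S (S n))) with (poch z (S n) * (z + INR (S n))).
  rewrite fact_simpl, mult_INR, RtoC_mult, S_INR.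
  rewrite !Cpower_pos by lra.
  rewrite Rdiv_def at 1.
  rewrite ln_mult, ln_Rinv by (try apply Rinv_0_lt_compat; lra).
  rewrite RtoC_plus.
  replace (z * (ln (INR n + 1))) with (z * (ln (INR n + 1) + - ln (INR n))%R + z * ln (INR n))
   by (rewrite RtoC_plus, RtoC_opp; ring).
  rewrite Cexp_add. field. repeat split; easy.
Qed.
Lemma Gamma_seq_step (z : C) : not_nonpos_int z ->
  exists (K : R) (n0 : nat), (0 <= K)%R /\ (1 <= n0)%nat /\
    forall n, (n0 <= n)%nat ->
      (Cmod (Gamma_seq z (S n) - Gamma_seq z n)%C
       <= Cmod (Gamma_seq z n) * (K / INR n - K / INR (S n)))%R.
Proof.
  intros hz. set (A := Cmod z). assert (hA : (0 <= A)%R) by apply Cmod_ge_0.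
  destruct (INR_unbounded (4 * A + 2)) as [n0 hn0].
  assert (h1 : (1 <= n0)%nat) by (apply INR_le; simpl; lra).
  exists (32 * A * A + 2 * A)%R, n0. repeat split; [nra|easy|].
  intros n hn. rewrite Gamma_seq_S by (easy || lia).
  rewrite Cmod_mult, S_INR. apply Rmult_le_compat_l; [apply Cmod_ge_0|].
  destruct (ln_succ_bounds n ltac:(lia)) as [l1 l2].
  set (t := ln ((INR n + 1) / INR n)) in *.
  apply le_INR in hn. set (x := INR n) in *.
  assert (hx : (/ (x + 1) < / x)%R) by (apply Rinv_lt_contravar; nra).
  assert (hx0 : (0 < / (x + 1))%R) by (apply Rinv_0_lt_compat; lra).
  assert (e : (Cmod ((x + 1) / (z + (x + 1)))%C <= 2)%R).
  { assert (hge : ((x + 1) / 2 <= Cmod (z + (x + 1))%C)%R).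
    { pose proof (Cmod_triangle (z + (x + 1)) (- z)) as h.
      replace (z + (x + 1) + - z) with (RtoC (x + 1)) in h by (rewrite RtoC_plus; ring).
      rewrite Cmod_opp, Cmod_R, Rabs_pos_eq in h by lra. fold A in h. lra. }
    rewrite Cmod_div by (apply Cmod_gt_0; lra).
    rewrite <- RtoC_plus, Cmod_R, Rabs_pos_eq by lra. rewrite RtoC_plus.
    apply Rle_div_l; lra. }
  assert (hw : Cmod (z * t) = (A * t)%R).
  { rewrite Cmod_mult, Cmod_R, Rabs_pos_eq by lra. reflexivity. }
  assert (hAt : (A * t <= A * / x)%R) by (apply Rmult_le_compat_l; lra).
  assert (hAx : (A * / x <= 1/2)%R).
  { apply (Rle_div_l A (1/2) x); lra. }
  assert (b1 := Cexp_bound (z * t) ltac:(lra)). rewrite hw in b1.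
  replace (Cexp (z * t) - 1 - z / (x + 1))
    with ((Cexp (z * t) - 1 - z * t) + z * RtoC (t - / (x + 1))).
  2:{ rewrite RtoC_minus, RtoC_inv, RtoC_plus by lra. unfold Cdiv; ring. }
  rewrite Cmod_mult.
  assert (b2 : (Cmod (z * RtoC (t - / (x + 1)))%C <= A * (/ x - / (x + 1)))%R).
  { rewrite Cmod_mult, Cmod_R, Rabs_pos_eq by lra. fold A.
    apply Rmult_le_compat_l; lra. }
  pose proof (Cmod_triangle (Cexp (z * t) - 1 - z * t) (z * RtoC (t - / (x + 1)))) as b3.
  assert (b4 : ((A * t)² <= 2 * (A * A) * (/ x - / (x + 1)))%R).
  { apply Rle_trans with ((A * / x)²)%R.
    - apply Rsqr_incr_1; [easy| |]; apply Rmult_le_pos; lra.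
    - unfold Rsqr. replace (A * / x * (A * / x))%R with (A * A * (/ x * / x))%R by ring.
      replace (2 * (A * A) * (/ x - / (x + 1)))%R
        with (A * A * (2 * (/ x - / (x + 1))))%R by ring.
      apply Rmult_le_compat_l; [nra|].
      replace (2 * (/ x - / (x + 1)))%R with (/ x * (2 * / (x + 1)))%R by (field; lra).
      apply Rmult_le_compat_l; [lra|].
      apply Rmult_le_reg_l with (x * (x + 1))%R; [nra|].
      replace (x * (x + 1) * / x)%R with (x + 1)%R by (field; lra).
      replace (x * (x + 1) * (2 * / (x + 1)))%R with (2 * x)%R by (field; lra). lra. }
  eapply Rle_trans.
  { apply Rmult_le_compat; [apply Cmod_ge_0|apply Cmod_ge_0|exact e|exact b3]. }
  unfold Rdiv. nra.
Qed.

Lemma ex_finite_lim_seq_step (u : nat -> R) (D : R) (n0 : nat) :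
  (1 <= n0)%nat ->
  (forall n, (n0 <= n)%nat ->
    (Rabs (u (S n) - u n)%R <= D / INR n - D / INR (S n))%R) ->
  ex_finite_lim_seq u.
Proof.
  intros hn0 hu.
  assert (hv : ex_finite_lim_seq (fun n => u (n + n0)%nat + D / INR (n + n0))%R).
  { apply ex_finite_lim_seq_decr with (u n0 - D / INR n0)%R.
    - intros n. specialize (hu (n + n0)%nat ltac:(lia)).
      change (S n + n0)%nat with (S (n + n0)). split_Rabs; lra.
    - intros n.
      enough (u n0 - D / INR n0 <= u (n + n0)%nat - D / INR (n + n0)
              /\ 0 <= D / INR n0 - D / INR (n + n0)
              /\ 0 <= D / INR (n + n0))%R by lra.
      assert (hD : (0 <= D)%R).
      { specialize (hu n0 (le_n _)).
        assert (0 < / INR n0 - / INR (S n0))%R.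
        { enough (/ INR (S n0) < / INR n0)%R by lra.
          apply Rinv_lt_contravar; [|apply lt_INR; lia].
          apply Rmult_lt_0_compat; apply lt_0_INR; lia. }
        pose proof (Rabs_pos (u (S n0) - u n0)). unfold Rdiv in *. nra. }
      induction n as [|n IH].
      + rewrite Nat.add_0_l. repeat split; try lra. apply Rdiv_le_0_compat; [easy|apply lt_0_INR; lia].
      + change (S n + n0)%nat with (S (n + n0)).
        specialize (hu (n + n0)%nat ltac:(lia)).
        pose proof (Rabs_pos (u (S (n + n0)) - u (n + n0)%nat)).
        assert (0 <= D / INR (S (n + n0)))%R
          by (apply Rdiv_le_0_compat; [easy|apply lt_0_INR; lia]).
        split_Rabs; lra. }
  destruct hv as [l hl]. exists l.
  apply is_lim_seq_incr_n with n0.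
  apply is_lim_seq_ext with
    (fun n => (u (n + n0)%nat + D / INR (n + n0)) - D / INR (n + n0))%R.
  { intros; ring. }
  replace (Finite l) with (Finite (l - D * 0)%R) by (f_equal; ring).
  apply is_lim_seq_minus'; [easy|].
  apply is_lim_seq_mult'; [apply is_lim_seq_const|].
  apply (is_lim_seq_incr_n (fun n => / INR n)%R).
  replace (Finite 0) with (Rbar_inv p_infty) by reflexivity.
  apply is_lim_seq_inv; [apply is_lim_seq_INR|discriminate].
Qed.

Lemma Gamma_seq_bounded (z : C) (K : R) (n0 : nat) :
  (forall n, (n0 <= n)%nat ->
      (Cmod (Gamma_seq z (S n) - Gamma_seq z n)%C
       <= Cmod (Gamma_seq z n) * (K / INR n - K / INR (S n)))%R) ->
  (0 <= K)%R -> (1 <= n0)%nat ->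
  exists B : R, forall n, (n0 <= n)%nat -> (Cmod (Gamma_seq z n) <= B)%R.
Proof.
  intros h hK hn0. exists (Cmod (Gamma_seq z n0) * exp (K / INR n0))%R.
  assert (H : forall n, (n0 <= n)%nat ->
    (Cmod (Gamma_seq z n) * exp (K / INR n)
     <= Cmod (Gamma_seq z n0) * exp (K / INR n0))%R).
  { intros n hn; induction hn as [|n hn IH]; [lra|].
    eapply Rle_trans; [|exact IH].
    specialize (h n hn).
    pose proof (Cmod_triangle (Gamma_seq z (S n) - Gamma_seq z n) (Gamma_seq z n)) as h2.
    replace (Gamma_seq z (S n) - Gamma_seq z n + Gamma_seq z n)
      with (Gamma_seq z (S n)) in h2 by ring.
    replace (K / INR n)%R with ((K / INR n - K / INR (S n)) + K / INR (S n))%R by ring.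
    set (d := (K / INR n - K / INR (S n))%R) in *.
    rewrite exp_plus. pose proof (exp_ineq1_le d).
    pose proof (exp_pos (K / INR (S n))). pose proof (Cmod_ge_0 (Gamma_seq z n)).
    rewrite <- Rmult_assoc. apply Rmult_le_compat_r; [lra|]. nra. }
  intros n hn. specialize (H n hn).
  assert (1 <= exp (K / INR n))%R.
  { assert (0 <= K / INR n)%R by (apply Rdiv_le_0_compat; [easy|apply lt_0_INR; lia]).
    pose proof (exp_ineq1_le (K / INR n)). lra. }
  pose proof (Cmod_ge_0 (Gamma_seq z n)). nra.
Qed.

Lemma Gamma_seq_lim (z : C) : not_nonpos_int z ->
  is_lim_seq (fun n => Re (Gamma_seq z n)) (Re (Gamma z)) /\
  is_lim_seq (fun n => Im (Gamma_seq z n)) (Im (Gamma z)).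
Proof.
  intros hz. destruct (Gamma_seq_step z hz) as (K & n0 & hK & hn0 & h).
  destruct (Gamma_seq_bounded z K n0 h hK hn0) as [B hB].
  assert (hs : forall n, (n0 <= n)%nat ->
    (Cmod (Gamma_seq z (S n) - Gamma_seq z n)%C
     <= B * K / INR n - B * K / INR (S n))%R).
  { intros n hn. eapply Rle_trans; [now apply h|].
    replace (B * K / INR n - B * K / INR (S n))%R
      with (B * (K / INR n - K / INR (S n)))%R by (unfold Rdiv; ring).
    apply Rmult_le_compat_r; [|now apply hB].
    enough (/ INR (S n) <= / INR n)%R by (unfold Rdiv; nra).
    apply Rinv_le_contravar; [apply lt_0_INR; lia|apply le_INR; lia]. }
  split; simpl; apply Lim_seq_correct', ex_finite_lim_seq_step with (B * K)%R n0;
    try easy; intros n hn; (eapply Rle_trans; [|now apply hs]).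
  - apply (re_le_Cmod (Gamma_seq z (S n) - Gamma_seq z n)).
  - eapply Rle_trans; [apply Rmax_r|apply (Rmax_Cmod (Gamma_seq z (S n) - Gamma_seq z n))].
Qed.

Lemma Gamma_seq_succ_arg (z : C) (n : nat) : (1 <= n)%nat -> not_nonpos_int z ->
  Gamma_seq (z + 1) n = z * Gamma_seq z n - Gamma_seq (z + 1) n * ((z + 1) / INR n).
Proof.
  intros hn hz. assert (hn' := hn). apply le_INR in hn'; simpl in hn'.
  unfold Gamma_seq. rewrite Cpower_pos_succ by lra.
  assert (h := poch_S_l z (S n)).
  change (poch z (S (S n))) with (poch z (S n) * (z + INR (S n))) in h.
  rewrite INR_C_S in h.
  assert (hz0 : z <> 0).
  { intros h0; apply (hz O). rewrite h0. simpl. f_equal; ring. }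
  assert (hp := poch_neq_0 (z + 1) (S n) (not_nonpos_int_succ z hz)).
  assert (hp' := poch_neq_0 z (S n) hz).
  assert (h1 : RtoC (INR n) <> 0) by (intros e; apply RtoC_inj in e; lra).
  assert (hzn : z + (INR n + 1) <> 0).
  { rewrite <- INR_C_S. now apply not_nonpos_int_add. }
  replace (poch (z + 1) (S n)) with (poch z (S n) * (z + (INR n + 1)) / z)
    by (rewrite h; field; easy).
  field. repeat split; easy.
Qed.

Lemma Gamma_succ (z : C) : not_nonpos_int z -> Gamma (z + 1) = z * Gamma z.
Proof.
  intros hz.
  destruct (Gamma_seq_lim z hz) as [hr hi].
  destruct (Gamma_seq_lim (z + 1) (not_nonpos_int_succ z hz)) as [hr' hi'].
  assert (hinv : is_lim_seq (fun n => / INR n)%R 0).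
  { replace (Finite 0) with (Rbar_inv p_infty) by reflexivity.
    apply is_lim_seq_inv; [apply is_lim_seq_INR|discriminate]. }
  set (g := Gamma_seq z) in *. set (g' := Gamma_seq (z + 1)) in *.
  assert (e : forall n, (1 <= n)%nat ->
     g' n = z * g n - (g' n * (z + 1)) * RtoC (/ INR n)).
  { intros n hn. unfold g', g. rewrite Gamma_seq_succ_arg at 1 by easy.
    assert (0 < INR n)%R by (apply lt_0_INR; lia).
    rewrite RtoC_inv by lra. unfold Cdiv; ring. }
  set (p := Re z) in *. set (q := Im z) in *.
  assert (L : forall (u : nat -> R) (l l' : R),
     is_lim_seq u l -> is_lim_seq u l' -> l = l').
  { intros u l l' h1 h2. apply is_lim_seq_unique in h1, h2.
    rewrite h1 in h2. now injection h2. }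
  rewrite (surjective_pairing (Gamma (z + 1))), (surjective_pairing (z * Gamma z)).
  f_equal.
  - apply (L (fun n => Re (g' n))); [exact hr'|].
    apply is_lim_seq_ext_loc with (fun n => (p * Re (g n) - q * Im (g n))
      - (Re (g' n) * (p + 1) - Im (g' n) * q) * / INR n)%R.
    { exists 1%nat. intros n hn. rewrite (e n hn) at 3.
      unfold p, q; destruct z, (g n), (g' n); simpl; ring. }
    replace (Finite (fst (z * Gamma z))) with
      (Finite ((p * Re (Gamma z) - q * Im (Gamma z))
        - (Re (Gamma (z + 1)) * (p + 1) - Im (Gamma (z + 1)) * q) * 0))
      by (f_equal; unfold p, q, Re, Im; simpl; ring).
    repeat (apply is_lim_seq_minus' || apply is_lim_seq_mult'
            || apply is_lim_seq_const || assumption).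
  - apply (L (fun n => Im (g' n))); [exact hi'|].
    apply is_lim_seq_ext_loc with (fun n => (p * Im (g n) + q * Re (g n))
      - (Re (g' n) * q + Im (g' n) * (p + 1)) * / INR n)%R.
    { exists 1%nat. intros n hn. rewrite (e n hn) at 3.
      unfold p, q; destruct z, (g n), (g' n); simpl; ring. }
    replace (Finite (snd (z * Gamma z))) with
      (Finite ((p * Im (Gamma z) + q * Re (Gamma z))
        - (Re (Gamma (z + 1)) * q + Im (Gamma (z + 1)) * (p + 1)) * 0))
      by (f_equal; unfold p, q, Re, Im; simpl; ring).
    repeat (apply is_lim_seq_minus' || apply is_lim_seq_plus' || apply is_lim_seq_mult'
            || apply is_lim_seq_const || assumption).
Qed.

Lemma poch_Gamma (z : C) (n : nat) : not_nonpos_int z ->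
  Gamma (z + INR n) = poch z n * Gamma z.
Proof.
  intros hz; induction n as [|n IH].
  - simpl. rewrite Cplus_0_r. ring.
  - rewrite INR_C_S, Cplus_assoc, Gamma_succ.
    + rewrite IH; simpl; ring.
    + intros k h. apply (hz (n + k)%nat).
      replace z with (z + INR n - INR n) by ring.
      rewrite h, plus_INR, !RtoC_opp, RtoC_plus. ring.
Qed.

Lemma pochZ_Gamma (z : C) (n : Z) :
  not_nonpos_int z -> not_nonpos_int (z + IZR n) ->
  Gamma (z + IZR n) = pochZ z n * Gamma z.
Proof.
  intros hz hzn. destruct (Z_le_gt_dec 0 n) as [h|h].
  - rewrite <- (Z2Nat.id n h), <- INR_IZR_INZ, pochZ_nat. now apply poch_Gamma.
  - set (j := Z.to_nat (- n)).
    assert (hj : n = (- Z.of_nat j)%Z) by lia.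
    rewrite hj, opp_IZR, <- INR_IZR_INZ, RtoC_opp in hzn |- *.
    rewrite pochZ_opp.
    assert (e := poch_Gamma _ j hzn).
    replace (z + - INR j + INR j) with z in e by ring.
    rewrite e. change (z + - INR j) with (z - INR j) in *.
    field. now apply poch_neq_0.
Qed.

(* Main.v *)
Require Import Defs.
From Stdlib Require Import Reals Lra Lia ZArith.
From Coquelicot Require Import Coquelicot.
Open Scope R_scope.

(** Since [|x y|] is bounded, [x] is small and the double series may be summed over [n]
    first.  With [eta = x y] and Kummer's function [M(a,c;y)] this gives
      [Phi1 = Sum_m (b)_m / m! (eta / y)^m (d/dy)^m M(a,c;y)],
    where [(d/dy)^m M(a,c;y) = (a)_m / (c)_m M(a+m,c+m;y)].  So the whole matter is a
    compound expansion of [M], uniform up to the slit, plus control of the derivatives of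
    high order.

    The tail over [m >= N] is easy: Kummer's equation is a three-term recursion for the
    derivatives, so they grow at most like [4^m (|M| + |M'|)] as long as [m <= |y|], and for
    larger [m] the factor [(eta / y)^m] beats any exponential of [y] ([Phi1_tail]).  For
    [m < N] one inserts the expansion of [M(a+m,c+m;y)] and collects equal powers of [y]
    ([bsum_collect]); this is where the double sums defining the coefficients come from.

    On the positive axis, [exp (-r) M(a,c;r)] is the mean of [(a)_n / (c)_n] under the Poisson
    law of parameter [r].  Gauss's product says that this sequence is asymptotic to
    [Gamma c / Gamma a n^(a-c)], and Chebyshev's inequality gives the leading term
    ([poisson_limit_of_power_growth]).  Moreover [r^(c-a) exp (-r) M(a,c;r)], as a function of
    [1/r], has a derivative of the same form with [a - 1] in place of [a]; hence the complete
    expansion is a Taylor expansion at [1/r = 0] ([kummer_ray_expansion]).  Kummer's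
    transformation carries it to the negative axis.  The two rays thus provide both
    connection constants, [Gamma c / Gamma a] and [Gamma c / Gamma (c-a)].

    To reach the other directions, [M(a,c;y)] and [M(a+1,c;y)] are compared with truncated
    sums along a path from [-r] to [r].  The contiguous relations turn the two remainders,
    suitably normalised, into a first-order system with coupling of order [r^(-2)] on a path of
    length of order [r], driven by the first omitted terms.  One remainder is known to be small
    at [-r] and the other at [r]; such a two-point problem is stable because each equation is
    integrated in the direction in which its forcing grows ([two_point_bound]). *)


(** * Absolutely convergent series and exponential generating functions *)

Ltac max_lra :=
  repeat match goal with
    | |- context [Rmax ?u ?v] => pose proof (Rmax_l u v); pose proof (Rmax_r u v);
        generalize dependent (Rmax u v); intros
    | H : context [Rmax ?u ?v] |- _ => pose proof (Rmax_l u v); pose proof (Rmax_r u v);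
        generalize dependent (Rmax u v); intros
    end; lra.

Lemma Cmod_sub_le (u v : C) : Cmod (u - v)%C <= Cmod u + Cmod v.
Proof.
  eapply Rle_trans; [apply Cmod_triangle|]. rewrite Cmod_opp; lra.
Qed.

Lemma Cmod_sub_sym (u v : C) : Cmod (u - v)%C = Cmod (v - u)%C.
Proof. rewrite <- Cmod_opp. f_equal. ring. Qed.

Lemma Cmod_INR (n : nat) : Cmod (INR n) = INR n.
Proof. rewrite Cmod_R, Rabs_pos_eq; [easy|apply pos_INR]. Qed.

Lemma Im_le_Cmod (z : C) : Rabs (Im z) <= Cmod z.
Proof. eapply Rle_trans; [apply Rmax_r|apply (Rmax_Cmod z)]. Qed.

Lemma RtoC_neq_0 (r : R) : r <> 0 -> RtoC r <> 0%C.
Proof. intros h e. apply h. now apply RtoC_inj. Qed.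

Lemma INR_fact_neq_0_C (n : nat) : RtoC (INR (fact n)) <> 0%C.
Proof. apply RtoC_neq_0, INR_fact_neq_0. Qed.

Lemma INR_S_neq_0_C (n : nat) : (RtoC (INR n) + 1)%C <> 0%C.
Proof. rewrite <- INR_C_S. apply RtoC_neq_0, not_0_INR. lia. Qed.

Definition abs_summable (u : nat -> C) : Prop := ex_series (fun n => Cmod (u n)).

Lemma abs_summable_le (u : nat -> C) (v : nat -> R) :
  (forall n, Cmod (u n) <= v n) -> ex_series v -> abs_summable u.
Proof.
  intros h hv. apply (ex_series_le (V := R_CompleteNormedModule) _ v); [|exact hv].
  intros n. change (norm (Cmod (u n))) with (Rabs (Cmod (u n))).
  rewrite Rabs_pos_eq; [apply h|apply Cmod_ge_0].
Qed.

Lemma abs_summable_Re (u : nat -> C) :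
  abs_summable u -> ex_series (fun n => Re (u n)).
Proof.
  intros h. apply (ex_series_le (V := R_CompleteNormedModule) _ (fun n => Cmod (u n)));
    [|exact h]. intros n. apply re_le_Cmod.
Qed.

Lemma abs_summable_Im (u : nat -> C) :
  abs_summable u -> ex_series (fun n => Im (u n)).
Proof.
  intros h. apply (ex_series_le (V := R_CompleteNormedModule) _ (fun n => Cmod (u n)));
    [|exact h]. intros n. apply Im_le_Cmod.
Qed.

Lemma CSeries_ext (u v : nat -> C) :
  (forall n, u n = v n) -> CSeries u = CSeries v.
Proof.
  intros h. unfold CSeries. f_equal; apply Series_ext; intros n; now rewrite h.
Qed.

Lemma CSeries_plus (u v : nat -> C) : abs_summable u -> abs_summable v ->
  CSeries (fun n => u n + v n)%C = (CSeries u + CSeries v)%C.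
Proof.
  intros hu hv. unfold CSeries, Cplus; simpl. f_equal.
  - rewrite <- Series_plus; [easy|now apply abs_summable_Re|now apply abs_summable_Re].
  - rewrite <- Series_plus; [easy|now apply abs_summable_Im|now apply abs_summable_Im].
Qed.

Lemma CSeries_scal (w : C) (u : nat -> C) : abs_summable u ->
  CSeries (fun n => w * u n)%C = (w * CSeries u)%C.
Proof.
  intros hu. assert (h1 := abs_summable_Re u hu). assert (h2 := abs_summable_Im u hu).
  unfold CSeries, Cmult; simpl. f_equal.
  - rewrite <- !Series_scal_l, <- Series_minus; [easy| |];
      now apply (ex_series_scal (V := R_NormedModule)).
  - rewrite <- !Series_scal_l, <- Series_plus; [easy| |];
      now apply (ex_series_scal (V := R_NormedModule)).
Qed.

Lemma CSeries_minus (u v : nat -> C) : abs_summable u -> abs_summable v ->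
  CSeries (fun n => u n - v n)%C = (CSeries u - CSeries v)%C.
Proof.
  intros hu hv.
  rewrite (CSeries_ext _ (fun n => u n + - (1) * v n)%C)
    by (intros n; ring).
  rewrite CSeries_plus, CSeries_scal; [ring|easy|easy|].
  apply abs_summable_le with (2 := hv). intros n.
  rewrite Cmod_mult, Cmod_opp, Cmod_1. lra.
Qed.

Lemma abs_summable_minus (u v : nat -> C) : abs_summable u -> abs_summable v ->
  abs_summable (fun n => u n - v n)%C.
Proof.
  intros hu hv. apply abs_summable_le with (fun n => Cmod (u n) + Cmod (v n)).
  - intros n. apply Cmod_sub_le.
  - now apply (ex_series_plus (V := R_NormedModule)).
Qed.

Lemma CSeries_incr_1 (u : nat -> C) : abs_summable u ->
  CSeries u = (u O + CSeries (fun n => u (S n)))%C.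
Proof.
  intros hu. unfold CSeries, Cplus; simpl. f_equal.
  - apply (Series_incr_1 (fun n => Re (u n))). now apply abs_summable_Re.
  - apply (Series_incr_1 (fun n => Im (u n))). now apply abs_summable_Im.
Qed.

Lemma abs_summable_incr_n (u : nat -> C) (N : nat) : abs_summable u ->
  abs_summable (fun n => u (N + n)%nat).
Proof. intros h. unfold abs_summable. now apply (ex_series_incr_n (fun n => Cmod (u n))). Qed.

Lemma Cmod_rotation (z : C) : exists w : C, Cmod w = 1 /\ (w * z)%C = RtoC (Cmod z).
Proof.
  destruct (Ceq_dec z 0) as [->|e].
  { exists 1%C. rewrite Cmod_0, Cmod_1. split; [easy|ring]. }
  assert (h0 : 0 < Cmod z) by now apply Cmod_gt_0.
  assert (hz : RtoC (Cmod z) <> 0%C) by (apply RtoC_neq_0; lra).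
  exists (Cconj z / Cmod z)%C. split.
  - rewrite Cmod_div by easy. rewrite Cmod_R, Rabs_pos_eq, Cmod_conj by lra. field; lra.
  - assert (hc : (Cconj z * z)%C = RtoC (Cmod z * Cmod z)).
    { replace (Cmod z * Cmod z) with (Rsqr (Cmod z)) by reflexivity.
      unfold Cmod. rewrite Rsqr_sqrt.
      - destruct z as [p q]; unfold Cconj, Cmult, RtoC; simpl; f_equal; ring.
      - pose proof (pow2_ge_0 (fst z)); pose proof (pow2_ge_0 (snd z)); lra. }
    replace (Cconj z / Cmod z * z)%C with ((Cconj z * z) / Cmod z)%C by (field; easy).
    rewrite hc, RtoC_mult. field. easy.
Qed.

(** After a rotation that makes the sum positive, this is the real triangle inequality. *)
Lemma Cmod_CSeries (u : nat -> C) : abs_summable u ->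
  Cmod (CSeries u) <= Series (fun n => Cmod (u n)).
Proof.
  intros hu. destruct (Cmod_rotation (CSeries u)) as (w & hw & hS).
  rewrite <- CSeries_scal in hS by exact hu.
  apply (f_equal Re) in hS.
  change (Series (fun n => Re (w * u n)%C) = Cmod (CSeries u)) in hS. rewrite <- hS.
  assert (hn : forall n, Rabs (Re (w * u n)%C) <= Cmod (u n)).
  { intros n. eapply Rle_trans; [apply re_le_Cmod|]. rewrite Cmod_mult, hw; lra. }
  eapply Rle_trans; [apply Rle_abs|].
  eapply Rle_trans; [apply Series_Rabs|].
  - apply (ex_series_le (V := R_CompleteNormedModule) _ (fun n => Cmod (u n))); [|exact hu].
    intros n. change (norm (Rabs (Re (w * u n)%C))) with (Rabs (Rabs (Re (w * u n)%C))).
    rewrite Rabs_Rabsolu. apply hn.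
  - apply Series_le; [|exact hu]. intros n; split; [apply Rabs_pos|apply hn].
Qed.

Lemma Cmod_CSeries_le (u : nat -> C) (v : nat -> R) :
  (forall n, Cmod (u n) <= v n) -> ex_series v -> Cmod (CSeries u) <= Series v.
Proof.
  intros h hv. eapply Rle_trans; [apply Cmod_CSeries; now apply abs_summable_le with v|].
  apply Series_le; [|exact hv]. intros n; split; [apply Cmod_ge_0|apply h].
Qed.

(** Finite sums with [n] terms; unlike [sum_n] they can be empty. *)
Fixpoint bsum (f : nat -> C) (n : nat) : C :=
  match n with O => 0%C | S k => (bsum f k + f k)%C end.

Lemma bsum_sum_n (f : nat -> C) (n : nat) : bsum f (S n) = sum_n f n.
Proof.
  induction n as [|n IH].
  - rewrite sum_O. cbn [bsum]. apply Cplus_0_l.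
  - rewrite sum_Sn, <- IH. reflexivity.
Qed.

Lemma bsum_ext (f g : nat -> C) (n : nat) :
  (forall k, (k < n)%nat -> f k = g k) -> bsum f n = bsum g n.
Proof.
  induction n as [|n IH]; intros h; [easy|]. simpl. rewrite IH, h; auto.
Qed.

Lemma bsum_scal (w : C) (f : nat -> C) (n : nat) :
  bsum (fun k => w * f k)%C n = (w * bsum f n)%C.
Proof. induction n as [|n IH]; simpl; [ring|rewrite IH; ring]. Qed.

Lemma bsum_plus (f g : nat -> C) (n : nat) :
  bsum (fun k => f k + g k)%C n = (bsum f n + bsum g n)%C.
Proof. induction n as [|n IH]; simpl; [ring|rewrite IH; ring]. Qed.

Lemma bsum_S_l (f : nat -> C) (n : nat) :
  bsum f (S n) = (f O + bsum (fun k => f (S k)) n)%C.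
Proof.
  induction n as [|n IH]; [simpl; ring|].
  change (bsum f (S (S n))) with (bsum f (S n) + f (S n))%C. rewrite IH. simpl. ring.
Qed.

Lemma bsum_add (f : nat -> C) (m n : nat) :
  bsum f (m + n) = (bsum f m + bsum (fun k => f (m + k)%nat) n)%C.
Proof.
  induction n as [|n IH].
  - rewrite Nat.add_0_r. simpl. ring.
  - rewrite Nat.add_succ_r. simpl. rewrite IH. ring.
Qed.

Lemma Cmod_bsum_le (f : nat -> C) (B : R) (n : nat) :
  (forall k, (k < n)%nat -> Cmod (f k) <= B) -> Cmod (bsum f n) <= INR n * B.
Proof.
  induction n as [|n IH]; intros h.
  - simpl. rewrite Cmod_0. lra.
  - rewrite S_INR. simpl. eapply Rle_trans; [apply Cmod_triangle|].
    specialize (IH ltac:(auto)). specialize (h n ltac:(lia)). lra.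
Qed.

Lemma CSeries_split (u : nat -> C) (N : nat) : abs_summable u ->
  CSeries u = (bsum u N + CSeries (fun n => u (N + n)%nat))%C.
Proof.
  intros hu. induction N as [|N IH]; [symmetry; apply Cplus_0_l|].
  rewrite IH, (CSeries_incr_1 (fun n => u (N + n)%nat)) by now apply abs_summable_incr_n.
  cbn [bsum]. rewrite Nat.add_0_r.
  rewrite (CSeries_ext (fun n => u (S N + n)%nat) (fun n => u (N + S n)%nat))
    by (intros n; f_equal; lia).
  ring.
Qed.

(** Exactly what makes the exponential generating function entire of exponential type. *)
Definition geom_growth (f : nat -> C) : Prop :=
  exists K q : R, 0 <= K /\ 1 <= q /\ forall n, Cmod (f n) <= K * q ^ n.

(** On these functions differentiation shifts the sequence, and multiplication by the
    variable is [f n |-> n f (n-1)]; differential relations become termwise identities. *)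
Definition egf (f : nat -> C) (y : C) : C :=
  CSeries (fun n => f n * (y ^ n / INR (fact n)))%C.

Lemma exp_is_series (x : R) : is_series (fun n => x ^ n / INR (fact n)) (exp x).
Proof.
  apply (is_series_ext (V := R_NormedModule) (fun n => / INR (fact n) * x ^ n)).
  { intros n. apply Rmult_comm. }
  apply is_pseries_R, is_exp_Reals.
Qed.

Lemma exp_ex_series (x : R) : ex_series (fun n => x ^ n / INR (fact n)).
Proof. exists (exp x). apply exp_is_series. Qed.

Lemma exp_series (x : R) : Series (fun n => x ^ n / INR (fact n)) = exp x.
Proof. apply is_series_unique, exp_is_series. Qed.

Lemma ex_series_scal_R (w : R) (u : nat -> R) :
  ex_series u -> ex_series (fun n => w * u n).
Proof. apply (ex_series_scal (V := R_NormedModule)). Qed.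

Lemma Cmod_pow_fact (y : C) (n : nat) :
  Cmod (y ^ n / INR (fact n))%C = Cmod y ^ n / INR (fact n).
Proof.
  rewrite Cmod_div by apply INR_fact_neq_0_C. now rewrite Cmod_pow, Cmod_INR.
Qed.

Lemma egf_term_le (f : nat -> C) (K q : R) (y : C) (n : nat) :
  Cmod (f n) <= K * q ^ n ->
  Cmod (f n * (y ^ n / INR (fact n)))%C <= K * ((q * Cmod y) ^ n / INR (fact n)).
Proof.
  intros h. rewrite Cmod_mult, Cmod_pow_fact, Rpow_mult_distr.
  replace (K * (q ^ n * Cmod y ^ n / INR (fact n)))
    with (K * q ^ n * (Cmod y ^ n / INR (fact n))) by (unfold Rdiv; ring).
  apply Rmult_le_compat_r; [|exact h].
  apply Rdiv_le_0_compat; [apply pow_le, Cmod_ge_0|apply INR_fact_lt_0].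
Qed.

Lemma egf_summable (f : nat -> C) (y : C) : geom_growth f ->
  abs_summable (fun n => f n * (y ^ n / INR (fact n)))%C.
Proof.
  intros (K & q & hK & hq & h).
  eapply abs_summable_le; [intros n; apply egf_term_le, h|].
  apply ex_series_scal_R, exp_ex_series.
Qed.

Lemma egf_bound (f : nat -> C) (K q : R) (y : C) :
  (forall n, Cmod (f n) <= K * q ^ n) -> Cmod (egf f y) <= K * exp (q * Cmod y).
Proof.
  intros h. rewrite <- exp_series, <- Series_scal_l.
  apply Cmod_CSeries_le; [intros n; apply egf_term_le, h|].
  apply ex_series_scal_R, exp_ex_series.
Qed.

Lemma egf_ext (f g : nat -> C) (y : C) :
  (forall n, f n = g n) -> egf f y = egf g y.
Proof. intros h. apply CSeries_ext; intros n; now rewrite h. Qed.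

Lemma egf_plus (f g : nat -> C) (y : C) : geom_growth f -> geom_growth g ->
  egf (fun n => f n + g n)%C y = (egf f y + egf g y)%C.
Proof.
  intros hf hg. unfold egf. rewrite <- CSeries_plus by now apply egf_summable.
  apply CSeries_ext; intros n. ring.
Qed.

Lemma egf_scal (w : C) (f : nat -> C) (y : C) : geom_growth f ->
  egf (fun n => w * f n)%C y = (w * egf f y)%C.
Proof.
  intros hf. unfold egf. rewrite <- CSeries_scal by now apply egf_summable.
  apply CSeries_ext; intros n. ring.
Qed.

Lemma geom_growth_plus (f g : nat -> C) : geom_growth f -> geom_growth g ->
  geom_growth (fun n => f n + g n)%C.
Proof.
  intros (K & q & hK & hq & h) (K' & q' & hK' & hq' & h').
  exists (K + K'), (Rmax q q'). pose proof (Rmax_l q q'). pose proof (Rmax_r q q').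
  repeat split; try lra. intros n. eapply Rle_trans; [apply Cmod_triangle|].
  specialize (h n); specialize (h' n).
  assert (q ^ n <= Rmax q q' ^ n) by (apply pow_incr; lra).
  assert (q' ^ n <= Rmax q q' ^ n) by (apply pow_incr; lra). nra.
Qed.

Lemma geom_growth_scal (w : C) (f : nat -> C) : geom_growth f ->
  geom_growth (fun n => w * f n)%C.
Proof.
  intros (K & q & hK & hq & h). exists (Cmod w * K), q.
  pose proof (Cmod_ge_0 w). repeat split; [nra|lra|].
  intros n. rewrite Cmod_mult, Rmult_assoc. apply Rmult_le_compat_l; [easy|apply h].
Qed.

Lemma geom_growth_shift (f : nat -> C) (m : nat) : geom_growth f ->
  geom_growth (fun n => f (n + m)%nat).
Proof.
  intros (K & q & hK & hq & h). exists (K * q ^ m), q.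
  assert (0 < q ^ m) by (apply pow_lt; lra). repeat split; [nra|easy|].
  intros n. eapply Rle_trans; [apply h|]. rewrite pow_add. right; ring.
Qed.

Lemma geom_growth_succ (f : nat -> C) : geom_growth f -> geom_growth (fun n => f (S n)).
Proof.
  intros hf. destruct (geom_growth_shift f 1 hf) as (K & q & hK & hq & h).
  exists K, q. repeat split; try easy. intros n. specialize (h n).
  now rewrite Nat.add_1_r in h.
Qed.

Lemma INR_le_pow2 (n : nat) : INR n <= 2 ^ n.
Proof.
  induction n as [|n IH]; [simpl; lra|]. rewrite S_INR. simpl.
  assert (1 <= 2 ^ n) by (apply pow_R1_Rle; lra). lra.
Qed.

Lemma geom_growth_mul_INR (f : nat -> C) : geom_growth f ->
  geom_growth (fun n => INR n * f n)%C.
Proof.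
  intros (K & q & hK & hq & h). exists K, (2 * q). repeat split; [easy|lra|].
  intros n. rewrite Cmod_mult, Cmod_INR, Rpow_mult_distr.
  pose proof (INR_le_pow2 n). specialize (h n). pose proof (Cmod_ge_0 (f n)).
  pose proof (pos_INR n). apply Rle_trans with (2 ^ n * (K * q ^ n)); [|right; ring].
  apply Rmult_le_compat; lra.
Qed.

Lemma geom_growth_pred (f : nat -> C) : geom_growth f ->
  geom_growth (fun n => f (pred n)).
Proof.
  intros (K & q & hK & hq & h). exists K, q. repeat split; [easy|easy|].
  intros n. eapply Rle_trans; [apply h|]. apply Rmult_le_compat_l; [easy|].
  apply Rle_pow; [easy|lia].
Qed.

Lemma egf_mul_var (f : nat -> C) (y : C) : geom_growth f ->
  egf (fun n => INR n * f (pred n))%C y = (y * egf f y)%C.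
Proof.
  intros hf. unfold egf at 1. rewrite CSeries_incr_1.
  - simpl INR at 1. rewrite Cmult_0_l, Cmult_0_l, Cplus_0_l.
    unfold egf. rewrite <- CSeries_scal by now apply egf_summable.
    apply CSeries_ext; intros n. simpl pred.
    rewrite fact_simpl, mult_INR, RtoC_mult, INR_C_S. simpl Cpow.
    field. split; [apply INR_fact_neq_0_C|apply INR_S_neq_0_C].
  - apply egf_summable. apply (geom_growth_mul_INR (fun n => f (pred n))).
    now apply geom_growth_pred.
Qed.

Lemma Cpow_add_remainder (y h : C) (n : nat) : Cmod h <= 1 ->
  Cmod ((y + h) ^ S n - y ^ S n - INR (S n) * h * y ^ n)%C
  <= Cmod h ^ 2 * (4 * (Cmod y + 1)) ^ S n.
Proof.
  intros hh. pose proof (Cmod_ge_0 h) as h0. pose proof (Cmod_ge_0 y) as y0.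
  set (rho := Cmod y + 1). assert (hrho : 1 <= rho) by (unfold rho; lra).
  assert (p3 : 0 <= Cmod h ^ 2) by apply pow2_ge_0.
  induction n as [|n IH].
  - replace ((y + h) ^ 1 - y ^ 1 - INR 1 * h * y ^ 0)%C with (RtoC 0) by (simpl; ring).
    rewrite Cmod_0. apply Rmult_le_pos; [easy|]. apply pow_le. lra.
  - set (del := ((y + h) ^ S n - y ^ S n - INR (S n) * h * y ^ n)%C) in *.
    replace ((y + h) ^ S (S n) - y ^ S (S n) - INR (S (S n)) * h * y ^ S n)%C
      with ((y + h) * del + h ^ 2 * (INR (S n) * y ^ n))%C
      by (unfold del; rewrite (INR_C_S (S n)); simpl; ring).
    eapply Rle_trans; [apply Cmod_triangle|]. rewrite !Cmod_mult, Cmod_INR, !Cmod_pow.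
    set (Q := (4 * rho) ^ S n) in *.
    assert (e1 : Cmod (y + h)%C <= rho)
      by (eapply Rle_trans; [apply Cmod_triangle|unfold rho; lra]).
    assert (e2 : INR (S n) * Cmod y ^ n <= Q).
    { unfold Q. rewrite Rpow_mult_distr. apply Rmult_le_compat; [apply pos_INR|now apply pow_le| |].
      - eapply Rle_trans; [apply INR_le_pow2|]. apply pow_incr; lra.
      - apply Rle_trans with (rho ^ n); [apply pow_incr; unfold rho; lra|].
        apply Rle_pow; [easy|lia]. }
    assert (hQ : 0 <= Q) by (apply pow_le; lra).
    assert (hQ2 : 0 <= Cmod h ^ 2 * Q) by now apply Rmult_le_pos.
    apply Rle_trans with (rho * (Cmod h ^ 2 * Q) + Cmod h ^ 2 * Q).
    + apply Rplus_le_compat; [|now apply Rmult_le_compat_l].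
      apply Rmult_le_compat; try apply Cmod_ge_0; easy.
    + change ((4 * rho) ^ S (S n)) with (4 * rho * Q). nra.
Qed.

(** Complex differentiability with a quadratic remainder, which restricts well to
    curves with a real parameter. *)
Lemma egf_diff (f : nat -> C) (y : C) : geom_growth f ->
  exists K : R, forall h : C, Cmod h <= 1 ->
    Cmod (egf f (y + h) - egf f y - h * egf (fun n => f (S n)) y)%C <= K * Cmod h ^ 2.
Proof.
  intros hf. assert (hs := geom_growth_succ f hf).
  assert (hf' := hf). destruct hf' as (K & q & hK & hq & hb).
  set (rho := q * (4 * (Cmod y + 1))). exists (K * exp rho). intros h hh.
  assert (hS : forall n, RtoC (INR (S n)) <> 0%C)
    by (intros n; apply RtoC_neq_0, not_0_INR; lia).
  set (del := fun n => ((y + h) ^ S n - y ^ S n - INR (S n) * h * y ^ n)%C).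
  assert (e : (egf f (y + h) - egf f y - h * egf (fun n => f (S n)) y)%C =
    CSeries (fun n => f (S n) / INR (fact (S n)) * del n)%C).
  { assert (s1 := egf_summable f (y + h) hf). assert (s2 := egf_summable f y hf).
    assert (s1' := abs_summable_incr_n _ 1 s1). assert (s2' := abs_summable_incr_n _ 1 s2).
    assert (s3 := egf_summable _ y hs).
    unfold egf. rewrite (CSeries_incr_1 _ s1), (CSeries_incr_1 _ s2).
    rewrite <- CSeries_scal by exact s3.
    match goal with |- ((?z + ?A) - (?z' + ?B) - ?D = _)%C =>
      replace (z + A - (z' + B) - D)%C with (A - B - D)%C by (simpl; ring) end.
    rewrite <- CSeries_minus, <- CSeries_minus.
    - apply CSeries_ext; intros n. unfold del.
      rewrite fact_simpl, mult_INR, RtoC_mult. field. split; [apply INR_fact_neq_0_C|apply hS].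
    - now apply abs_summable_minus.
    - apply abs_summable_le with (fun n => Cmod h * Cmod (f (S n) * (y ^ n / INR (fact n)))%C).
      + intros n. rewrite Cmod_mult. lra.
      + now apply ex_series_scal_R.
    - exact s1'.
    - exact s2'. }
  rewrite e. set (v := fun n => rho ^ n / INR (fact n)).
  assert (hv : ex_series (fun n => v (S n))) by (apply (ex_series_incr_1 v), exp_ex_series).
  assert (hv1 : Series (fun n => v (S n)) <= exp rho).
  { rewrite <- exp_series. fold v. rewrite (Series_incr_1 v) by apply exp_ex_series.
    unfold v at 2. simpl. lra. }
  apply Rle_trans with (K * Cmod h ^ 2 * Series (fun n => v (S n))).
  2:{ replace (K * exp rho * Cmod h ^ 2) with (K * Cmod h ^ 2 * exp rho) by ring.
      apply Rmult_le_compat_l; [apply Rmult_le_pos; [easy|apply pow2_ge_0]|exact hv1]. }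
  rewrite <- Series_scal_l. apply Cmod_CSeries_le; [|now apply ex_series_scal_R].
  intros n. rewrite Cmod_mult, Cmod_div, Cmod_INR by apply INR_fact_neq_0_C.
  pose proof (Cpow_add_remainder y h n hh) as hr. fold (del n) in hr.
  unfold v, rho. rewrite Rpow_mult_distr.
  replace (K * Cmod h ^ 2 * (q ^ S n * (4 * (Cmod y + 1)) ^ S n / INR (fact (S n))))
    with ((K * q ^ S n) / INR (fact (S n)) * (Cmod h ^ 2 * (4 * (Cmod y + 1)) ^ S n))
    by (unfold Rdiv; ring).
  apply Rmult_le_compat; [|apply Cmod_ge_0| |exact hr].
  - apply Rdiv_le_0_compat; [apply Cmod_ge_0|apply INR_fact_lt_0].
  - apply Rmult_le_compat_r; [|apply hb]. left; apply Rinv_0_lt_compat, INR_fact_lt_0.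
Qed.

(** * Complex-valued functions of a real parameter *)

(** Coordinatewise, so that the real theory applies; the parameter is real while the
    functions restricted to the path are holomorphic. *)
Definition is_Cderive (F : R -> C) (t : R) (d : C) : Prop :=
  is_derive (fun u => Re (F u)) t (Re d) /\ is_derive (fun u => Im (F u)) t (Im d).

Lemma is_Cderive_eq (F : R -> C) (t : R) (d d' : C) :
  is_Cderive F t d -> d = d' -> is_Cderive F t d'.
Proof. now intros h <-. Qed.

Lemma is_Cderive_ext (F G : R -> C) (t : R) (d : C) :
  (forall u, F u = G u) -> is_Cderive F t d -> is_Cderive G t d.
Proof.
  intros h [h1 h2]. split.
  - apply is_derive_ext with (2 := h1). intros u. now rewrite h.
  - apply is_derive_ext with (2 := h2). intros u. now rewrite h.
Qed.

Lemma is_derive_Rconst (w t : R) : is_derive (fun _ : R => w) t 0.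
Proof. apply (is_derive_const (V := R_NormedModule)). Qed.

Lemma is_derive_Rplus (f g : R -> R) (t d e : R) :
  is_derive f t d -> is_derive g t e -> is_derive (fun u => f u + g u) t (d + e).
Proof. apply (is_derive_plus (V := R_NormedModule)). Qed.

Lemma is_derive_Rminus (f g : R -> R) (t d e : R) :
  is_derive f t d -> is_derive g t e -> is_derive (fun u => f u - g u) t (d - e).
Proof. apply (is_derive_minus (V := R_NormedModule)). Qed.

Lemma is_derive_Ropp (f : R -> R) (t d : R) :
  is_derive f t d -> is_derive (fun u => - f u) t (- d).
Proof. apply (is_derive_opp (V := R_NormedModule)). Qed.

Lemma is_derive_Rmult (f g : R -> R) (t d e : R) :
  is_derive f t d -> is_derive g t e ->
  is_derive (fun u => f u * g u) t (d * g t + f t * e).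
Proof. intros h1 h2. apply (is_derive_mult (K := R_AbsRing) f g t d e h1 h2 Rmult_comm). Qed.

Lemma is_Cderive_const (w : C) (t : R) : is_Cderive (fun _ => w) t 0%C.
Proof. split; [exact (is_derive_Rconst (Re w) t)|exact (is_derive_Rconst (Im w) t)]. Qed.

Lemma is_Cderive_RtoC (g : R -> R) (t d : R) :
  is_derive g t d -> is_Cderive (fun u => RtoC (g u)) t (RtoC d).
Proof. intros h. split; [exact h|exact (is_derive_Rconst 0 t)]. Qed.

Lemma is_Cderive_plus (F G : R -> C) (t : R) (d e : C) :
  is_Cderive F t d -> is_Cderive G t e ->
  is_Cderive (fun u => F u + G u)%C t (d + e)%C.
Proof.
  intros [h1 h2] [h3 h4]. split.
  - exact (is_derive_Rplus _ _ _ _ _ h1 h3).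
  - exact (is_derive_Rplus _ _ _ _ _ h2 h4).
Qed.

Lemma is_Cderive_minus (F G : R -> C) (t : R) (d e : C) :
  is_Cderive F t d -> is_Cderive G t e ->
  is_Cderive (fun u => F u - G u)%C t (d - e)%C.
Proof.
  intros [h1 h2] [h3 h4]. split.
  - exact (is_derive_Rminus _ _ _ _ _ h1 h3).
  - exact (is_derive_Rminus _ _ _ _ _ h2 h4).
Qed.

Lemma is_Cderive_mult (F G : R -> C) (t : R) (d e : C) :
  is_Cderive F t d -> is_Cderive G t e ->
  is_Cderive (fun u => F u * G u)%C t (d * G t + F t * e)%C.
Proof.
  intros [h1 h2] [h3 h4]. split.
  - replace (Re (d * G t + F t * e)%C) with
      ((Re d * Re (G t) + Re (F t) * Re e) - (Im d * Im (G t) + Im (F t) * Im e))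
      by (simpl; unfold Re, Im; ring).
    apply (is_derive_Rminus (fun u => Re (F u) * Re (G u)) (fun u => Im (F u) * Im (G u)));
      now apply is_derive_Rmult.
  - replace (Im (d * G t + F t * e)%C) with
      ((Re d * Im (G t) + Re (F t) * Im e) + (Im d * Re (G t) + Im (F t) * Re e))
      by (simpl; unfold Re, Im; ring).
    apply (is_derive_Rplus (fun u => Re (F u) * Im (G u)) (fun u => Im (F u) * Re (G u)));
      now apply is_derive_Rmult.
Qed.

Lemma is_Cderive_scal (w : C) (F : R -> C) (t : R) (d : C) :
  is_Cderive F t d -> is_Cderive (fun u => w * F u)%C t (w * d)%C.
Proof.
  intros h. eapply is_Cderive_eq; [apply (is_Cderive_mult (fun _ => w) F);
    [apply is_Cderive_const|exact h]|ring].
Qed.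

Lemma is_Cderive_exp (F : R -> C) (t : R) (d : C) :
  is_Cderive F t d -> is_Cderive (fun u => Cexp (F u)) t (d * Cexp (F t))%C.
Proof.
  intros [h1 h2].
  assert (d1 : is_derive (fun u => exp (Re (F u))) t (Re d * exp (Re (F t)))).
  { apply (is_derive_comp exp (fun u => Re (F u))); [apply is_derive_exp|exact h1]. }
  assert (d2 : is_derive (fun u => cos (Im (F u))) t (Im d * - sin (Im (F t)))).
  { apply (is_derive_comp cos (fun u => Im (F u))); [apply is_derive_cos|exact h2]. }
  assert (d3 : is_derive (fun u => sin (Im (F u))) t (Im d * cos (Im (F t)))).
  { apply (is_derive_comp sin (fun u => Im (F u))); [apply is_derive_sin|exact h2]. }
  split.
  - replace (Re (d * Cexp (F t))%C) with
      (Re d * exp (Re (F t)) * cos (Im (F t))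
       + exp (Re (F t)) * (Im d * - sin (Im (F t))))
      by (unfold Cexp, Re, Im; simpl; ring).
    apply (is_derive_Rmult (fun u => exp (Re (F u))) (fun u => cos (Im (F u)))); assumption.
  - replace (Im (d * Cexp (F t))%C) with
      (Re d * exp (Re (F t)) * sin (Im (F t))
       + exp (Re (F t)) * (Im d * cos (Im (F t))))
      by (unfold Cexp, Re, Im; simpl; ring).
    apply (is_derive_Rmult (fun u => exp (Re (F u))) (fun u => sin (Im (F u)))); assumption.
Qed.

(** The difference quotients of [e] at its zero are dominated by those of [q]. *)
Lemma is_derive_squeeze (e q : R -> R) (t : R) :
  locally t (fun u => Rabs (e u) <= q u) -> q t = 0 -> is_derive q t 0 ->
  is_derive e t 0.
Proof.
  intros hl h0 hq. assert (he : e t = 0).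
  { apply locally_singleton in hl. rewrite h0 in hl. split_Rabs; lra. }
  apply is_derive_Reals. apply is_derive_Reals in hq. intros eps heps.
  destruct (hq eps heps) as [d1 hd1]. destruct hl as [d2 hd2].
  assert (hd : 0 < Rmin d1 d2) by (apply Rmin_pos; apply cond_pos).
  exists (mkposreal _ hd). simpl. intros h hh hlt.
  specialize (hd1 h hh ltac:(eapply Rlt_le_trans; [exact hlt|apply Rmin_l])).
  assert (hb : Rabs (e (t + h)) <= q (t + h)).
  { apply hd2. unfold ball; simpl. unfold AbsRing_ball, abs, minus, plus, opp; simpl.
    replace (t + h + - t) with h by ring.
    eapply Rlt_le_trans; [exact hlt|apply Rmin_r]. }
  rewrite h0 in hd1. rewrite he.
  eapply Rle_lt_trans; [|exact hd1].
  unfold Rdiv. rewrite !Rminus_0_r, !Rabs_mult.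
  apply Rmult_le_compat_r; [apply Rabs_pos|].
  eapply Rle_trans; [exact hb|apply Rle_abs].
Qed.

Lemma is_derive_continuous (f : R -> R) (t d : R) : is_derive f t d -> continuous f t.
Proof. intros h. apply (ex_derive_continuous (V := R_NormedModule)). now exists d. Qed.

(** The chain rule needs only a quadratic remainder at one point: the squared modulus of the
    increment has derivative [0] there. *)
Lemma is_Cderive_comp (F : C -> C) (y : R -> C) (t : R) (d D : C) (K : R) :
  (forall h, Cmod h <= 1 -> Cmod (F (y t + h) - F (y t) - h * D)%C <= K * Cmod h ^ 2) ->
  is_Cderive y t d -> is_Cderive (fun u => F (y u)) t (d * D)%C.
Proof.
  intros hF hy. set (h := fun u => (y u - y t)%C).
  set (e := fun u => (F (y u) - F (y t) - h u * D)%C).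
  set (n2 := fun u => Re (h u) * Re (h u) + Im (h u) * Im (h u)).
  assert (hd : is_Cderive h t d).
  { eapply is_Cderive_eq; [apply is_Cderive_minus; [exact hy|apply is_Cderive_const]|ring]. }
  assert (h0 : h t = 0%C) by (unfold h; ring).
  assert (hn : is_derive n2 t 0).
  { destruct hd as [d1 d2].
    replace 0 with ((Re d * Re (h t) + Re (h t) * Re d) + (Im d * Im (h t) + Im (h t) * Im d))
      by (rewrite h0; simpl; ring).
    apply (is_derive_Rplus (fun u => Re (h u) * Re (h u)) (fun u => Im (h u) * Im (h u)));
      now apply is_derive_Rmult. }
  assert (hm : forall u, Cmod (h u) ^ 2 = n2 u).
  { intros u. unfold Cmod, n2. rewrite pow2_sqrt; [unfold Re, Im; ring|].
    pose proof (pow2_ge_0 (fst (h u))); pose proof (pow2_ge_0 (snd (h u))); lra. }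
  assert (hb : locally t (fun u => Cmod (e u) <= K * n2 u)).
  { assert (hc : continuous n2 t) by now apply is_derive_continuous with 0.
    assert (hl : locally t (fun u => n2 u < 1)).
    { apply (hc (fun v => v < 1)). apply (open_lt 1). unfold n2. rewrite h0. simpl. lra. }
    revert hl. apply filter_imp. intros u hu.
    rewrite <- hm. unfold e. replace (y u) with (y t + h u)%C at 1 by (unfold h; ring).
    apply hF. rewrite <- hm in hu. pose proof (Cmod_ge_0 (h u)). nra. }
  assert (n0 : K * n2 t = 0) by (unfold n2; rewrite h0; simpl; ring).
  assert (hq : is_derive (fun u => K * n2 u) t 0).
  { replace 0 with (0 * n2 t + K * 0) by ring.
    apply is_derive_Rmult; [apply is_derive_Rconst|exact hn]. }
  assert (he : is_Cderive e t 0%C).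
  { split; apply is_derive_squeeze with (fun u => K * n2 u); try assumption;
      revert hb; apply filter_imp; intros u hu; (eapply Rle_trans; [|exact hu]).
    - apply re_le_Cmod.
    - apply Im_le_Cmod. }
  apply is_Cderive_ext with (fun u => F (y t) + (D * h u + e u))%C.
  { intros u. unfold e. ring. }
  eapply is_Cderive_eq.
  - apply is_Cderive_plus; [apply is_Cderive_const|].
    apply is_Cderive_plus; [apply is_Cderive_scal, hd|exact he].
  - ring.
Qed.

Lemma is_Cderive_egf (f : nat -> C) (y : R -> C) (t : R) (d : C) : geom_growth f ->
  is_Cderive y t d ->
  is_Cderive (fun u => egf f (y u)) t (d * egf (fun n => f (S n)) (y t))%C.
Proof.
  intros hf hy. destruct (egf_diff f (y t) hf) as [K hK].
  now apply is_Cderive_comp with K.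
Qed.

Lemma is_Cderive_inv (y : R -> C) (t : R) (d : C) : y t <> 0%C ->
  is_Cderive y t d -> is_Cderive (fun u => / y u)%C t (- d * (/ y t * / y t))%C.
Proof.
  intros h0 [h1 h2]. set (n2 := fun u => Re (y u) * Re (y u) + Im (y u) * Im (y u)).
  assert (hn : n2 t <> 0).
  { intros e. apply h0. unfold n2 in e.
    rewrite (surjective_pairing (y t)). unfold Re, Im in e.
    assert (fst (y t) = 0) by nra. assert (snd (y t) = 0) by nra.
    unfold RtoC. f_equal; assumption. }
  assert (dn : is_derive n2 t ((Re d * Re (y t) + Re (y t) * Re d)
                               + (Im d * Im (y t) + Im (y t) * Im d))).
  { apply (is_derive_Rplus (fun u => Re (y u) * Re (y u)) (fun u => Im (y u) * Im (y u)));
      now apply is_derive_Rmult. }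
  assert (di := is_derive_inv n2 t _ dn hn).
  split.
  - apply is_derive_ext with (fun u => Re (y u) * / n2 u).
    { intros u. unfold n2, Re, Im. simpl. unfold Rdiv. f_equal. f_equal. ring. }
    evar_last; [apply is_derive_Rmult; [exact h1|exact di]|].
    unfold n2, Re, Im in *. destruct (y t) as [p q], d as [d1 d2]; simpl in *.
    field. intros e; apply hn; rewrite <- e; ring.
  - apply is_derive_ext with (fun u => - Im (y u) * / n2 u).
    { intros u. unfold n2, Re, Im. simpl. unfold Rdiv. f_equal. f_equal. ring. }
    evar_last; [apply is_derive_Rmult; [|exact di];
      apply is_derive_Ropp; exact h2|].
    unfold n2, Re, Im, opp in *. destruct (y t) as [p q], d as [d1 d2]; simpl in *.
    field. intros e; apply hn; rewrite <- e; ring.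
Qed.

(** The mean value inequality with a real majorant; rotating the increment onto the
    positive axis reduces it to a monotonicity statement. *)
Lemma mean_value_ineq (F : R -> C) (F' : R -> C) (g g' : R -> R) (a b : R) :
  a <= b ->
  (forall t, a <= t <= b -> is_Cderive F t (F' t)) ->
  (forall t, a <= t <= b -> is_derive g t (g' t)) ->
  (forall t, a <= t <= b -> Cmod (F' t) <= g' t) ->
  Cmod (F b - F a)%C <= g b - g a.
Proof.
  intros hab hF hg hle. destruct (Cmod_rotation (F b - F a)) as (w & hw & e).
  set (phi := fun t => g t - Re (w * F t)%C).
  destruct (MVT_gen phi a b (fun t => g' t - Re (w * F' t)%C)) as (c & hc & hm).
  - rewrite Rmin_left, Rmax_right by easy. intros t ht.
    apply (is_derive_Rminus g (fun t => Re (w * F t)%C)).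
    + apply hg; lra.
    + apply is_Cderive_scal, hF; lra.
  - rewrite Rmin_left, Rmax_right by easy. intros t ht.
    apply continuity_pt_filterlim.
    apply is_derive_continuous with (g' t - Re (w * F' t)%C).
    apply (is_derive_Rminus g (fun t => Re (w * F t)%C)).
    + now apply hg.
    + now apply is_Cderive_scal, hF.
  - rewrite Rmin_left, Rmax_right in hc by easy.
    assert (h1 : 0 <= g' c - Re (w * F' c)%C).
    { specialize (hle c hc). pose proof (re_le_Cmod (w * F' c)%C) as h.
      rewrite Cmod_mult, hw in h. pose proof (Rle_abs (Re (w * F' c)%C)). lra. }
    assert (h2 : 0 <= phi b - phi a) by (rewrite hm; apply Rmult_le_pos; lra).
    apply (f_equal Re) in e.
    replace (w * (F b - F a))%C with (w * F b - w * F a)%C in e by ring.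
    change (Re (w * F b)%C - Re (w * F a)%C = Cmod (F b - F a)%C) in e.
    unfold phi in h2. lra.
Qed.

(** * The logarithm on a closed half plane *)

(** [hlog sg X T] is the logarithm of [X + i sg T] for [T >= 0], with argument between
    [0] and [sg PI].  The half-angle form of the argument is smooth up to the real axis,
    which the arc cosine is not. *)
Definition hlog (sg X T : R) : C :=
  (ln (sqrt (X * X + T * T)),
   sg * (PI / 2 - 2 * atan (X / (sqrt (X * X + T * T) + T)))).

(** With [q = X / (R + T)], the tangent of half the complementary angle, [1 + q^2] equals
    [2 R / (R + T)]. *)
Lemma hlog_arg_cos_sin (X T : R) : 0 <= T -> 0 < X * X + T * T ->
  let R := sqrt (X * X + T * T) in
  let th := PI / 2 - 2 * atan (X / (R + T)) in
  0 <= th <= PI /\ R * cos th = X /\ R * sin th = T.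
Proof.
  intros hT hR R th. assert (hR0 : 0 < R) by now apply sqrt_lt_R0.
  assert (hRR : R * R = X * X + T * T) by (apply sqrt_sqrt; lra).
  set (q := X / (R + T)).
  assert (hq : -1 <= q <= 1).
  { assert (Rabs X <= R).
    { apply Rsqr_incr_0_var; [rewrite <- Rsqr_abs; unfold Rsqr; nra|lra]. }
    unfold q. split.
    - apply Rle_div_r; split_Rabs; lra.
    - apply Rle_div_l; split_Rabs; lra. }
  assert (hq2 : 0 < 1 + q * q) by nra.
  assert (hat : - (PI / 4) <= atan q <= PI / 4).
  { assert (a1 := atan_1).
    assert (a2 : atan (-1) = - atan 1) by (rewrite <- atan_opp; f_equal; lra).
    split; apply Rnot_lt_le; intros h.
    - destruct (Rle_lt_or_eq_dec (-1) q ltac:(lra)) as [h1|h1].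
      + apply atan_increasing in h1. lra.
      + rewrite <- h1 in h. lra.
    - destruct (Rle_lt_or_eq_dec q 1 ltac:(lra)) as [h1|h1].
      + apply atan_increasing in h1. lra.
      + rewrite h1 in h. lra. }
  assert (hs : sin (atan q) = q * cos (atan q)).
  { rewrite <- (tan_atan q) at 2. unfold tan. field.
    pose proof (atan_bound q). apply Rgt_not_eq, cos_gt_0; lra. }
  assert (hc2 : cos (atan q) * cos (atan q) * (1 + q * q) = 1).
  { pose proof (sin2_cos2 (atan q)) as h. unfold Rsqr in h. rewrite hs in h. nra. }
  assert (key : R * (1 + q * q) = 2 * R * R / (R + T)).
  { unfold q. apply Rmult_eq_reg_r with ((R + T) * (R + T)); [|nra].
    field_simplify; [|lra..]. replace (X ^ 2) with (R * R - T * T) by (rewrite hRR; ring). ring. }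
  assert (hcs : cos (atan q) * cos (atan q) = (R + T) / (2 * R)).
  { apply Rmult_eq_reg_r with (1 + q * q); [|lra]. rewrite hc2.
    apply Rmult_eq_reg_l with R; [|lra].
    replace (R * ((R + T) / (2 * R) * (1 + q * q))) with ((R + T) / (2 * R) * (R * (1 + q * q))) by ring.
    rewrite key. field. lra. }
  unfold th. fold q. repeat split.
  - lra.
  - lra.
  - rewrite cos_shift, sin_2a, hs.
    replace (R * (2 * (q * cos (atan q)) * cos (atan q)))
      with (2 * R * q * (cos (atan q) * cos (atan q))) by ring.
    rewrite hcs. unfold q. field. lra.
  - rewrite sin_shift, cos_2a, hs.
    replace (R * (cos (atan q) * cos (atan q) - q * cos (atan q) * (q * cos (atan q))))
      with (R * (2 - (1 + q * q)) * (cos (atan q) * cos (atan q))) by ring.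
    replace (R * (2 - (1 + q * q))) with (2 * R - R * (1 + q * q)) by ring.
    rewrite key, hcs. field. lra.
Qed.

Lemma Cmod_pair (X T : R) : Cmod (X, T) = sqrt (X * X + T * T).
Proof. unfold Cmod; simpl. f_equal. ring. Qed.

Lemma Cexp_hlog (sg X T : R) : sg = 1 \/ sg = -1 -> 0 <= T -> 0 < X * X + T * T ->
  Cexp (hlog sg X T) = (X, sg * T).
Proof.
  intros hsg hT hR. destruct (hlog_arg_cos_sin X T hT hR) as (_ & h1 & h2).
  unfold Cexp, hlog. simpl. rewrite exp_ln by now apply sqrt_lt_R0.
  set (th := PI / 2 - _) in *. f_equal.
  - destruct hsg as [->| ->]; [rewrite Rmult_1_l; exact h1|].
    replace (-1 * th) with (- th) by ring. rewrite cos_neg. exact h1.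
  - destruct hsg as [->| ->]; [rewrite !Rmult_1_l; exact h2|].
    replace (-1 * th) with (- th) by ring. rewrite sin_neg, Ropp_mult_distr_r_reverse, h2. ring.
Qed.

Lemma hlog_arg_acos (X T : R) : 0 <= T -> 0 < X * X + T * T ->
  PI / 2 - 2 * atan (X / (sqrt (X * X + T * T) + T)) = acos (X / sqrt (X * X + T * T)).
Proof.
  intros hT hR. destruct (hlog_arg_cos_sin X T hT hR) as (h0 & h1 & _).
  assert (hp := sqrt_lt_R0 _ hR).
  set (th := PI / 2 - _) in *. set (R := sqrt _) in *.
  replace (X / R) with (cos th) by (rewrite <- h1; field; lra).
  symmetry. now apply acos_cos.
Qed.

Lemma Clog_upper (X T : R) : 0 <= T -> 0 < X * X + T * T -> Clog (X, T) = hlog 1 X T.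
Proof.
  intros hT hR. unfold Clog, hlog, Arg. rewrite Cmod_pair. simpl.
  destruct (Rle_dec 0 T); [|lra]. now rewrite hlog_arg_acos, Rmult_1_l.
Qed.

Lemma Clog_lower (X T : R) : 0 < T -> Clog (X, - T) = hlog (-1) X T.
Proof.
  intros hT. assert (0 < X * X + T * T) by nra.
  unfold Clog, hlog, Arg. rewrite Cmod_pair. simpl.
  destruct (Rle_dec 0 (- T)); [lra|]. rewrite hlog_arg_acos by lra.
  replace (- T * - T) with (T * T) by ring. f_equal. ring.
Qed.

(** This fixes the branch of [(-y)^(-a)]: in either half plane it differs from [y^(-a)] by the
    constant factor [exp (i sg PI a)].  The condition for [T = 0] excludes the positive axis,
    where the branch jumps, and assigns the negative axis to the upper half plane, as the
    principal argument does. *)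
Lemma Clog_opp (sg X T : R) : sg = 1 \/ sg = -1 -> 0 <= T -> (T = 0 -> X < 0 /\ sg = 1) ->
  Clog (Copp (X, sg * T)) = Cminus (hlog sg X T) (0, sg * PI).
Proof.
  intros hsg hT h0.
  assert (hR : 0 < X * X + T * T).
  { destruct (Req_dec T 0) as [e|e]; [destruct (h0 e); nra|nra]. }
  assert (hp := sqrt_lt_R0 _ hR).
  unfold Clog, hlog, Arg. rewrite Cmod_opp, Cmod_pair. simpl.
  replace (sg * T * (sg * T)) with (T * T) by (destruct hsg as [->| ->]; ring).
  rewrite hlog_arg_acos by easy.
  replace (- X / sqrt (X * X + T * T)) with (- (X / sqrt (X * X + T * T))) by (field; lra).
  rewrite acos_opp. unfold Cminus, Cplus, Copp; simpl. f_equal; [ring|].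
  destruct (Rle_dec 0 (- (sg * T))) as [h|h]; destruct hsg as [->| ->]; try ring; try lra.
  assert (e : T = 0) by lra. destruct (h0 e) as [hX _].
  subst T. replace (X * X + 0 * 0) with (Rsqr (- X)) by (unfold Rsqr; ring).
  rewrite sqrt_Rsqr by lra. replace (X / - X) with (Ropp 1) by (field; lra).
  rewrite acos_opp, acos_1. ring.
Qed.

Lemma is_Cderive_hlog (sg : R) (T : R -> R) (s T' : R) : sg = 1 \/ sg = -1 ->
  is_derive T s T' -> 0 <= T s -> 0 < s * s + T s * T s ->
  is_Cderive (fun u => hlog sg u (T u)) s (Cmult (1, sg * T') (Cinv (s, sg * T s))).
Proof.
  intros hsg hT h0 hR. assert (hp := sqrt_lt_R0 _ hR).
  assert (hRR : sqrt (s * s + T s * T s) * sqrt (s * s + T s * T s) = s * s + T s * T s)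
    by (apply sqrt_sqrt; lra).
  assert (eT : ex_derive T s) by now exists T'.
  assert (dT : Derive (fun x => T x) s = T') by now apply is_derive_unique.
  assert (sg2 : sg * sg = 1) by (destruct hsg as [->| ->]; ring).
  assert (hinv : (Cmult (1, sg * T') (Cinv (s, sg * T s)))
     = ((s + T s * T') / (s * s + T s * T s), sg * ((s * T' - T s) / (s * s + T s * T s)))).
  { unfold Cinv, Cmult; simpl.
    replace (s * (s * 1) + sg * T s * (sg * T s * 1)) with (s * s + (sg * sg) * (T s * T s)) by ring.
    rewrite sg2, Rmult_1_l. f_equal; field_simplify; try lra.
    replace (sg ^ 2) with 1 by (rewrite <- sg2; ring). f_equal; ring. }
  rewrite hinv. split.
  - unfold hlog; simpl. auto_derive; [repeat split; easy|]. rewrite dT.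
    unfold Rdiv in *. set (R := sqrt _) in *. rewrite <- hRR. field. lra.
  - unfold hlog; simpl. auto_derive; [repeat split; try easy; lra|]. rewrite dT.
    set (R := sqrt _) in *. 
    assert (hq : 1 + (s / (R + T s)) ^ 2 = 2 * R / (R + T s)).
    { apply Rmult_eq_reg_r with ((R + T s) * (R + T s)); [|nra].
      field_simplify; [|lra..]. replace (s ^ 2) with (R * R - T s * T s) by (rewrite hRR; ring). ring. }
    replace (1 + s * / (R + T s) * (s * / (R + T s) * 1)) with (2 * R / (R + T s))
      by (rewrite <- hq; unfold Rdiv; ring).
    assert (num : (R + T s) * R - s * (s + T s * T' + R * T') = (R + T s) * (T s - s * T')).
    { replace (s * (s + T s * T' + R * T')) with (s * s + s * (T s * T' + R * T')) by ring.
      replace (s * s) with (R * R - T s * T s) by lra. ring. }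
    f_equal. rewrite <- hRR.
    apply eq_trans with
      (- (((R + T s) * R - s * (s + T s * T' + R * T')) / ((R + T s) * (R * R)))).
    + field. split; lra.
    + rewrite num. field. split; lra.
Qed.

(** * Complex limits and powers *)

Lemma exp_le_compat (x y : R) : x <= y -> exp x <= exp y.
Proof. intros [h| ->]; [left; now apply exp_increasing|apply Rle_refl]. Qed.

Lemma Cmod_Cexp (z : C) : Cmod (Cexp z) = exp (Re z).
Proof.
  unfold Cexp. rewrite Cmod_pair. pose proof (exp_pos (Re z)).
  replace (exp (Re z) * cos (Im z) * (exp (Re z) * cos (Im z)) +
           exp (Re z) * sin (Im z) * (exp (Re z) * sin (Im z)))
    with (Rsqr (exp (Re z)) * (Rsqr (sin (Im z)) + Rsqr (cos (Im z)))) by (unfold Rsqr; ring).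
  rewrite sin2_cos2, Rmult_1_r. apply sqrt_Rsqr. lra.
Qed.

Lemma Cexp_neq_0 (z : C) : Cexp z <> 0%C.
Proof.
  intros h. assert (e : Cmod (Cexp z) = 0) by now rewrite h, Cmod_0.
  rewrite Cmod_Cexp in e. pose proof (exp_pos (Re z)). lra.
Qed.

Lemma Cexp_RtoC (x : R) : Cexp x = RtoC (exp x).
Proof. unfold Cexp, RtoC; simpl. rewrite cos_0, sin_0. f_equal; ring. Qed.

Lemma Cexp_0 : Cexp 0 = 1%C.
Proof. now rewrite Cexp_RtoC, exp_0. Qed.

Lemma Cexp_opp (z : C) : Cexp (- z) = (/ Cexp z)%C.
Proof.
  assert (h : (Cexp (- z) * Cexp z)%C = 1%C).
  { rewrite <- Cexp_add. replace (- z + z)%C with (RtoC 0) by ring. apply Cexp_0. }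
  replace (Cexp (- z)) with (Cexp (- z) * Cexp z / Cexp z)%C by (field; apply Cexp_neq_0).
  rewrite h. field. apply Cexp_neq_0.
Qed.

Definition rpow (r : R) (w : C) : C := Cexp (w * ln r).

Lemma Cmod_rpow (r : R) (w : C) : Cmod (rpow r w) = exp (Re w * ln r).
Proof. unfold rpow. rewrite Cmod_Cexp. f_equal. unfold Re. simpl. ring. Qed.

Lemma rpow_add (r : R) (w v : C) : rpow r (w + v) = (rpow r w * rpow r v)%C.
Proof. unfold rpow. rewrite <- Cexp_add. f_equal. ring. Qed.

Lemma rpow_neq_0 (r : R) (w : C) : rpow r w <> 0%C.
Proof. apply Cexp_neq_0. Qed.

Lemma rpow_1 (r : R) : 0 < r -> rpow r 1 = RtoC r.
Proof. intros hr. unfold rpow. rewrite Cmult_1_l, Cexp_RtoC, exp_ln; easy. Qed.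

Lemma rpow_opp (r : R) (w : C) : rpow r (- w) = (/ rpow r w)%C.
Proof. unfold rpow. rewrite <- Cexp_opp. f_equal. ring. Qed.

Lemma rpow_mult_base (r s : R) (w : C) : 0 < r -> 0 < s ->
  rpow (r * s) w = (rpow r w * rpow s w)%C.
Proof.
  intros hr hs. unfold rpow. rewrite ln_mult, RtoC_plus, <- Cexp_add by easy. f_equal. ring.
Qed.

Lemma rpow_base_1 (w : C) : rpow 1 w = 1%C.
Proof. unfold rpow. rewrite ln_1, Cmult_0_r. apply Cexp_0. Qed.

Lemma is_Cderive_rpow (w : C) (t : R) : 0 < t ->
  is_Cderive (fun u => rpow u w) t (w * / t * rpow t w)%C.
Proof.
  intros ht. apply is_Cderive_exp, is_Cderive_scal.
  rewrite <- RtoC_inv by lra. apply is_Cderive_RtoC, is_derive_ln, ht.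
Qed.

Definition Ctends (u : nat -> C) (l : C) : Prop :=
  is_lim_seq (fun n => Cmod (u n - l)%C) 0.

Lemma Ctends_squeeze (u : nat -> C) (l : C) (v : nat -> R) :
  (exists n0, forall n, (n0 <= n)%nat -> Cmod (u n - l)%C <= v n) ->
  is_lim_seq v 0 -> Ctends u l.
Proof.
  intros [n0 h] hv. unfold Ctends.
  apply is_lim_seq_le_le_loc with (fun _ => 0) v; [|apply is_lim_seq_const|exact hv].
  exists n0. intros n hn. split; [apply Cmod_ge_0|now apply h].
Qed.

Lemma Ctends_ext (u v : nat -> C) (l : C) : (forall n, u n = v n) ->
  Ctends u l -> Ctends v l.
Proof. intros h. apply is_lim_seq_ext. intros n. now rewrite h. Qed.

Lemma Ctends_incr_1 (u : nat -> C) (l : C) :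
  Ctends u l <-> Ctends (fun n => u (S n)) l.
Proof. apply (is_lim_seq_incr_1 (fun n => Cmod (u n - l)%C)). Qed.

Lemma Ctends_const (l : C) : Ctends (fun _ => l) l.
Proof.
  apply is_lim_seq_ext with (fun _ => 0); [|apply is_lim_seq_const].
  intros n. replace (l - l)%C with (RtoC 0) by ring. now rewrite Cmod_0.
Qed.

Lemma Ctends_mult (u v : nat -> C) (l m : C) :
  Ctends u l -> Ctends v m -> Ctends (fun n => u n * v n)%C (l * m)%C.
Proof.
  intros hu hv. apply Ctends_squeeze with (fun n =>
    Cmod (u n - l)%C * Cmod (v n - m)%C + (Cmod l * Cmod (v n - m)%C + Cmod (u n - l)%C * Cmod m)).
  - exists O. intros n _.
    replace (u n * v n - l * m)%C with ((u n - l) * (v n - m) + (l * (v n - m) + (u n - l) * m))%C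
      by ring.
    rewrite <- !Cmod_mult. eapply Rle_trans; [apply Cmod_triangle|].
    apply Rplus_le_compat_l, Cmod_triangle.
  - replace (Finite 0) with (Finite (0 * 0 + (Cmod l * 0 + 0 * Cmod m))) by (f_equal; ring).
    apply is_lim_seq_plus'; [now apply is_lim_seq_mult'|].
    apply is_lim_seq_plus'; (apply is_lim_seq_mult'; [|]);
      first [exact hu|exact hv|apply is_lim_seq_const].
Qed.

Lemma Ctends_inv (u : nat -> C) (l : C) : l <> 0%C -> Ctends u l ->
  Ctends (fun n => / u n)%C (/ l)%C.
Proof.
  intros hl hu. assert (h0 : 0 < Cmod l) by now apply Cmod_gt_0.
  apply Ctends_squeeze with (fun n => 2 / (Cmod l * Cmod l) * Cmod (u n - l)%C).
  - destruct (proj2 (is_lim_seq_spec _ _) hu (mkposreal (Cmod l / 2) ltac:(lra))) as [n0 hn0].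
    exists n0. intros n hn. specialize (hn0 n hn). simpl in hn0.
    rewrite Rminus_0_r, Rabs_pos_eq in hn0 by apply Cmod_ge_0.
    assert (h1 : Cmod l / 2 <= Cmod (u n)).
    { pose proof (Cmod_triangle (u n) (l - u n)) as h.
      replace (u n + (l - u n))%C with l in h by ring.
      rewrite (Cmod_sub_sym l) in h. lra. }
    assert (hun : u n <> 0%C) by (apply Cmod_gt_0; lra).
    replace (/ u n - / l)%C with ((l - u n) * / (u n * l))%C by (field; easy).
    rewrite Cmod_mult, Cmod_inv, Cmod_mult, (Cmod_sub_sym l) by now apply Cmult_neq_0.
    rewrite Rmult_comm. apply Rmult_le_compat_r; [apply Cmod_ge_0|].
    replace (2 / (Cmod l * Cmod l)) with (/ (Cmod l / 2 * Cmod l)) by (field; lra).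
    apply Rinv_le_contravar; [apply Rmult_lt_0_compat; lra|].
    apply Rmult_le_compat_r; lra.
  - replace (Finite 0) with (Finite (2 / (Cmod l * Cmod l) * 0)) by (f_equal; ring).
    now apply is_lim_seq_mult'; [apply is_lim_seq_const|].
Qed.

Lemma Ctends_Re_Im (u : nat -> C) (l : C) :
  is_lim_seq (fun n => Re (u n)) (Re l) -> is_lim_seq (fun n => Im (u n)) (Im l) ->
  Ctends u l.
Proof.
  intros h1 h2.
  apply Ctends_squeeze with (fun n => Rabs (Re (u n) - Re l) + Rabs (Im (u n) - Im l)).
  - exists O. intros n _. apply (Cmod_le_abs (u n - l)).
  - replace (Finite 0) with (Finite (Rabs (Re l - Re l) + Rabs (Im l - Im l)))
      by (f_equal; rewrite !Rminus_eq_0, Rabs_R0; ring).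
    apply is_lim_seq_plus'; apply (is_lim_seq_abs _ (Finite _));
      apply is_lim_seq_minus'; try assumption; apply is_lim_seq_const.
Qed.

Lemma is_lim_seq_inv_S : is_lim_seq (fun n => / INR (S n)) 0.
Proof.
  apply (is_lim_seq_incr_1 (fun n => / INR n)).
  replace (Finite 0) with (Rbar_inv p_infty) by reflexivity.
  apply is_lim_seq_inv; [apply is_lim_seq_INR|discriminate].
Qed.

Lemma finite_upper_bound (g : nat -> R) (N : nat) :
  exists D, 0 <= D /\ forall n, (n < N)%nat -> g n <= D.
Proof.
  induction N as [|N [D [hD IH]]].
  - exists 0. split; [lra|]. intros n hn; lia.
  - exists (Rmax D (g N)). pose proof (Rmax_l D (g N)); pose proof (Rmax_r D (g N)).
    split; [lra|]. intros n hn. destruct (Nat.eq_dec n N) as [->|hne]; [easy|].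
    specialize (IH n ltac:(lia)). lra.
Qed.

(** * The Poisson averages of a sequence with power growth *)

Lemma Rpower_interp (t sg : R) : 0 < t -> 0 <= sg <= 1 -> exp (sg * ln t) <= Rmax 1 t.
Proof.
  intros ht hs. destruct (Rle_lt_dec 1 t) as [h|h].
  - eapply Rle_trans; [|apply Rmax_r]. rewrite <- (exp_ln t) at 2 by easy.
    apply exp_le_compat. assert (0 <= ln t) by (rewrite <- ln_1; apply ln_le; lra). nra.
  - eapply Rle_trans; [|apply Rmax_l]. rewrite <- exp_0.
    apply exp_le_compat. assert (ln t <= 0) by (rewrite <- ln_1; apply ln_le; lra). nra.
Qed.

(** Near [1] by the mean value inequality; for [x < 1/2] the right side exceeds [2].  The
    restriction on [Re mu] is what makes this hold on the whole half line. *)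
Lemma rpow_Lipschitz_1 (mu : C) : 0 <= Re mu <= 1 ->
  forall x, 0 < x -> Cmod (rpow x mu - 1)%C <= (2 * Cmod mu + 4) * Rabs (x - 1).
Proof.
  intros hs x hx. pose proof (Cmod_ge_0 mu) as hmu.
  destruct (Rle_lt_dec (1/2) x) as [h|h].
  - assert (hd : forall t, 1/2 <= t -> Cmod (mu * / t * rpow t mu)%C <= 2 * Cmod mu).
    { intros t ht. rewrite !Cmod_mult, Cmod_inv, Cmod_R, Rabs_pos_eq, Cmod_rpow
        by (try apply RtoC_neq_0; lra).
      assert (hm : exp (Re mu * ln t) <= 2 * t).
      { eapply Rle_trans; [apply Rpower_interp; [lra|easy]|]. apply Rmax_lub; lra. }
      replace (Cmod mu * / t * exp (Re mu * ln t)) with (Cmod mu * (exp (Re mu * ln t) / t))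
        by (unfold Rdiv; ring).
      rewrite (Rmult_comm 2). apply Rmult_le_compat_l; [easy|]. apply Rle_div_l; lra. }
    rewrite <- (rpow_base_1 mu). set (L := 2 * Cmod mu).
    destruct (Rle_lt_dec 1 x) as [h1|h1].
    + rewrite Rabs_pos_eq by lra.
      apply Rle_trans with (L * x - L * 1); [|unfold L; nra].
      apply (mean_value_ineq (fun u => rpow u mu) (fun t => mu * / t * rpow t mu)%C
               (fun t => L * t) (fun _ => L) 1 x h1).
      * intros t ht. apply is_Cderive_rpow; lra.
      * intros t _. auto_derive; [easy|ring].
      * intros t ht. apply hd; lra.
    + rewrite Cmod_sub_sym, Rabs_left by lra.
      apply Rle_trans with (L * 1 - L * x); [|unfold L; nra].
      apply (mean_value_ineq (fun u => rpow u mu) (fun t => mu * / t * rpow t mu)%C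
               (fun t => L * t) (fun _ => L) x 1); [lra| | |].
      * intros t ht. apply is_Cderive_rpow; lra.
      * intros t _. auto_derive; [easy|ring].
      * intros t ht. apply hd; lra.
  - eapply Rle_trans; [apply Cmod_sub_le|]. rewrite Cmod_1, Cmod_rpow, Rabs_left by lra.
    assert (exp (Re mu * ln x) <= 1).
    { eapply Rle_trans; [apply Rpower_interp; easy|]. apply Rmax_lub; lra. }
    nra.
Qed.

Lemma is_series_Rext (u v : nat -> R) (l m : R) :
  (forall n, u n = v n) -> l = m -> is_series u l -> is_series v m.
Proof. intros h <-. now apply (is_series_ext (V := R_NormedModule)). Qed.

Lemma is_series_Rscal (w : R) (u : nat -> R) (l : R) :
  is_series u l -> is_series (fun n => w * u n) (w * l).
Proof. apply (is_series_scal (V := R_NormedModule)). Qed.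

Lemma is_series_Rplus (u v : nat -> R) (l m : R) :
  is_series u l -> is_series v m -> is_series (fun n => u n + v n) (l + m).
Proof. apply (is_series_plus (V := R_NormedModule)). Qed.

Lemma is_series_Rdecr (u : nat -> R) (l : R) :
  is_series (fun n => u (S n)) (l - u O) -> is_series u l.
Proof. apply (is_series_decr_1 (V := R_NormedModule)). Qed.

Lemma is_series_Rincr (u : nat -> R) (l : R) :
  is_series u (l + u O) -> is_series (fun n => u (S n)) l.
Proof. apply (is_series_incr_1 (V := R_NormedModule)). Qed.

Lemma exp_series_moment1 (r : R) :
  is_series (fun n => INR n * (r ^ n / INR (fact n))) (r * exp r).
Proof.
  apply is_series_Rdecr.
  apply is_series_Rext with (3 := is_series_Rscal r _ _ (exp_is_series r)).
  - intros n. rewrite fact_simpl, mult_INR. simpl pow. field.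
    split; [apply INR_fact_neq_0|apply not_0_INR; lia].
  - simpl. ring.
Qed.

Lemma exp_series_moment2 (r : R) :
  is_series (fun n => INR n * INR n * (r ^ n / INR (fact n))) (r * (r + 1) * exp r).
Proof.
  apply is_series_Rdecr.
  apply is_series_Rext with
    (3 := is_series_Rscal r _ _ (is_series_Rplus _ _ _ _ (exp_series_moment1 r) (exp_is_series r))).
  - intros n. rewrite fact_simpl, mult_INR, S_INR. simpl pow. field.
    split; [apply INR_fact_neq_0|rewrite <- S_INR; apply not_0_INR; lia].
  - simpl. ring.
Qed.

Lemma exp_series_centered (r : R) :
  is_series (fun n => (INR (S n) - r) * (INR (S n) - r) * (r ^ n / INR (fact n)))
    ((r + 1) * exp r).
Proof.
  apply is_series_Rext with
    (3 := is_series_Rplus _ _ _ _ (exp_series_moment2 r)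
      (is_series_Rplus _ _ _ _ (is_series_Rscal (2 * (1 - r)) _ _ (exp_series_moment1 r))
        (is_series_Rscal ((1 - r) * (1 - r)) _ _ (exp_is_series r)))).
  - intros n. rewrite S_INR. ring.
  - ring.
Qed.

Lemma exp_series_succ (r : R) :
  is_series (fun n => INR (S n) * (r ^ n / INR (fact n))) ((r + 1) * exp r).
Proof.
  apply is_series_Rext with
    (3 := is_series_Rplus _ _ _ _ (exp_series_moment1 r) (exp_is_series r)).
  - intros n. rewrite S_INR. ring.
  - ring.
Qed.

Lemma exp_series_inv_succ (r : R) : 0 < r ->
  is_series (fun n => / INR (S n) * (r ^ n / INR (fact n))) ((exp r - 1) / r).
Proof.
  intros hr.
  assert (h : is_series (fun n => r ^ (S n) / INR (fact (S n))) (exp r - 1)).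
  { apply (is_series_Rincr (fun n => r ^ n / INR (fact n))).
    apply is_series_Rext with (3 := exp_is_series r); [easy|simpl; field]. }
  apply is_series_Rext with (3 := is_series_Rscal (/ r) _ _ h).
  - intros n. rewrite fact_simpl, mult_INR. simpl pow. field.
    repeat split; [apply INR_fact_neq_0|apply not_0_INR; lia|lra].
  - unfold Rdiv. ring.
Qed.

Lemma egf_one (r : R) : egf (fun _ => 1%C) r = RtoC (exp r).
Proof.
  unfold egf. rewrite (CSeries_ext _ (fun n => RtoC (r ^ n / INR (fact n)))).
  2:{ intros n. rewrite Cmult_1_l, RtoC_div, RtoC_pow by apply INR_fact_neq_0. easy. }
  apply injective_projections.
  - apply exp_series.
  - change (Series (fun _ => 0) = 0). transitivity (0 * Series (fun _ => 0)); [|ring].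
    rewrite <- Series_scal_l. apply Series_ext; intros; ring.
Qed.

(** [egf f r ~ beta r^mu exp r]; here [exp (-r) egf f r] is the mean of [f] under the Poisson
    law of parameter [r]. *)
Definition poisson_limit (f : nat -> C) (mu beta : C) : Prop :=
  forall eps, 0 < eps -> exists r0, 1 <= r0 /\ forall r, r0 <= r ->
    Cmod (rpow r (- mu) * exp (- r) * egf f r - beta)%C <= eps.

(** Chebyshev: under the Poisson weights [exp (-r) r^n / n!] the index [n] stays within
    [O(sqrt r)] of [r] in mean square, and for [0 <= Re mu <= 1] the function
    [(n/r)^mu] is Lipschitz at [1] with no loss at infinity or at [0]. *)
Lemma poisson_limit_base (f : nat -> C) (mu beta : C) :
  geom_growth f -> 0 <= Re mu <= 1 ->
  Ctends (fun n => f n * rpow (INR (S n)) (- mu))%C beta -> poisson_limit f mu beta.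
Proof.
  intros hf hmu hlim eps heps.
  set (A := Cmod beta * (2 * Cmod mu + 4)).
  assert (hA : 0 <= A).
  { unfold A. pose proof (Cmod_ge_0 beta); pose proof (Cmod_ge_0 mu). nra. }
  set (e1 := eps / 12). assert (he1 : 0 < e1) by (unfold e1; lra).
  set (e2 := eps / (4 * (A + 1))).
  assert (he2 : 0 < e2) by (unfold e2; apply Rdiv_lt_0_compat; lra).
  assert (hAe : A * e2 <= eps / 4).
  { unfold e2. replace (A * (eps / (4 * (A + 1)))) with (eps / 4 * (A / (A + 1))) by (field; lra).
    rewrite <- (Rmult_1_r (eps / 4)) at 2. apply Rmult_le_compat_l; [lra|].
    apply Rle_div_l; lra. }
  destruct (proj2 (is_lim_seq_spec _ _) hlim (mkposreal e1 he1)) as [n0 hn0].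
  cbv beta in hn0. change (pos (mkposreal e1 he1)) with e1 in hn0.
  set (dd := fun n => (f n - beta * rpow (INR (S n)) mu)%C).
  destruct (finite_upper_bound (fun n => Cmod (dd n) * INR (S n)) n0) as (D & hD & hDn).
  assert (hS : forall n, 0 < INR (S n)) by (intros n; apply lt_0_INR; lia).
  assert (hdd : forall n, Cmod (dd n) <= e1 * exp (Re mu * ln (INR (S n))) + D * / INR (S n)).
  { intros n. assert (hi : 0 <= D * / INR (S n))
      by (apply Rmult_le_pos; [easy|left; apply Rinv_0_lt_compat, hS]).
    pose proof (exp_pos (Re mu * ln (INR (S n)))) as hE.
    destruct (le_lt_dec n0 n) as [h|h].
    - specialize (hn0 n h). rewrite Rminus_0_r, Rabs_pos_eq in hn0 by apply Cmod_ge_0.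
      replace (dd n) with ((f n * rpow (INR (S n)) (- mu) - beta) * rpow (INR (S n)) mu)%C.
      2:{ unfold dd. rewrite rpow_opp. field. apply rpow_neq_0. }
      rewrite Cmod_mult, Cmod_rpow.
      apply Rle_trans with (e1 * exp (Re mu * ln (INR (S n)))); [|lra].
      apply Rmult_le_compat_r; lra.
    - specialize (hDn n h). cbv beta in hDn.
      assert (Cmod (dd n) <= D * / INR (S n)).
      { apply (Rmult_le_reg_r (INR (S n))); [apply hS|].
        rewrite Rmult_assoc, Rinv_l, Rmult_1_r by (specialize (hS n); lra). exact hDn. }
      assert (0 < e1 * exp (Re mu * ln (INR (S n)))) by now apply Rmult_lt_0_compat. lra. }
  exists (Rmax 1 (Rmax (4 * D / eps) (8 * A / (e2 * eps)))). split; [apply Rmax_l|].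
  intros r hr.
  assert (hr1 : 1 <= r) by max_lra.
  assert (hr2 : D / r <= eps / 4).
  { apply Rle_div_l; [lra|].
    assert (h : 4 * D / eps <= r) by max_lra.
    apply Rle_div_l in h; lra. }
  assert (hr3 : 2 * A / (e2 * r) <= eps / 4).
  { apply Rle_div_l; [apply Rmult_lt_0_compat; lra|].
    assert (h : 8 * A / (e2 * eps) <= r) by max_lra.
    apply Rle_div_l in h; [|now apply Rmult_lt_0_compat]. nra. }
  set (P := exp (Re mu * ln r)). assert (hP : 0 < P) by apply exp_pos.
  assert (hP1 : 1 <= P).
  { unfold P. rewrite <- exp_0. apply exp_le_compat.
    assert (0 <= ln r) by (rewrite <- ln_1; apply ln_le; lra). nra. }
  (* In terms of x = (n+1)/r, the distance from x to 1 is traded for its square divided by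
     e2, because only the mean square is at hand; the finitely many indices below n0 are
     absorbed in D/(n+1), whose mean is O(1/r). *)
  assert (hterm : forall n, Cmod (f n - beta * rpow r mu)%C <=
     P * (e1 + A * e2) + P * e1 / r * INR (S n) + D * / INR (S n)
     + P * A / (e2 * (r * r)) * ((INR (S n) - r) * (INR (S n) - r))).
  { intros n. specialize (hdd n). set (x := INR (S n) / r).
    assert (hx : 0 < x) by (apply Rdiv_lt_0_compat; [apply hS|lra]).
    assert (hxr : INR (S n) = x * r) by (unfold x; field; lra).
    assert (b1 : exp (Re mu * ln (INR (S n))) <= P * (1 + x)).
    { rewrite hxr, ln_mult, Rmult_plus_distr_l, exp_plus, Rmult_comm by lra.
      apply Rmult_le_compat_l; [lra|].
      eapply Rle_trans; [apply Rpower_interp; easy|]. apply Rmax_lub; lra. }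
    assert (b2 : Cmod (beta * rpow (INR (S n)) mu - beta * rpow r mu)%C <= P * A * Rabs (x - 1)).
    { rewrite hxr, rpow_mult_base by lra.
      replace (beta * (rpow x mu * rpow r mu) - beta * rpow r mu)%C
        with (rpow r mu * (beta * (rpow x mu - 1)))%C by ring.
      rewrite !Cmod_mult, Cmod_rpow. fold P. rewrite Rmult_assoc.
      apply Rmult_le_compat_l; [lra|]. unfold A. rewrite Rmult_assoc.
      apply Rmult_le_compat_l; [apply Cmod_ge_0|]. now apply rpow_Lipschitz_1. }
    assert (b3 : Rabs (x - 1) <= e2 + (x - 1) * (x - 1) / e2).
    { apply Rmult_le_reg_r with e2; [easy|].
      replace ((e2 + (x - 1) * (x - 1) / e2) * e2) with (e2 * e2 + (x - 1) * (x - 1)) by (field; lra).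
      assert (0 <= Rabs (x - 1)) by apply Rabs_pos.
      replace ((x - 1) * (x - 1)) with (Rabs (x - 1) * Rabs (x - 1))
        by (split_Rabs; ring).
      nra. }
    replace (f n - beta * rpow r mu)%C
      with (dd n + (beta * rpow (INR (S n)) mu - beta * rpow r mu))%C by (unfold dd; ring).
    eapply Rle_trans; [apply Cmod_triangle|].
    assert (b4 : e1 * exp (Re mu * ln (INR (S n))) <= e1 * (P * (1 + x)))
      by (apply Rmult_le_compat_l; lra).
    assert (b5 : P * A * Rabs (x - 1) <= P * A * (e2 + (x - 1) * (x - 1) / e2))
      by (apply Rmult_le_compat_l; [nra|easy]).
    replace (P * e1 / r * INR (S n)) with (P * e1 * x) by (unfold x; field; lra).
    replace (P * A / (e2 * (r * r)) * ((INR (S n) - r) * (INR (S n) - r)))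
      with (P * A * ((x - 1) * (x - 1) / e2)) by (unfold x; field; lra).
    nra. }
  assert (hsum := is_series_Rplus _ _ _ _ (is_series_Rplus _ _ _ _ (is_series_Rplus _ _ _ _
     (is_series_Rscal (P * (e1 + A * e2)) _ _ (exp_is_series r))
     (is_series_Rscal (P * e1 / r) _ _ (exp_series_succ r)))
     (is_series_Rscal D _ _ (exp_series_inv_succ r ltac:(lra))))
     (is_series_Rscal (P * A / (e2 * (r * r))) _ _ (exp_series_centered r))).
  assert (hdiff : Cmod (egf f r - beta * rpow r mu * exp r)%C <=
     P * (e1 + A * e2) * exp r + P * e1 / r * ((r + 1) * exp r)
       + D * ((exp r - 1) / r) + P * A / (e2 * (r * r)) * ((r + 1) * exp r)).
  { assert (hgc : geom_growth (fun _ : nat => beta * rpow r mu)%C).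
    { exists (Cmod (beta * rpow r mu)%C), 1. repeat split; [apply Cmod_ge_0|lra|].
      intros n. rewrite pow1. lra. }
    assert (e : (beta * rpow r mu * exp r)%C = egf (fun _ => beta * rpow r mu)%C r).
    { rewrite (egf_ext _ (fun n => beta * rpow r mu * 1)%C) by (intros; ring).
      rewrite (egf_scal _ (fun _ => RtoC 1)).
      - now rewrite egf_one.
      - exists 1, 1. repeat split; try lra. intros n. rewrite Cmod_1, pow1; lra. }
    rewrite e. unfold egf.
    rewrite <- CSeries_minus by (apply egf_summable; assumption).
    rewrite <- (is_series_unique _ _ hsum).
    apply Cmod_CSeries_le; [|eexists; exact hsum].
    intros n. replace (f n * (r ^ n / INR (fact n)) - beta * rpow r mu * (r ^ n / INR (fact n)))%C
      with ((f n - beta * rpow r mu) * (r ^ n / INR (fact n)))%C by ring.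
    rewrite Cmod_mult, Cmod_pow_fact, Cmod_R, Rabs_pos_eq by lra.
    rewrite <- !Rmult_assoc, <- !Rmult_plus_distr_r, !Rmult_assoc.
    assert (0 <= r ^ n / INR (fact n)).
    { apply Rdiv_le_0_compat; [apply pow_le; lra|apply INR_fact_lt_0]. }
    rewrite <- !Rmult_assoc in *. apply Rmult_le_compat_r; [easy|].
    specialize (hterm n). rewrite <- !Rmult_assoc in hterm. lra. }
  replace (rpow r (- mu) * exp (- r) * egf f r - beta)%C
    with (rpow r (- mu) * exp (- r) * (egf f r - beta * rpow r mu * exp r))%C.
  2:{ rewrite rpow_opp, exp_Ropp, RtoC_inv by (pose proof (exp_pos r); lra).
      field. split; [apply RtoC_neq_0; pose proof (exp_pos r); lra|apply rpow_neq_0]. }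
  rewrite !Cmod_mult, Cmod_R, (Rabs_pos_eq (exp (- r))) by (pose proof (exp_pos (- r)); lra).
  rewrite rpow_opp, Cmod_inv, Cmod_rpow, exp_Ropp by apply rpow_neq_0. fold P.
  assert (hE := exp_pos r). set (E := exp r) in *.
  apply Rle_trans with (/ P * / E *
    (P * (e1 + A * e2) * E + P * e1 / r * ((r + 1) * E)
       + D * ((E - 1) / r) + P * A / (e2 * (r * r)) * ((r + 1) * E))).
  { apply Rmult_le_compat_l; [|exact hdiff].
    apply Rmult_le_pos; left; now apply Rinv_0_lt_compat. }
  replace (/ P * / E * (P * (e1 + A * e2) * E + P * e1 / r * ((r + 1) * E)
       + D * ((E - 1) / r) + P * A / (e2 * (r * r)) * ((r + 1) * E)))
    with ((e1 + A * e2) + e1 * ((r + 1) / r) + D / r * ((1 - / E) * / P)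
       + 2 * A / (e2 * r) * ((r + 1) / (2 * r))) by (field; lra).
  assert (c1 : (r + 1) / r <= 2) by (apply Rle_div_l; lra).
  assert (c2 : (r + 1) / (2 * r) <= 1) by (apply Rle_div_l; lra).
  assert (c3 : (1 - / E) * / P <= 1).
  { assert (0 < / E) by now apply Rinv_0_lt_compat.
    assert (0 < / P) by now apply Rinv_0_lt_compat.
    assert (/ P <= 1) by (rewrite <- Rinv_1; apply Rinv_le_contravar; lra). nra. }
  assert (c4 : 0 <= D / r) by (apply Rdiv_le_0_compat; lra).
  assert (c5 : 0 <= 2 * A / (e2 * r)) by (apply Rdiv_le_0_compat; nra).
  assert (D / r * ((1 - / E) * / P) <= D / r * 1) by (apply Rmult_le_compat_l; easy).
  assert (2 * A / (e2 * r) * ((r + 1) / (2 * r)) <= 2 * A / (e2 * r) * 1)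
    by (apply Rmult_le_compat_l; easy).
  assert (e1 * ((r + 1) / r) <= e1 * 2) by (apply Rmult_le_compat_l; lra).
  unfold e1 in *. lra.
Qed.

(** * Reduction of a general exponent to the strip [0 <= Re mu <= 1] *)

Lemma ln_le_linear (kappa eps : R) : 0 < eps ->
  exists B, 0 <= B /\ forall r, 1 <= r -> kappa * ln r <= eps * r + B.
Proof.
  intros heps. set (d := eps / (Rabs kappa + 1)). pose proof (Rabs_pos kappa) as hk.
  assert (hd : 0 < d) by (apply Rdiv_lt_0_compat; lra).
  exists (Rabs kappa * Rabs (ln d)). split; [apply Rmult_le_pos; apply Rabs_pos|].
  intros r hr.
  assert (h : ln r <= d * r - ln d).
  { pose proof (exp_ineq1_le (ln (d * r))) as h. rewrite exp_ln, ln_mult in h by nra. lra. }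
  assert (hl : 0 <= ln r) by (rewrite <- ln_1; apply ln_le; lra).
  apply Rle_trans with (Rabs kappa * ln r).
  { apply Rmult_le_compat_r; [easy|apply Rle_abs]. }
  assert (hdk : Rabs kappa * d <= eps).
  { unfold d. replace (Rabs kappa * (eps / (Rabs kappa + 1)))
      with (eps * (Rabs kappa / (Rabs kappa + 1))) by (field; lra).
    rewrite <- (Rmult_1_r eps) at 2. apply Rmult_le_compat_l; [lra|]. apply Rle_div_l; lra. }
  assert (hn : - ln d <= Rabs (ln d)) by (rewrite <- Rabs_Ropp; apply Rle_abs).
  apply Rle_trans with (Rabs kappa * (d * r + Rabs (ln d))).
  { apply Rmult_le_compat_l; [easy|lra]. }
  nra.
Qed.

Lemma exp_neg_beats_power (kappa K eps : R) : 0 <= K -> 0 < eps ->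
  exists r0, 1 <= r0 /\ forall r, r0 <= r -> K * exp (kappa * ln r - r) <= eps.
Proof.
  intros hK heps. destruct (ln_le_linear kappa (1/2) ltac:(lra)) as (B & hB & h).
  exists (Rmax 1 (2 * (B + K / eps))). split; [apply Rmax_l|]. intros r hr.
  assert (h1 : 1 <= r) by max_lra.
  assert (h2 : 2 * (B + K / eps) <= r) by max_lra.
  specialize (h r h1).
  assert (h3 : exp (kappa * ln r - r) <= exp (- (K / eps))) by (apply exp_le_compat; lra).
  assert (h4 : K / eps <= exp (K / eps)) by (pose proof (exp_ineq1_le (K / eps)); lra).
  rewrite exp_Ropp in h3. pose proof (exp_pos (K / eps)) as hp.
  apply Rle_trans with (K * / exp (K / eps)); [now apply Rmult_le_compat_l|].
  apply Rle_div_l; [easy|]. apply (Rmult_le_compat_l eps) in h4; [|lra].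
  replace (eps * (K / eps)) with K in h4 by (field; lra). lra.
Qed.

Lemma Ctends_rpow_ratio (w : C) :
  Ctends (fun n => rpow (INR (S (S n))) w * rpow (INR (S n)) (- w))%C 1%C.
Proof.
  pose proof (Cmod_ge_0 w) as hw.
  apply Ctends_squeeze with (fun n => 5 * Cmod w * / INR (S n)).
  - destruct (INR_unbounded (2 * Cmod w + 1)) as [n0 hn0]. exists n0. intros n hn.
    assert (hn1 : INR n0 <= INR (S n)) by (apply le_INR; lia).
    set (t := ln (INR (S (S n)) / INR (S n))).
    assert (hb : 0 <= t <= / INR (S n)).
    { destruct (ln_succ_bounds (S n) ltac:(lia)) as [h1 h2].
      rewrite <- (S_INR (S n)) in h1, h2. split; [|exact h2].
      assert (0 < / INR (S (S n))) by (apply Rinv_0_lt_compat, lt_0_INR; lia).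
      unfold t. lra. }
    replace (rpow (INR (S (S n))) w * rpow (INR (S n)) (- w))%C with (Cexp (w * t)).
    2:{ unfold rpow, t. rewrite <- Cexp_add. f_equal.
        rewrite ln_div by (apply lt_0_INR; lia). rewrite RtoC_minus. ring. }
    assert (hm : Cmod (w * t)%C = Cmod w * t)
      by (rewrite Cmod_mult, Cmod_R, Rabs_pos_eq by lra; easy).
    assert (hs : Cmod w * t <= Cmod w * / INR (S n)) by (apply Rmult_le_compat_l; lra).
    assert (hs2 : Cmod w * / INR (S n) <= 1/2) by (apply (Rle_div_l (Cmod w)); lra).
    pose proof (Cexp_bound (w * t) ltac:(lra)) as hc. rewrite hm in hc.
    replace (Cexp (w * t) - 1)%C with ((Cexp (w * t) - 1 - w * t) + w * t)%C by ring.
    eapply Rle_trans; [apply Cmod_triangle|]. rewrite hm.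
    set (q := Cmod w * t) in *. assert (0 <= q) by (unfold q; nra).
    unfold Rsqr in hc. nra.
  - replace (Finite 0) with (Finite (5 * Cmod w * 0)) by (f_equal; ring).
    apply is_lim_seq_mult'; [apply is_lim_seq_const|apply is_lim_seq_inv_S].
Qed.

(** Multiplying [egf f] by its variable trades the exponent [mu] for [mu + 1]. *)
Lemma poisson_limit_up (f : nat -> C) (mu beta : C) : geom_growth f ->
  Ctends (fun n => f n * rpow (INR (S n)) (- mu))%C beta ->
  Ctends (fun n => (INR n * f (pred n)) * rpow (INR (S n)) (- (mu + 1)))%C beta /\
  (poisson_limit (fun n => INR n * f (pred n))%C (mu + 1) beta -> poisson_limit f mu beta).
Proof.
  intros hf hlim. split.
  - apply Ctends_incr_1.
    rewrite <- (Cmult_1_r beta).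
    eapply Ctends_ext; [|exact (Ctends_mult _ _ _ _ hlim (Ctends_rpow_ratio (- (mu + 1))))].
    intros n. cbv beta. simpl pred.
    assert (h0 : 0 < INR (S n)) by (apply lt_0_INR; lia).
    rewrite <- (rpow_1 (INR (S n)) h0).
    replace (- mu)%C with (1 - (mu + 1))%C by ring.
    unfold Cminus. rewrite rpow_add, !rpow_opp. field. split; apply rpow_neq_0.
  - intros h eps heps. destruct (h eps heps) as (r0 & hr0 & hr). exists r0. split; [easy|].
    intros r hrr. specialize (hr r hrr). rewrite egf_mul_var in hr by easy.
    replace (rpow r (- mu) * exp (- r) * egf f r - beta)%C
      with (rpow r (- (mu + 1)) * exp (- r) * (r * egf f r) - beta)%C; [easy|].
    f_equal. rewrite <- (rpow_1 r) at 1 by lra. rewrite !rpow_opp, rpow_add. field. split; apply rpow_neq_0.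
Qed.

(** Conversely, dropping the constant term and dividing by the variable lowers it. *)
Lemma poisson_limit_down (f : nat -> C) (mu beta : C) : geom_growth f ->
  Ctends (fun n => f n * rpow (INR (S n)) (- mu))%C beta ->
  let g := (fun n => f (S n) / INR (S n))%C in
  geom_growth g /\ Ctends (fun n => g n * rpow (INR (S n)) (- (mu - 1)))%C beta /\
  (poisson_limit g (mu - 1) beta -> poisson_limit f mu beta).
Proof.
  intros hf hlim g.
  assert (hS : forall n, RtoC (INR (S n)) <> 0%C)
    by (intros n; apply RtoC_neq_0, not_0_INR; lia).
  assert (hg : geom_growth g).
  { destruct (geom_growth_shift f 1 hf) as (K & q & hK & hq & h).
    exists K, q. repeat split; try easy. intros n. specialize (h n).
    rewrite Nat.add_1_r in h. unfold g. rewrite Cmod_div, Cmod_INR by easy.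
    eapply Rle_trans; [|exact h]. apply Rle_div_l; [apply lt_0_INR; lia|].
    assert (1 <= INR (S n)) by (rewrite S_INR; pose proof (pos_INR n); lra).
    pose proof (Cmod_ge_0 (f (S n))). nra. }
  split; [exact hg|split].
  - rewrite <- (Cmult_1_r beta).
    eapply Ctends_ext; [|exact (Ctends_mult _ _ _ _ (proj1 (Ctends_incr_1 _ _) hlim)
      (Ctends_rpow_ratio mu))].
    intros n. cbv beta. unfold g.
    assert (h0 : 0 < INR (S n)) by (apply lt_0_INR; lia).
    replace (- (mu - 1))%C with (1 + - mu)%C by ring.
    rewrite rpow_add, !rpow_opp, rpow_1 by easy. field.
    repeat split; try apply rpow_neq_0. apply hS.
  - intros h eps heps.
    destruct (h (eps / 2) ltac:(lra)) as (r1 & hr1 & h1).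
    destruct (exp_neg_beats_power (- Re mu) (Cmod (f O)) (eps / 2)) as (r2 & hr2 & h2);
      [apply Cmod_ge_0|lra|].
    exists (Rmax r1 r2). split; [max_lra|].
    intros r hr.
    assert (hrr1 : r1 <= r) by max_lra.
    assert (hrr2 : r2 <= r) by max_lra.
    specialize (h1 r hrr1). specialize (h2 r hrr2).
    assert (e : egf f r = (f O + r * egf g r)%C).
    { unfold egf. rewrite CSeries_incr_1 by now apply egf_summable. f_equal.
      - simpl. field.
      - rewrite <- CSeries_scal by now apply egf_summable.
        apply CSeries_ext; intros n. unfold g.
        rewrite fact_simpl, mult_INR, RtoC_mult. simpl Cpow.
        field. split; [apply INR_fact_neq_0_C|apply hS]. }
    rewrite e.
    replace (rpow r (- mu) * exp (- r) * (f O + r * egf g r) - beta)%C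
      with ((rpow r (- (mu - 1)) * exp (- r) * egf g r - beta)
            + f O * (rpow r (- mu) * exp (- r)))%C.
    2:{ replace (- (mu - 1))%C with (1 + - mu)%C by ring.
        rewrite rpow_add, rpow_1 by lra. ring. }
    eapply Rle_trans; [apply Cmod_triangle|].
    rewrite !Cmod_mult, Cmod_rpow, Cmod_R, (Rabs_pos_eq (exp (- r)))
      by (pose proof (exp_pos (- r)); lra).
    rewrite <- exp_plus.
    replace (Re (- mu)%C * ln r + - r) with (- Re mu * ln r - r)
      by (unfold Re; simpl; ring).
    lra.
Qed.

(** The two shifts move the exponent by one in either direction until [poisson_limit_base]
    applies. *)
Lemma poisson_limit_of_power_growth (f : nat -> C) (mu beta : C) : geom_growth f ->
  Ctends (fun n => f n * rpow (INR (S n)) (- mu))%C beta -> poisson_limit f mu beta.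
Proof.
  assert (H : forall k f mu, - INR k <= Re mu <= INR k + 1 -> geom_growth f ->
    Ctends (fun n => f n * rpow (INR (S n)) (- mu))%C beta -> poisson_limit f mu beta).
  { clear f mu. induction k as [|k IH]; intros f mu hk hf hlim.
    - apply poisson_limit_base; try easy. simpl in hk. lra.
    - rewrite S_INR in hk. pose proof (pos_INR k) as hk0.
      destruct (Rlt_le_dec (Re mu) (- INR k)) as [h|h].
      + destruct (poisson_limit_up f mu beta hf hlim) as [h1 h2].
        apply h2, IH; [|apply (geom_growth_mul_INR (fun n => f (pred n)));
                        now apply geom_growth_pred|exact h1].
        replace (Re (mu + 1)%C) with (Re mu + 1) by (unfold Re; simpl; ring). lra.
      + destruct (Rlt_le_dec (INR k + 1) (Re mu)) as [h'|h'].
        * destruct (poisson_limit_down f mu beta hf hlim) as (h1 & h2 & h3).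
          apply h3, IH; [|exact h1|exact h2].
          replace (Re (mu - 1)%C) with (Re mu - 1) by (unfold Re; simpl; ring). lra.
        * apply IH; [lra|easy|easy]. }
  intros hf hlim. destruct (INR_unbounded (Rabs (Re mu))) as [k hk].
  apply (H k); try easy. split_Rabs; lra.
Qed.

(** * Kummer's function and its contiguous relations *)

Lemma not_nonpos_int_away (c : C) : not_nonpos_int c ->
  exists d, 0 < d /\ forall n, d <= Cmod (c + INR n)%C.
Proof.
  intros hc. destruct (INR_unbounded (Cmod c + 1)) as [n0 hn0].
  destruct (finite_upper_bound (fun n => / Cmod (c + INR n)%C) n0) as (D & hD & h).
  exists (/ (D + 1)). split; [apply Rinv_0_lt_compat; lra|]. intros n.
  destruct (le_lt_dec n0 n) as [hn|hn].
  - apply Rle_trans with 1.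
    { rewrite <- Rinv_1. apply Rinv_le_contravar; lra. }
    pose proof (Cmod_triangle (c + INR n) (- c)) as ht.
    replace (c + INR n + - c)%C with (RtoC (INR n)) in ht by ring.
    rewrite Cmod_opp, Cmod_INR in ht. apply le_INR in hn. lra.
  - specialize (h n hn). cbv beta in h.
    assert (h0 : 0 < Cmod (c + INR n)%C) by (apply Cmod_gt_0; now apply not_nonpos_int_add).
    rewrite <- (Rinv_inv (Cmod (c + INR n)%C)).
    apply Rinv_le_contravar; [now apply Rinv_0_lt_compat|lra].
Qed.

(** Kummer's [M(a,c;y)] is [egf (kummer_coef a c) y]. *)
Definition kummer_coef (a c : C) (n : nat) : C := (poch a n / poch c n)%C.

Lemma kummer_coef_S (a c : C) (n : nat) : not_nonpos_int c ->
  kummer_coef a c (S n) = (kummer_coef a c n * ((a + INR n) / (c + INR n)))%C.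
Proof.
  intros hc. unfold kummer_coef. simpl poch. field.
  split; [now apply not_nonpos_int_add|now apply poch_neq_0].
Qed.

Lemma geom_growth_kummer (a c : C) : not_nonpos_int c -> geom_growth (kummer_coef a c).
Proof.
  intros hc. destruct (not_nonpos_int_away c hc) as (d & hd & h).
  pose proof (Cmod_ge_0 (a - c)%C) as h0.
  assert (h1 : 0 <= Cmod (a - c)%C / d) by (apply Rdiv_le_0_compat; lra).
  exists 1, (1 + Cmod (a - c)%C / d). repeat split; [lra|lra|].
  induction n as [|n IH].
  - unfold kummer_coef. simpl poch. simpl pow. rewrite Cmod_div, Cmod_1 by apply C1_nz. lra.
  - rewrite kummer_coef_S, Cmod_mult by easy. simpl pow.
    assert (hn := not_nonpos_int_add c n hc).
    replace ((a + INR n) / (c + INR n))%C with (1 + (a - c) / (c + INR n))%C by (field; easy).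
    assert (hb : Cmod (1 + (a - c) / (c + INR n))%C <= 1 + Cmod (a - c)%C / d).
    { eapply Rle_trans; [apply Cmod_triangle|]. rewrite Cmod_1, Cmod_div by easy.
      apply Rplus_le_compat_l, Rmult_le_compat_l; [easy|].
      apply Rinv_le_contravar; [easy|apply h]. }
    pose proof (Cmod_ge_0 (kummer_coef a c n)).
    pose proof (Cmod_ge_0 (1 + (a - c) / (c + INR n))%C).
    rewrite Rmult_1_l in IH |- *. rewrite (Rmult_comm (1 + Cmod (a - c)%C / d)).
    apply Rmult_le_compat; easy.
Qed.

Lemma kummer_contiguous_up (a c y : C) : not_nonpos_int c ->
  (y * egf (fun n => kummer_coef a c (S n)) y
   = a * (egf (kummer_coef (a + 1) c) y - egf (kummer_coef a c) y))%C.
Proof.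
  intros hc. pose proof (geom_growth_kummer a c hc) as g1.
  pose proof (geom_growth_kummer (a + 1) c hc) as g2.
  rewrite <- egf_mul_var by now apply geom_growth_succ.
  replace (a * (egf (kummer_coef (a + 1) c) y - egf (kummer_coef a c) y))%C
    with (a * egf (kummer_coef (a + 1) c) y + (- a) * egf (kummer_coef a c) y)%C by ring.
  rewrite <- !egf_scal, <- egf_plus by (try apply geom_growth_scal; easy).
  apply egf_ext. intros [|n].
  - simpl INR. rewrite Cmult_0_l. unfold kummer_coef. simpl. field.
  - simpl pred.
    assert (e : (a * poch (a + 1) (S n) = poch a (S n) * (a + INR (S n)))%C)
      by (rewrite <- poch_S_l; reflexivity).
    unfold kummer_coef.
    replace (a * (poch (a + 1) (S n) / poch c (S n)))%C
      with ((a * poch (a + 1) (S n)) / poch c (S n))%C by (field; now apply poch_neq_0).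
    rewrite e. field. now apply poch_neq_0.
Qed.

Lemma kummer_contiguous_down (a c y : C) : not_nonpos_int c ->
  (y * egf (fun n => kummer_coef a c (S n)) y
   = (c - a) * egf (kummer_coef (a - 1) c) y + (a - c + y) * egf (kummer_coef a c) y)%C.
Proof.
  intros hc. pose proof (geom_growth_kummer a c hc) as g1.
  pose proof (geom_growth_kummer (a - 1) c hc) as g2.
  replace ((a - c + y) * egf (kummer_coef a c) y)%C
    with ((a - c) * egf (kummer_coef a c) y + y * egf (kummer_coef a c) y)%C by ring.
  rewrite <- !egf_mul_var by (try apply geom_growth_succ; easy).
  assert (g3 : geom_growth (fun n => INR n * kummer_coef a c (pred n))%C).
  { apply (geom_growth_mul_INR (fun n => kummer_coef a c (pred n))).
    now apply geom_growth_pred. }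
  assert (g4 : geom_growth (fun n => (c - a) * kummer_coef (a - 1) c n)%C)
    by now apply geom_growth_scal.
  assert (g5 : geom_growth (fun n => (a - c) * kummer_coef a c n)%C)
    by now apply geom_growth_scal.
  rewrite <- !egf_scal by easy.
  rewrite <- (egf_plus _ _ y g5 g3), <- (egf_plus _ _ y g4) by now apply geom_growth_plus.
  apply egf_ext. intros [|n].
  - simpl INR. rewrite Cmult_0_l. unfold kummer_coef. simpl. field.
  - simpl pred. rewrite !(kummer_coef_S a c n hc). unfold kummer_coef.
    rewrite (poch_S_l (a - 1)). replace (a - 1 + 1)%C with a by ring.
    simpl poch. rewrite INR_C_S.
    field. split; [now apply poch_neq_0|now apply not_nonpos_int_add].
Qed.

(** [(a)_n / (c)_n ~ beta n^(a-c)]; for [a] not a pole, [beta] is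
    [Gamma c / Gamma a], but the condition also makes sense, with [beta = 0], when
    [(a)_n] eventually vanishes. *)
Definition kummer_limit (a c beta : C) : Prop :=
  Ctends (fun n => kummer_coef a c n * rpow (INR (S n)) (- (a - c)))%C beta.

Lemma Ctends_shifted_ratio (c : C) : not_nonpos_int c ->
  Ctends (fun n => INR (S (S n)) / (c + INR n))%C 1%C.
Proof.
  intros hc. apply Ctends_squeeze with (fun n => 2 * Cmod (2 - c)%C * / INR (S n)).
  - destruct (INR_unbounded (2 * Cmod c + 1)) as [n0 hn0]. exists n0. intros n hn.
    assert (h0 := not_nonpos_int_add c n hc). apply le_INR in hn.
    replace (INR (S (S n)) / (c + INR n) - 1)%C with ((2 - c) / (c + INR n))%C.
    2:{ rewrite !INR_C_S. field. easy. }
    rewrite Cmod_div by easy. pose proof (Cmod_ge_0 (2 - c)%C).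
    assert (hb : INR (S n) / 2 <= Cmod (c + INR n)%C).
    { pose proof (Cmod_triangle (c + INR n) (- c)) as ht.
      replace (c + INR n + - c)%C with (RtoC (INR n)) in ht by ring.
      rewrite Cmod_opp, Cmod_INR in ht. rewrite S_INR. lra. }
    assert (hS : 0 < INR (S n)) by (apply lt_0_INR; lia).
    replace (2 * Cmod (2 - c)%C * / INR (S n)) with (Cmod (2 - c)%C * / (INR (S n) / 2))
      by (field; lra).
    apply Rmult_le_compat_l; [easy|]. apply Rinv_le_contravar; lra.
  - replace (Finite 0) with (Finite (2 * Cmod (2 - c)%C * 0)) by (f_equal; ring).
    apply is_lim_seq_mult'; [apply is_lim_seq_const|apply is_lim_seq_inv_S].
Qed.

(** The step from [a] to [a - 1] may cross a pole of [Gamma], where the factor [a - 1]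
    vanishes; the abstract constant is carried through without dividing by it. *)
Lemma kummer_limit_pred (a c beta : C) : not_nonpos_int c ->
  kummer_limit a c beta -> kummer_limit (a - 1) c ((a - 1) * beta)%C.
Proof.
  intros hc h. unfold kummer_limit. apply Ctends_incr_1.
  replace ((a - 1) * beta)%C with ((a - 1) * ((beta * 1) * 1))%C by ring.
  eapply Ctends_ext; [|exact (Ctends_mult _ _ _ _ (Ctends_const (a - 1)%C)
    (Ctends_mult _ _ _ _ (Ctends_mult _ _ _ _ h (Ctends_rpow_ratio (- (a - c))))
       (Ctends_shifted_ratio c hc)))].
  intros n. cbv beta. unfold kummer_coef.
  assert (h0 : 0 < INR (S (S n))) by (apply lt_0_INR; lia).
  rewrite (poch_S_l (a - 1)). replace (a - 1 + 1)%C with a by ring.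
  replace (- (a - 1 - c))%C with (1 + - (a - c))%C by ring.
  rewrite rpow_add, rpow_1, (rpow_opp (INR (S n)) (- (a - c))) by easy.
  simpl poch. field. repeat split;
    first [now apply not_nonpos_int_add|apply rpow_neq_0|now apply poch_neq_0].
Qed.

(** * Gauss's product and the connection constants *)

Lemma Cpower_neq_0 (z w : C) : Cpower z w <> 0%C.
Proof. apply Cexp_neq_0. Qed.

Lemma Gamma_seq_neq_0 (z : C) (n : nat) : not_nonpos_int z -> Gamma_seq z n <> 0%C.
Proof.
  intros hz h. apply (Cmult_neq_0 (INR (fact n)) (Cpower (INR n) z));
    [apply INR_fact_neq_0_C|apply Cpower_neq_0|].
  assert (hp := poch_neq_0 z (S n) hz).
  replace (INR (fact n) * Cpower (INR n) z)%C with (Gamma_seq z n * poch z (S n))%C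
    by (unfold Gamma_seq; field; exact hp).
  rewrite h. ring.
Qed.

Lemma Gamma_tends (z : C) : not_nonpos_int z -> Ctends (Gamma_seq z) (Gamma z).
Proof. intros hz. destruct (Gamma_seq_lim z hz). now apply Ctends_Re_Im. Qed.

(** The factors of Gauss's product tend to [1] fast enough for the limit not to vanish. *)
Lemma Gamma_neq_0 (z : C) : not_nonpos_int z -> Gamma z <> 0%C.
Proof.
  intros hz h. destruct (Gamma_seq_step z hz) as (K & n0 & hK & hn0 & hstep).
  destruct (INR_unbounded (2 * K + 1)) as [n2 hn2].
  set (n1 := Nat.max n0 n2). set (A := K / INR n1).
  assert (hn1 : 2 * K + 1 < INR n1).
  { eapply Rlt_le_trans; [exact hn2|]. apply le_INR. unfold n1; lia. }
  assert (hA : 0 <= A <= 1/2).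
  { split; [apply Rdiv_le_0_compat; lra|]. apply Rle_div_l; lra. }
  assert (H : forall n, (n1 <= n)%nat ->
    Cmod (Gamma_seq z n1) * (1 - A + K / INR n) <= Cmod (Gamma_seq z n)).
  { intros n hn. induction hn as [|n hn IH].
    - unfold A. right. ring.
    - specialize (hstep n ltac:(unfold n1 in hn; lia)).
      set (d := K / INR n - K / INR (S n)) in *.
      assert (hn3 : INR n1 <= INR n) by now apply le_INR.
      assert (hK1 : 0 <= K / INR n <= A).
      { split; [apply Rdiv_le_0_compat; lra|]. apply Rmult_le_compat_l; [easy|].
        apply Rinv_le_contravar; lra. }
      assert (hd : 0 <= d).
      { unfold d. enough (K / INR (S n) <= K / INR n) by lra. apply Rmult_le_compat_l; [easy|].
        apply Rinv_le_contravar; [lra|]. apply le_INR; lia. }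
      assert (hK2 : 0 <= K / INR (S n)).
      { apply Rdiv_le_0_compat; [easy|]. apply lt_0_INR; lia. }
      pose proof (Cmod_triangle (Gamma_seq z (S n)) (Gamma_seq z n - Gamma_seq z (S n))) as ht.
      replace (Gamma_seq z (S n) + (Gamma_seq z n - Gamma_seq z (S n)))%C
        with (Gamma_seq z n) in ht by ring.
      rewrite (Cmod_sub_sym (Gamma_seq z n)) in ht.
      pose proof (Cmod_ge_0 (Gamma_seq z n1)) as g1.
      replace (K / INR (S n)) with (K / INR n - d) by (unfold d; ring).
      assert (hd1 : d <= 1) by (unfold d; lra).
      apply Rle_trans with (Cmod (Gamma_seq z n) * (1 - d)); [|lra].
      apply Rle_trans with (Cmod (Gamma_seq z n1) * (1 - A + K / INR n) * (1 - d)).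
      + rewrite Rmult_assoc. apply Rmult_le_compat_l; [easy|]. nra.
      + apply Rmult_le_compat_r; lra. }
  assert (hg : 0 < Cmod (Gamma_seq z n1)) by (apply Cmod_gt_0; now apply Gamma_seq_neq_0).
  assert (hl := Gamma_tends z hz). rewrite h in hl.
  assert (he : 0 < Cmod (Gamma_seq z n1) / 2) by lra.
  destruct (proj2 (is_lim_seq_spec _ _) hl (mkposreal _ he)) as [n3 hn3].
  specialize (hn3 (Nat.max n1 n3) ltac:(lia)). specialize (H (Nat.max n1 n3) ltac:(lia)).
  change (pos (mkposreal _ he)) with (Cmod (Gamma_seq z n1) / 2) in hn3.
  rewrite Rminus_0_r, Rabs_pos_eq in hn3 by apply Cmod_ge_0.
  replace (Gamma_seq z (Nat.max n1 n3) - 0)%C with (Gamma_seq z (Nat.max n1 n3)) in hn3 by ring.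
  assert (0 <= K / INR (Nat.max n1 n3)).
  { apply Rdiv_le_0_compat; [easy|]. apply Rlt_le_trans with (INR n1); [lra|]. apply le_INR; lia. }
  nra.
Qed.

(** The quotient of two Gauss products is [n^(c-a) (a)_(n+1) / (c)_(n+1)]; two index shifts
    bring it to the normalisation of [kummer_limit]. *)
Lemma kummer_limit_Gamma (a c : C) : not_nonpos_int a -> not_nonpos_int c ->
  kummer_limit a c (Gamma c / Gamma a)%C.
Proof.
  intros ha hc. unfold kummer_limit. do 2 apply Ctends_incr_1.
  assert (h1 := Ctends_mult _ _ _ _ (Gamma_tends c hc)
    (Ctends_inv _ _ (Gamma_neq_0 a ha) (Gamma_tends a ha))).
  assert (h2 := Ctends_mult _ _ _ _ (Ctends_rpow_ratio (- (a - c)))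
    (proj1 (Ctends_incr_1 _ _) (Ctends_rpow_ratio (- (a - c))))).
  apply Ctends_incr_1 in h1.
  assert (h3 := Ctends_mult _ _ _ _ h1 h2).
  replace (Gamma c * / Gamma a * (1 * 1))%C with (Gamma c / Gamma a)%C in h3
    by (unfold Cdiv; ring).
  revert h3. apply Ctends_ext. intros n. cbv beta.
  assert (hS : forall k, 0 < INR (S k)) by (intros k; apply lt_0_INR; lia).
  unfold Gamma_seq. rewrite !Cpower_pos by apply hS.
  change (Cexp (a * ln (INR (S n)))) with (rpow (INR (S n)) a).
  change (Cexp (c * ln (INR (S n)))) with (rpow (INR (S n)) c).
  rewrite !rpow_opp. replace (a - c)%C with (a + - c)%C by ring.
  rewrite !rpow_add, !rpow_opp. unfold kummer_coef.
  assert (p1 := poch_neq_0 a (S (S n)) ha). assert (p2 := poch_neq_0 c (S (S n)) hc).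
  field. repeat split; first [assumption|apply rpow_neq_0|apply INR_fact_neq_0_C].
Qed.

(** * Expansions on the two real rays *)

Lemma bsum_pow_bounded (f : nat -> C) (n : nat) :
  exists B, 0 <= B /\ forall u, Cmod u <= 1 -> Cmod (bsum (fun k => f k * u ^ k)%C n) <= B.
Proof.
  destruct (finite_upper_bound (fun k => Cmod (f k)) n) as (D & hD & h).
  exists (INR n * D). split; [apply Rmult_le_pos; [apply pos_INR|easy]|].
  intros u hu. apply Cmod_bsum_le. intros k hk.
  rewrite Cmod_mult, Cmod_pow. specialize (h k hk). cbv beta in h.
  assert (Cmod u ^ k <= 1) by (rewrite <- (pow1 k); apply pow_incr; split; [apply Cmod_ge_0|easy]).
  assert (0 <= Cmod u ^ k) by (apply pow_le, Cmod_ge_0).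
  pose proof (Cmod_ge_0 (f k)). nra.
Qed.

Lemma is_Cderive_inv_pow (y : R -> C) (t : R) (d : C) (k : nat) : y t <> 0%C ->
  is_Cderive y t d ->
  is_Cderive (fun s => (/ y s) ^ k)%C t (- d * (INR k * (/ y t) ^ S k))%C.
Proof.
  intros h0 hy. induction k as [|k IH].
  - apply (is_Cderive_eq _ _ _ _ (is_Cderive_const 1%C t)). simpl. ring.
  - apply is_Cderive_ext with (fun s => / y s * (/ y s) ^ k)%C; [easy|].
    eapply is_Cderive_eq;
      [apply is_Cderive_mult; [apply is_Cderive_inv; [exact h0|exact hy]|exact IH]|].
    rewrite INR_C_S. simpl Cpow. ring.
Qed.

Lemma is_Cderive_inv_poly (f : nat -> C) (y : R -> C) (t : R) (d : C) (n : nat) : y t <> 0%C ->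
  is_Cderive y t d ->
  is_Cderive (fun s => bsum (fun k => f k * (/ y s) ^ k)%C n) t
    (- d * bsum (fun k => INR k * f k * (/ y t) ^ S k)%C n)%C.
Proof.
  intros h0 hy. induction n as [|n IH].
  - apply (is_Cderive_eq _ _ _ _ (is_Cderive_const 0%C t)). simpl. ring.
  - eapply is_Cderive_eq.
    { apply is_Cderive_plus; [exact IH|].
      apply is_Cderive_scal, is_Cderive_inv_pow; [exact h0|exact hy]. }
    cbn [bsum]. ring.
Qed.

(** Coefficients of the expansion of [M(a,c;y)] that carries [exp y]; by Kummer's
    transformation the algebraic expansion has the coefficients of [c - a], in powers of
    [-1/y]. *)
Definition ray_coef (a c : C) (k : nat) : C :=
  (poch (c - a) k * poch (1 - a) k / INR (fact k))%C.

Lemma ray_coef_0 (a c : C) : ray_coef a c 0 = 1%C.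
Proof. unfold ray_coef. simpl. field. Qed.

Lemma ray_coef_S (a c : C) (k : nat) :
  (INR (S k) * ray_coef a c (S k) = (c - a) * (1 - a) * ray_coef (a - 1) c k)%C.
Proof.
  unfold ray_coef. rewrite !poch_S_l, fact_simpl, mult_INR, RtoC_mult.
  replace (c - (a - 1))%C with (c - a + 1)%C by ring.
  replace (1 - (a - 1))%C with (1 - a + 1)%C by ring.
  field. split; [apply INR_fact_neq_0_C|apply RtoC_neq_0, not_0_INR; lia].
Qed.

(** The left side is [u^2 d/du] of the truncated series, which is again such a series, for
    [a - 1]. *)
Lemma ray_coef_euler (a c u : C) (n : nat) :
  (bsum (fun k => INR k * ray_coef a c k * u ^ S k) (S n)
   = (c - a) * (1 - a) * u ^ 2 * bsum (fun k => ray_coef (a - 1) c k * u ^ k) n)%C.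
Proof.
  induction n as [|n IH]; [simpl; ring|].
  change (bsum (fun k => INR k * ray_coef a c k * u ^ S k) (S (S n)))%C
    with (bsum (fun k => INR k * ray_coef a c k * u ^ S k) (S n)
          + INR (S n) * ray_coef a c (S n) * u ^ S (S n))%C.
  rewrite IH, ray_coef_S. cbn [bsum]. simpl Cpow. ring.
Qed.

Definition kummer_scaled (a c : C) (r : R) : C :=
  (rpow r (- (a - c)) * exp (- r) * egf (kummer_coef a c) r)%C.

(** In the variable [1/r] this says that [kummer_scaled (a - 1)] is, up to a constant, the
    derivative of [kummer_scaled a]: its expansion in powers of [1/r] is a Taylor expansion
    at [0]. *)
Lemma is_Cderive_kummer_scaled (a c : C) (r : R) : not_nonpos_int c -> 0 < r ->
  is_Cderive (kummer_scaled a c) r ((c - a) * (/ r * / r) * kummer_scaled (a - 1) c r)%C.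
Proof.
  intros hc hr. unfold kummer_scaled.
  assert (hr0 : RtoC r <> 0%C) by (apply RtoC_neq_0; lra).
  assert (hid : is_Cderive (fun u => RtoC u) r 1%C)
    by (apply is_Cderive_RtoC; apply (is_derive_id (K := R_AbsRing))).
  assert (hexp : is_Cderive (fun u => RtoC (exp (- u))) r (RtoC (- exp (- r)))).
  { apply is_Cderive_RtoC. auto_derive; [easy|ring]. }
  eapply is_Cderive_eq.
  - apply is_Cderive_mult; [apply is_Cderive_mult; [apply is_Cderive_rpow, hr|exact hexp]|].
    apply (is_Cderive_egf _ (fun u => RtoC u)); [now apply geom_growth_kummer|exact hid].
  - assert (h := kummer_contiguous_down a c r hc).
    set (S1 := egf (fun n => kummer_coef a c (S n)) r) in *.
    replace S1 with (((c - a) * egf (kummer_coef (a - 1) c) r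
        + (a - c + r) * egf (kummer_coef a c) r) / r)%C by (rewrite <- h; field; easy).
    replace (- (a - 1 - c))%C with (1 + - (a - c))%C by ring.
    rewrite rpow_add, rpow_1, RtoC_opp by easy. field. easy.
Qed.

Lemma kummer_scaled_bounded (a c beta : C) : not_nonpos_int c -> kummer_limit a c beta ->
  poisson_limit (kummer_coef a c) (a - c) beta.
Proof.
  intros hc h. apply poisson_limit_of_power_growth; [now apply geom_growth_kummer|exact h].
Qed.

(** By induction on [N] for all [a]: the derivative of the remainder of order [N + 1] is
    [O(r^(-N-2))] by the case of [a - 1], and the remainder tends to [0] at infinity. *)
Lemma kummer_ray_expansion (c : C) (N : nat) : not_nonpos_int c ->
  forall a beta, kummer_limit a c beta ->
  exists K r0, 0 <= K /\ 1 <= r0 /\ forall r, r0 <= r ->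
    Cmod (kummer_scaled a c r
          - beta * bsum (fun k => ray_coef a c k * (/ r) ^ k) N)%C <= K * (/ r) ^ N.
Proof.
  intros hc. induction N as [|N IH]; intros a beta hlim.
  - destruct (kummer_scaled_bounded a c beta hc hlim 1 Rlt_0_1) as (r0 & h0 & h).
    exists (Cmod beta + 1), r0. pose proof (Cmod_ge_0 beta). repeat split; [lra|easy|].
    intros r hr. specialize (h r hr). cbn [bsum]. simpl pow. rewrite Rmult_1_r.
    replace (kummer_scaled a c r - beta * 0)%C with ((kummer_scaled a c r - beta) + beta)%C by ring.
    eapply Rle_trans; [apply Cmod_triangle|]. unfold kummer_scaled. lra.
  - destruct (IH _ _ (kummer_limit_pred a c beta hc hlim)) as (K & r0 & hK & hr0 & h).
    set (K' := Cmod (c - a)%C * K).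
    assert (hK' : 0 <= K') by (unfold K'; apply Rmult_le_pos; [apply Cmod_ge_0|easy]).
    exists K', r0. repeat split; [easy|easy|]. intros r hr.
    set (D := fun t : R => (kummer_scaled a c t
          - beta * bsum (fun k => ray_coef a c k * (/ t) ^ k) (S N))%C).
    set (D' := fun t : R => ((c - a) * (/ t * / t) * (kummer_scaled (a - 1) c t
          - (a - 1) * beta * bsum (fun k => ray_coef (a - 1) c k * (/ t) ^ k) N))%C).
    assert (hD : forall t, r <= t -> is_Cderive D t (D' t)).
    { intros t ht. assert (t0 : RtoC t <> 0%C) by (apply RtoC_neq_0; lra).
      eapply is_Cderive_eq.
      - apply is_Cderive_minus; [apply is_Cderive_kummer_scaled; [easy|lra]|].
        apply is_Cderive_scal, (is_Cderive_inv_poly _ (fun t => RtoC t)); [easy|].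
        apply is_Cderive_RtoC. apply (is_derive_id (K := R_AbsRing)).
      - unfold D'. rewrite ray_coef_euler. change (@one R_AbsRing) with 1. simpl Cpow. ring. }
    assert (hDle : forall t, r <= t -> Cmod (D' t) <= K' * (/ r) ^ N * (/ t * / t)).
    { intros t ht. unfold D'. rewrite !Cmod_mult.
      rewrite Cmod_inv, Cmod_R, (Rabs_pos_eq t) by (try apply RtoC_neq_0; lra).
      specialize (h t ltac:(lra)).
      assert (i1 : 0 < / t) by (apply Rinv_0_lt_compat; lra).
      assert (i2 : (/ t) ^ N <= (/ r) ^ N).
      { apply pow_incr. split; [lra|]. apply Rinv_le_contravar; lra. }
      unfold K'. replace (Cmod (c - a)%C * K * (/ r) ^ N * (/ t * / t))
        with (Cmod (c - a)%C * (/ t * / t) * (K * (/ r) ^ N)) by ring.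
      apply Rmult_le_compat_l.
      { apply Rmult_le_pos; [apply Cmod_ge_0|nra]. }
      eapply Rle_trans; [exact h|]. now apply Rmult_le_compat_l. }
    assert (hD0 : forall eps, 0 < eps -> exists r2, r <= r2 /\ Cmod (D r2) <= eps).
    { intros eps heps.
      destruct (kummer_scaled_bounded a c beta hc hlim (eps / 2) ltac:(lra)) as (r1 & h1 & hr1).
      destruct (bsum_pow_bounded (fun k => ray_coef a c (S k)) N) as (B & hB & hb).
      pose proof (Cmod_ge_0 beta) as hbeta.
      set (r2 := Rmax (Rmax r r1) (2 * (Cmod beta * B) / eps)).
      assert (q1 : r <= r2) by (unfold r2; max_lra).
      assert (q2 : r1 <= r2) by (unfold r2; max_lra).
      assert (q3 : 2 * (Cmod beta * B) / eps <= r2) by apply Rmax_r.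
      exists r2. split; [exact q1|]. unfold D. rewrite bsum_S_l, ray_coef_0.
      rewrite (bsum_ext (fun k => ray_coef a c (S k) * (/ r2) ^ S k)%C
         (fun k => / r2 * (ray_coef a c (S k) * (/ r2) ^ k))%C) by (intros; simpl; ring).
      rewrite bsum_scal.
      set (X := bsum _ N).
      replace (kummer_scaled a c r2 - beta * (1 * (/ r2) ^ 0 + / r2 * X))%C
        with ((kummer_scaled a c r2 - beta) - / r2 * (beta * X))%C by (simpl; ring).
      eapply Rle_trans; [apply Cmod_sub_le|].
      specialize (hr1 r2 q2). fold (kummer_scaled a c r2) in hr1.
      assert (hi : Cmod (/ r2)%C = / r2).
      { rewrite Cmod_inv, Cmod_R, Rabs_pos_eq by (try apply RtoC_neq_0; lra). easy. }
      assert (hX : Cmod X <= B).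
      { apply hb. rewrite hi. rewrite <- Rinv_1. apply Rinv_le_contravar; lra. }
      rewrite !Cmod_mult, hi.
      assert (/ r2 * (Cmod beta * Cmod X) <= eps / 2).
      { rewrite Rmult_comm. apply Rle_div_l; [lra|].
        apply Rle_div_l in q3; [|easy].
        assert (Cmod beta * Cmod X <= Cmod beta * B) by now apply Rmult_le_compat_l. lra. }
      lra. }
    apply le_epsilon. intros eps heps. destruct (hD0 eps heps) as (r2 & h2 & he).
    change (Cmod (D r) <= K' * (/ r) ^ S N + eps).
    assert (hmv := mean_value_ineq D D' (fun t => - (K' * (/ r) ^ N) * / t)
      (fun t => K' * (/ r) ^ N * (/ t * / t)) r r2 h2
      ltac:(intros t ht; apply hD; lra)
      ltac:(intros t ht; auto_derive; [lra|field; lra])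
      ltac:(intros t ht; apply hDle; lra)).
    cbv beta in hmv.
    replace (D r) with (D r2 - (D r2 - D r))%C by ring.
    eapply Rle_trans; [apply Cmod_sub_le|].
    assert (0 <= K' * (/ r) ^ N * / r2).
    { apply Rmult_le_pos; [apply Rmult_le_pos; [exact hK'|apply pow_le]|];
        left; apply Rinv_0_lt_compat; lra. }
    simpl pow. lra.
Qed.

(** * Kummer's transformation *)

(** [Sum_k (-1)^k f k / (k! (n-k)!)], that is [1/n!] times an iterated difference of [f]. *)
Definition alternating_convolution (f : nat -> C) (n : nat) : C :=
  bsum (fun k => (-1) ^ k * f k / (INR (fact k) * INR (fact (n - k))))%C (S n).

Lemma alternating_convolution_S (f : nat -> C) (n : nat) :
  (INR (S n) * alternating_convolution f (S n)
   = alternating_convolution (fun k => f k - f (S k)) n)%C.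
Proof.
  unfold alternating_convolution. rewrite <- bsum_scal.
  set (A := fun k => (INR k * ((-1) ^ k * f k / (INR (fact k) * INR (fact (S n - k)))))%C).
  set (B := fun k => (INR (S n - k) * ((-1) ^ k * f k / (INR (fact k) * INR (fact (S n - k)))))%C).
  rewrite (bsum_ext _ (fun k => A k + B k)%C).
  2:{ intros k hk. unfold A, B. rewrite (minus_INR (S n) k) by lia. rewrite RtoC_minus. ring. }
  rewrite bsum_plus, (bsum_S_l A). cbn [bsum]. 
  change (bsum B n + B n)%C with (bsum B (S n)).
  replace (A O) with (RtoC 0) by (unfold A; simpl; ring).
  replace (B (S n)) with (RtoC 0) by (unfold B; rewrite Nat.sub_diag; simpl; ring).
  rewrite Cplus_0_l, Cplus_0_r. change (bsum (fun k => A (S k)) n + A (S n))%C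
    with (bsum (fun k => A (S k)) (S n)).
  rewrite <- bsum_plus.
  change (bsum (fun k => A (S k) + B k)%C (S n) = bsum (fun k =>
    (-1) ^ k * (f k - f (S k)) / (INR (fact k) * INR (fact (n - k))))%C (S n)).
  apply bsum_ext. intros k hk.
  unfold A, B. simpl (S n - S k)%nat.
  replace (S n - k)%nat with (S (n - k)) by lia.
  rewrite !fact_simpl, !mult_INR, !RtoC_mult. simpl Cpow.
  field. repeat split; first [apply INR_fact_neq_0_C|apply RtoC_neq_0, not_0_INR; lia].
Qed.

Lemma alternating_convolution_scal (w : C) (f : nat -> C) (n : nat) :
  (alternating_convolution (fun k => w * f k) n = w * alternating_convolution f n)%C.
Proof.
  unfold alternating_convolution. rewrite <- bsum_scal. apply bsum_ext. intros k _.
  field. split; apply INR_fact_neq_0_C.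
Qed.

(** The Chu-Vandermonde sum, by induction on [n] for all [c]: one difference turns
    [kummer_coef a c] into a multiple of [kummer_coef a (c + 1)]. *)
Lemma alternating_convolution_kummer (a : C) (n : nat) : forall c, not_nonpos_int c ->
  (alternating_convolution (kummer_coef a c) n = kummer_coef (c - a) c n / INR (fact n))%C.
Proof.
  induction n as [|n IH]; intros c hc.
  - unfold alternating_convolution, kummer_coef. simpl. field.
  - assert (hc' := not_nonpos_int_succ c hc).
    assert (hc0 : c <> 0%C).
    { rewrite <- (Cplus_0_r c). apply (not_nonpos_int_add c 0 hc). }
    assert (hS : RtoC (INR (S n)) <> 0%C) by (apply RtoC_neq_0, not_0_INR; lia).
    assert (e := alternating_convolution_S (kummer_coef a c) n).
    replace (alternating_convolution (fun k => kummer_coef a c k - kummer_coef a c (S k)) n)%C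
      with (alternating_convolution (fun k => (c - a) / c * kummer_coef a (c + 1) k) n)%C in e.
    2:{ apply bsum_ext. intros k _. f_equal. f_equal. unfold kummer_coef.
        assert (p := poch_S_l c k). assert (p1 := poch_neq_0 c k hc).
        assert (p2 := not_nonpos_int_add c k hc). simpl poch in *.
        replace (poch (c + 1) k) with (poch c k * (c + INR k) / c)%C by (rewrite p; field; easy).
        field. easy. }
    rewrite alternating_convolution_scal, IH in e by easy.
    replace (alternating_convolution (kummer_coef a c) (S n)) with
      ((INR (S n) * alternating_convolution (kummer_coef a c) (S n)) / INR (S n))%C
      by (field; easy).
    rewrite e. unfold kummer_coef. rewrite !(poch_S_l _ n), fact_simpl, mult_INR, RtoC_mult.
    replace (c + 1 - a)%C with (c - a + 1)%C by ring.
    field. repeat split; first [assumption|apply INR_fact_neq_0_C|now apply poch_neq_0].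
Qed.

Lemma kummer_transformation (a c : C) (r : R) : not_nonpos_int c ->
  (egf (kummer_coef (c - a) c) r = exp r * egf (kummer_coef a c) (- r))%C.
Proof.
  intros hc. set (w := fun k => (kummer_coef a c k * ((- r) ^ k / INR (fact k)))%C).
  assert (hw : abs_summable w) by (apply egf_summable; now apply geom_growth_kummer).
  set (v := fun k => r ^ k / INR (fact k)).
  assert (hv : is_series v (exp r)) by apply exp_is_series.
  assert (hva : ex_series (fun n => Rabs (v n))).
  { apply (ex_series_ext (V := R_NormedModule) (fun n => Rabs r ^ n / INR (fact n))).
    - intros n. unfold v. unfold Rdiv. rewrite Rabs_mult, RPow_abs.
      rewrite (Rabs_pos_eq (/ _)); [easy|]. left. apply Rinv_0_lt_compat, INR_fact_lt_0.
    - apply exp_ex_series. }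
  assert (key : forall n, bsum (fun k => w k * v (n - k)%nat)%C (S n)
     = (kummer_coef (c - a) c n * (r ^ n / INR (fact n)))%C).
  { intros n.
    replace (kummer_coef (c - a) c n * (r ^ n / INR (fact n)))%C
      with (r ^ n * (kummer_coef (c - a) c n / INR (fact n)))%C by (field; apply INR_fact_neq_0_C).
    rewrite <- alternating_convolution_kummer by easy.
    unfold alternating_convolution. rewrite <- bsum_scal. apply bsum_ext. intros k hk.
    unfold w, v. rewrite RtoC_div, RtoC_pow by apply INR_fact_neq_0.
    replace ((- RtoC r) ^ k)%C with ((-1) ^ k * r ^ k)%C.
    2:{ rewrite <- Cpow_mult_l. f_equal. ring. }
    replace (r ^ n)%C with (r ^ k * r ^ (n - k))%C
      by (rewrite <- Cpow_add_r; f_equal; lia).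
    field. split; apply INR_fact_neq_0_C. }
  (* The Cauchy product with the exponential series, one real coordinate at a time. *)
  assert (hL : forall L : C -> R, (forall z z', L (z + z')%C = L z + L z') ->
     (forall z x, L (z * RtoC x)%C = L z * x) -> (forall z, Rabs (L z) <= Cmod z) -> L 0%C = 0 ->
     Series (fun n => L (kummer_coef (c - a) c n * (r ^ n / INR (fact n)))%C)
     = Series (fun n => L (w n)) * exp r).
  { intros L hadd hmul hle h0.
    assert (habs : ex_series (fun n => Rabs (L (w n)))).
    { apply (ex_series_le (V := R_CompleteNormedModule) _ (fun n => Cmod (w n))); [|exact hw].
      intros n. change (norm (Rabs (L (w n)))) with (Rabs (Rabs (L (w n)))).
      rewrite Rabs_Rabsolu. apply hle. }
    assert (hsum : forall (f : nat -> C) n, sum_f_R0 (fun k => L (f k)) n = L (bsum f (S n))).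
    { intros f n. induction n as [|n IH]; [simpl; rewrite Cplus_0_l; easy|].
      simpl sum_f_R0. rewrite IH. now rewrite <- hadd. }
    rewrite <- (is_series_unique _ _ (is_series_mult _ _ _ _
      (Series_correct _ (ex_series_Rabs _ habs)) hv habs hva)).
    apply Series_ext. intros n. rewrite <- key, <- hsum. apply sum_eq. intros k _. apply hmul. }
  unfold egf at 2. fold w. apply injective_projections.
  - transitivity (Series (fun n => Re (w n)) * exp r); [|unfold CSeries; simpl; ring].
    apply hL; [easy| |apply re_le_Cmod|easy]. intros z x. unfold Re. simpl. ring.
  - transitivity (Series (fun n => Im (w n)) * exp r); [|unfold CSeries; simpl; ring].
    apply hL; [easy| |apply Im_le_Cmod|easy]. intros z x. unfold Im. simpl. ring.
Qed.

(** So [kummer_ray_expansion] at [c - a] is the expansion on the negative ray. *)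
Lemma kummer_scaled_reflect (a c : C) (r : R) : not_nonpos_int c ->
  kummer_scaled (c - a) c r = (rpow r a * egf (kummer_coef a c) (- r))%C.
Proof.
  intros hc. unfold kummer_scaled. rewrite kummer_transformation by easy.
  replace (- (c - a - c))%C with a by ring.
  rewrite exp_Ropp, RtoC_inv by (pose proof (exp_pos r); lra).
  field. apply RtoC_neq_0. pose proof (exp_pos r); lra.
Qed.

(** * Truncated expansions and a stable two-point problem *)

Lemma ray_coef_contiguous (a c : C) (k : nat) :
  ray_coef (a + 1) c (S k)
  = (ray_coef a c (S k) + (2 * a - c - INR k) * ray_coef a c k)%C.
Proof.
  unfold ray_coef. rewrite (poch_S_l (c - (a + 1))), (poch_S_l (1 - (a + 1))).
  replace (c - (a + 1) + 1)%C with (c - a)%C by ring.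
  replace (1 - (a + 1) + 1)%C with (1 - a)%C by ring.
  simpl poch. rewrite fact_simpl, mult_INR, RtoC_mult, INR_C_S.
  field. split; [apply INR_fact_neq_0_C|apply INR_S_neq_0_C].
Qed.

(** The truncated series satisfies the contiguous relation up to its first omitted term. *)
Lemma ray_coef_sum_contiguous (a c u : C) (n : nat) :
  ((1 + (2 * a - c) * u) * bsum (fun k => ray_coef a c k * u ^ k) n
   - bsum (fun k => INR k * ray_coef a c k * u ^ S k) n
   = bsum (fun k => ray_coef (a + 1) c k * u ^ k) (S n) - ray_coef a c n * u ^ n)%C.
Proof.
  induction n as [|n IH].
  - simpl. rewrite !ray_coef_0. ring.
  - set (P := bsum (fun k => ray_coef a c k * u ^ k)%C) in *.
    set (Q := bsum (fun k => INR k * ray_coef a c k * u ^ S k)%C) in *.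
    set (W := bsum (fun k => ray_coef (a + 1) c k * u ^ k)%C) in *.
    change (P (S n)) with (P n + ray_coef a c n * u ^ n)%C.
    change (Q (S n)) with (Q n + INR n * ray_coef a c n * u ^ S n)%C.
    change (W (S (S n))) with (W (S n) + ray_coef (a + 1) c (S n) * u ^ S n)%C.
    rewrite ray_coef_contiguous.
    replace (W (S n)) with ((1 + (2 * a - c) * u) * P n - Q n + ray_coef a c n * u ^ n)%C
      by (rewrite IH; ring).
    simpl Cpow. ring.
Qed.

(** A two-point problem for a weakly coupled pair: [p] is known at the left end, [t] at the
    right end, and the weight [G exp s] grows from left to right.  Both integrations then
    run in the direction in which the weight of the other component is absorbed, and the
    coupling over a path of length of order [r] is only [O(1/r)]. *)
Lemma two_point_bound (Q : R) : 0 <= Q ->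
  exists K, 0 <= K /\ forall (r G eps : R) (p t p' t' : R -> C),
    1 <= r -> 8 * (Q * Q) <= r -> 0 < G -> 0 <= eps ->
    (forall s, - r <= s <= r -> is_Cderive p s (p' s)) ->
    (forall s, - r <= s <= r -> is_Cderive t s (t' s)) ->
    (forall s, - r <= s <= r -> Cmod (p' s) <= Q * (G * exp s) * (Cmod (t s) + eps)) ->
    (forall s, - r <= s <= r ->
       Cmod (t' s) <= Q * / (r * r) * / (G * exp s) * (Cmod (p s) + r * eps)) ->
    Cmod (p (- r)) <= Q * eps -> Cmod (t r) <= Q * eps ->
    forall s, - r <= s <= r -> Cmod (p s) <= K * eps * (1 + G * exp s).
Proof.
  intros hQ. set (C0 := Q + Q * (Q + 1) + 2 * (Q * Q)).
  assert (hC0 : 0 <= C0) by (unfold C0; nra).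
  exists (2 * C0). split; [lra|].
  intros r G eps p t p' t' hr hrQ hG heps dp dt bp bt b1 b2.
  assert (hw : forall s, 0 < G * exp s) by (intros s; apply Rmult_lt_0_compat; [easy|apply exp_pos]).
  set (h := fun s => Cmod (p s) / (1 + G * exp s)).
  assert (hcont : forall s, - r <= s <= r -> continuity_pt h s).
  { intros s hs. destruct (dp s hs) as [d1 d2].
    apply continuity_pt_filterlim.
    assert (c1 : continuous (fun u => Re (p u) * Re (p u) + Im (p u) * Im (p u)) s).
    { eapply is_derive_continuous.
      apply (is_derive_Rplus (fun u => Re (p u) * Re (p u)) (fun u => Im (p u) * Im (p u)));
        apply is_derive_Rmult; eassumption. }
    assert (c2 : continuous (fun u => / (1 + G * exp u)) s).
    { apply (ex_derive_continuous (V := R_NormedModule)). auto_derive.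
      specialize (hw s). lra. }
    apply (continuous_mult (K := R_AbsRing) (fun u => Cmod (p u)) (fun u => / (1 + G * exp u)));
      [|exact c2].
    apply continuous_ext with (fun u => sqrt (Re (p u) * Re (p u) + Im (p u) * Im (p u))).
    { intros u. unfold Cmod, Re, Im. f_equal. ring. }
    apply (continuous_comp (fun u => Re (p u) * Re (p u) + Im (p u) * Im (p u)) sqrt);
      [exact c1|apply continuous_sqrt]. }
  destruct (continuity_ab_maj h (- r) r ltac:(lra) hcont) as (sm & hmax & hsm).
  set (X := h sm).
  assert (hX0 : 0 <= X).
  { unfold X, h. apply Rdiv_le_0_compat; [apply Cmod_ge_0|]. specialize (hw sm). lra. }
  assert (hX : forall s, - r <= s <= r -> Cmod (p s) <= X * (1 + G * exp s)).
  { intros s hs. specialize (hmax s hs). unfold h in hmax at 1. fold X in hmax.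
    assert (hws := hw s). apply (proj1 (Rle_div_l (Cmod (p s)) X (1 + G * exp s) ltac:(lra))), hmax. }
  assert (hXe : X = h sm) by reflexivity. clearbody X.
  assert (hre : 0 <= r * eps) by (apply Rmult_le_pos; lra).
  assert (hri : 0 < / r) by (apply Rinv_0_lt_compat; lra).
  assert (ht : forall s, - r <= s <= r ->
    Cmod (t s) <= Q * eps + Q * / (r * r) * (X + r * eps) * / (G * exp s) + 2 * Q * / r * X).
  { intros s hs. set (A := Q * / (r * r) * (X + r * eps)). set (B := Q * / (r * r) * X).
    assert (hr2 : 0 < / (r * r)) by (apply Rinv_0_lt_compat; nra).
    assert (hA : 0 <= A) by (unfold A; repeat apply Rmult_le_pos; lra).
    assert (hB : 0 <= B) by (unfold B; repeat apply Rmult_le_pos; lra).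
    assert (hd : forall v, s <= v <= r ->
      is_derive (fun v => B * v - A * / (G * exp v)) v (B + A * / (G * exp v))).
    { intros v hv. pose proof (hw v). pose proof (exp_pos v). auto_derive; [lra|].
      field. split; lra. }
    assert (hmv := mean_value_ineq t t' (fun v => B * v - A * / (G * exp v))
       (fun v => B + A * / (G * exp v)) s r ltac:(lra)
       ltac:(intros v hv; apply dt; lra) hd).
    assert (hb : forall v, s <= v <= r -> Cmod (t' v) <= B + A * / (G * exp v)).
    { intros v hv. eapply Rle_trans; [apply bt; lra|].
      specialize (hX v ltac:(lra)). pose proof (hw v) as hwv. pose proof (exp_pos v) as hev.
      replace (B + A * / (G * exp v)) with
        (Q * / (r * r) * / (G * exp v) * (X * (1 + G * exp v) + r * eps))
        by (unfold A, B; field; repeat split; lra).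
      apply Rmult_le_compat_l; [|lra].
      repeat apply Rmult_le_pos; try lra. left. now apply Rinv_0_lt_compat. }
    specialize (hmv hb). cbv beta in hmv.
    assert (hi1 : 0 <= A * / (G * exp r)).
    { apply Rmult_le_pos; [easy|]. left. apply Rinv_0_lt_compat, hw. }
    replace (t s) with (t r - (t r - t s))%C by ring.
    eapply Rle_trans; [apply Cmod_sub_le|].
    assert (hB2 : B * r - B * s <= 2 * Q * / r * X).
    { replace (2 * Q * / r * X) with (B * (2 * r)) by (unfold B; field; lra). nra. }
    lra. }
  (* The bound for [t] fed back into [p]: the gain is the factor [1/r] in front of [X]. *)
  assert (hp : forall s, - r <= s <= r ->
     Cmod (p s) <= (C0 * eps + 4 * (Q * Q) * / r * X) * (1 + G * exp s)).
  { intros s hs. set (A := Q * (Q * eps + 2 * Q * / r * X + eps)).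
    set (B := Q * Q * / (r * r) * (X + r * eps)).
    assert (hr2 : 0 < / (r * r)) by (apply Rinv_0_lt_compat; nra).
    assert (hqr : 0 <= 2 * Q * / r * X) by (repeat apply Rmult_le_pos; lra).
    assert (hA : 0 <= A) by (unfold A; apply Rmult_le_pos; [|assert (0 <= Q * eps) by (apply Rmult_le_pos; lra)]; lra).
    assert (hB : 0 <= B) by (unfold B; repeat apply Rmult_le_pos; lra).
    assert (hmv := mean_value_ineq p p' (fun v => B * v + A * (G * exp v))
       (fun v => B + A * (G * exp v)) (- r) s ltac:(lra)
       ltac:(intros v hv; apply dp; lra)
       ltac:(intros v hv; auto_derive; [easy|ring])).
    assert (hb : forall v, - r <= v <= s -> Cmod (p' v) <= B + A * (G * exp v)).
    { intros v hv. eapply Rle_trans; [apply bp; lra|].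
      specialize (ht v ltac:(lra)). pose proof (hw v) as hwv. pose proof (exp_pos v) as hev.
      replace (B + A * (G * exp v)) with (Q * (G * exp v) *
        ((Q * eps + Q * / (r * r) * (X + r * eps) * / (G * exp v) + 2 * Q * / r * X) + eps))
        by (unfold A, B; field; repeat split; lra).
      apply Rmult_le_compat_l; [|lra]. apply Rmult_le_pos; lra. }
    specialize (hmv hb). cbv beta in hmv.
    pose proof (hw (- r)) as h1. pose proof (hw s) as h2.
    replace (p s) with (p (- r)%R + (p s - p (- r)%R))%C by ring.
    eapply Rle_trans; [apply Cmod_triangle|].
    assert (h3 : 0 <= A * (G * exp (- r))) by (apply Rmult_le_pos; lra).
    assert (hB2 : B * s - B * - r <= 2 * (Q * Q) * / r * X + 2 * (Q * Q) * eps).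
    { replace (2 * (Q * Q) * / r * X + 2 * (Q * Q) * eps) with (B * (2 * r))
        by (unfold B; field; lra).
      assert (B * (s + r) <= B * (2 * r)) by (apply Rmult_le_compat_l; lra). lra. }
    assert (e1 : 0 <= Q * Q * / r * X) by (repeat apply Rmult_le_pos; lra).
    assert (e2 : 0 <= Q * Q * eps) by (repeat apply Rmult_le_pos; lra).
    assert (e3 : 0 <= Q * eps) by (apply Rmult_le_pos; lra).
    set (w := G * exp s) in *. unfold C0.
    replace (A * w) with ((Q * (Q + 1) * eps + 2 * (Q * Q) * / r * X) * w) in hmv
      by (unfold A; ring).
    assert (0 <= Q * Q * / r * X * w) by (apply Rmult_le_pos; lra).
    assert (0 <= Q * Q * eps * w) by (apply Rmult_le_pos; lra).
    assert (0 <= Q * eps * w) by (apply Rmult_le_pos; lra).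
    nra. }
  assert (hXs : X <= C0 * eps + 4 * (Q * Q) * / r * X).
  { rewrite hXe at 1. unfold h. apply Rle_div_l; [specialize (hw sm); lra|]. now apply hp. }
  assert (hhalf : 4 * (Q * Q) * / r <= 1/2) by (apply (Rle_div_l (4 * (Q * Q))); lra).
  assert (hX2 : X <= 2 * C0 * eps) by nra.
  intros s hs. eapply Rle_trans; [now apply hX|].
  apply Rmult_le_compat_r; [specialize (hw s); lra|exact hX2].
Qed.

(** * A path between the two real rays *)

(** Parabolic arcs from [-r] to [r] through the upper ([sg = 1]) or lower ([sg = -1]) half
    plane.  The real part is the parameter, so that the weight [exp (Re y)] has logarithmic
    derivative [1] along the path; on a circle it would be nearly constant close to the real
    axis, and the estimates would lose a power of [r]. *)
Definition arc_height (r s : R) : R := (r * r - s * s) / r.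
Definition arc (sg r s : R) : C := (s, sg * arc_height r s).
Definition arc_log (sg r s : R) : C := hlog sg s (arc_height r s).
Definition arc_speed (sg r s : R) : C := (1, sg * (- 2 * s / r)).

Lemma arc_height_bounds (r s : R) : 0 < r -> - r <= s <= r ->
  0 <= arc_height r s /\
  3 / 4 * (r * r) <= s * s + arc_height r s * arc_height r s <= r * r.
Proof.
  intros hr hs. unfold arc_height.
  assert (h1 : 0 <= r * r - s * s) by nra.
  split; [now apply Rdiv_le_0_compat|].
  assert (e : (s * s + (r * r - s * s) / r * ((r * r - s * s) / r))
    = (r * r) - s * s * (r * r - s * s) / (r * r)) by (field; lra).
  rewrite e. set (q := s * s) in *. set (w := r * r) in *.
  assert (hw : 0 < w) by (unfold w; nra). assert (hq : 0 <= q) by (unfold q; nra).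
  split.
  - enough (q * (w - q) / w <= w / 4) by lra.
    apply Rle_div_l; [lra|]. pose proof (pow2_ge_0 (q - w / 2)). nra.
  - assert (0 <= q * (w - q) / w) by (apply Rdiv_le_0_compat; [apply Rmult_le_pos|]; lra). lra.
Qed.

Lemma Cmod_arc (sg r s : R) : sg = 1 \/ sg = -1 -> 0 < r -> - r <= s <= r ->
  r / 2 <= Cmod (arc sg r s) <= r.
Proof.
  intros hsg hr hs. destruct (arc_height_bounds r s hr hs) as (_ & h1 & h2).
  unfold arc. rewrite Cmod_pair.
  replace (sg * arc_height r s * (sg * arc_height r s)) with (arc_height r s * arc_height r s)
    by (destruct hsg as [->| ->]; ring).
  set (q := s * s + arc_height r s * arc_height r s) in *. split.
  - replace (r / 2) with (sqrt (Rsqr (r / 2))) by (apply sqrt_Rsqr; lra).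
    apply sqrt_le_1_alt. unfold Rsqr. nra.
  - replace r with (sqrt (Rsqr r)) by (apply sqrt_Rsqr; lra).
    apply sqrt_le_1_alt. unfold Rsqr. nra.
Qed.

Lemma arc_neq_0 (sg r s : R) : sg = 1 \/ sg = -1 -> 0 < r -> - r <= s <= r ->
  arc sg r s <> 0%C.
Proof.
  intros hsg hr hs. apply Cmod_gt_0. pose proof (Cmod_arc sg r s hsg hr hs). lra.
Qed.

Lemma is_derive_arc_height (r s : R) : 0 < r ->
  is_derive (arc_height r) s (- 2 * s / r).
Proof. intros hr. unfold arc_height. auto_derive; [easy|field; lra]. Qed.

Lemma is_Cderive_arc (sg r s : R) : 0 < r ->
  is_Cderive (arc sg r) s (arc_speed sg r s).
Proof.
  intros hr. split.
  - apply (is_derive_id (K := R_AbsRing)).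
  - unfold arc, arc_speed, arc_height; simpl. auto_derive; [easy|field; lra].
Qed.

Lemma Cmod_arc_speed (sg r s : R) : sg = 1 \/ sg = -1 -> 0 < r -> - r <= s <= r ->
  Cmod (arc_speed sg r s) <= 3.
Proof.
  intros hsg hr hs. eapply Rle_trans; [apply Cmod_le_abs|]. unfold arc_speed; simpl.
  rewrite Rabs_R1, Rabs_mult.
  replace (Rabs sg) with 1 by (destruct hsg as [->| ->]; split_Rabs; lra).
  assert (Rabs (- 2 * s / r) <= 2).
  { apply Rabs_le. split; [apply Rle_div_r; lra|apply Rle_div_l; lra]. }
  lra.
Qed.

Lemma is_Cderive_arc_log (sg r s : R) : sg = 1 \/ sg = -1 -> 0 < r -> - r <= s <= r ->
  is_Cderive (arc_log sg r) s (arc_speed sg r s * / arc sg r s)%C.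
Proof.
  intros hsg hr hs. destruct (arc_height_bounds r s hr hs) as (h0 & h1 & _).
  apply (is_Cderive_hlog sg (arc_height r) s); [easy|now apply is_derive_arc_height|easy|nra].
Qed.

(** [y^w exp (v y)] along the path. *)
Definition arc_exp (w v : C) (sg r s : R) : C :=
  Cexp (w * arc_log sg r s + v * arc sg r s)%C.

Lemma arc_exp_mult (w v w' v' : C) (sg r s : R) :
  (arc_exp w v sg r s * arc_exp w' v' sg r s)%C = arc_exp (w + w') (v + v') sg r s.
Proof. unfold arc_exp. rewrite <- Cexp_add. f_equal. ring. Qed.

Lemma is_Cderive_arc_exp (w v : C) (sg r s : R) : sg = 1 \/ sg = -1 -> 0 < r -> - r <= s <= r ->
  is_Cderive (arc_exp w v sg r) s
    (arc_speed sg r s * (w * / arc sg r s + v) * arc_exp w v sg r s)%C.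
Proof.
  intros hsg hr hs. eapply is_Cderive_eq.
  - apply is_Cderive_exp, is_Cderive_plus; apply is_Cderive_scal;
      [now apply is_Cderive_arc_log|now apply is_Cderive_arc].
  - unfold arc_exp. ring.
Qed.

Lemma arc_exp_inv (sg r s : R) (w : C) : sg = 1 \/ sg = -1 -> 0 < r -> - r <= s <= r ->
  w = (- (1))%C -> arc_exp w 0 sg r s = (/ arc sg r s)%C.
Proof.
  intros hsg hr hs ->. destruct (arc_height_bounds r s hr hs) as (h0 & h1 & _).
  unfold arc_exp. replace (- (1) * arc_log sg r s + 0 * arc sg r s)%C
    with (- arc_log sg r s)%C by ring.
  rewrite Cexp_opp. unfold arc_log. rewrite Cexp_hlog; [easy|easy|easy|nra].
Qed.

(** On the path [y^w] has modulus [r^(Re w)] up to a constant factor: the argument is at most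
    [PI < 4], and [ln |y|] differs from [ln r] by at most [ln 2 < 1]. *)
Lemma hlog_weight_bound (w : C) (sg X T r : R) : sg = 1 \/ sg = -1 -> 0 <= T -> 0 < r ->
  r / 2 <= sqrt (X * X + T * T) <= r ->
  Rabs (Re (w * hlog sg X T)%C - Re w * ln r) <= 5 * Cmod w.
Proof.
  intros hsg hT hr hR.
  assert (h0 : 0 < X * X + T * T).
  { apply Rnot_le_lt. intros h. rewrite sqrt_neg_0 in hR by easy. lra. }
  destruct (hlog_arg_cos_sin X T hT h0) as (hth & _ & _).
  unfold hlog, Re, Cmult. simpl. set (th := PI / 2 - _) in *. set (R := sqrt _) in *.
  replace (fst w * ln R - snd w * (sg * th) - fst w * ln r)
    with (fst w * (ln R - ln r) + - (snd w * (sg * th))) by ring.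
  eapply Rle_trans; [apply Rabs_triang|]. rewrite Rabs_Ropp, !Rabs_mult.
  replace (Rabs sg) with 1 by (destruct hsg as [->| ->]; split_Rabs; lra).
  assert (l1 : Rabs (ln R - ln r) <= 1).
  { assert (ln R <= ln r) by (apply ln_le; lra).
    assert (ln (r / 2) <= ln R) by (apply ln_le; lra).
    rewrite ln_div in H0 by lra.
    assert (ln 2 <= 1).
    { pose proof (exp_ineq1_le 1). rewrite <- (ln_exp 1). apply ln_le; lra. }
    split_Rabs; lra. }
  assert (l2 : Rabs th <= 4) by (pose proof PI_4; split_Rabs; lra).
  pose proof (re_le_Cmod w) as w1. pose proof (Im_le_Cmod w) as w2. unfold Re, Im in w1, w2.
  pose proof (Rabs_pos (fst w)); pose proof (Rabs_pos (snd w)).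
  pose proof (Rabs_pos (ln R - ln r)); pose proof (Rabs_pos th). pose proof (Cmod_ge_0 w).
  assert (Rabs (fst w) * Rabs (ln R - ln r) <= Cmod w * 1) by (apply Rmult_le_compat; lra).
  assert (Rabs (snd w) * (1 * Rabs th) <= Cmod w * 4) by (apply Rmult_le_compat; lra).
  lra.
Qed.

Lemma Cmod_arc_exp (w : C) (v sg r s : R) : sg = 1 \/ sg = -1 -> 0 < r -> - r <= s <= r ->
  Cmod (arc_exp w v sg r s) <= exp (5 * Cmod w) * exp (Re w * ln r + v * s).
Proof.
  intros hsg hr hs. unfold arc_exp. rewrite Cmod_Cexp, <- exp_plus. apply exp_le_compat.
  destruct (arc_height_bounds r s hr hs) as (h0 & h1 & _).
  assert (hm := Cmod_arc sg r s hsg hr hs).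
  assert (e : Cmod (arc sg r s) = sqrt (s * s + arc_height r s * arc_height r s)).
  { unfold arc. rewrite Cmod_pair. f_equal. destruct hsg as [->| ->]; ring. }
  rewrite e in hm.
  pose proof (hlog_weight_bound w sg s (arc_height r s) r hsg h0 hr hm) as hb.
  fold (arc_log sg r s) in hb.
  replace (Re (w * arc_log sg r s + v * arc sg r s)%C)
    with (Re (w * arc_log sg r s)%C + v * s) by (unfold Re, arc; simpl; ring).
  split_Rabs; lra.
Qed.

(** * The remainders along the path *)

(** Normalised remainders of [M(a,c;y)] (after multiplication by [y^a]) and of
    [M(a+1,c;y)] (after multiplication by [y^(c-a-1) exp (-y)]).  Here [alpha] stands for
    [Gamma c / Gamma (c-a)] and [beta] for [Gamma c / Gamma (a+1)].  The four truncation
    lengths are chosen so that the algebraic sums match exactly in the derivative of the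
    first remainder and the exponential sums in the derivative of the second. *)
Definition rem_a (a c alpha beta : C) (n : nat) (sg r s : R) : C :=
  (arc_exp a 0 sg r s * egf (kummer_coef a c) (arc sg r s)
   - alpha * Cexp (a * (0, sg * PI)%R)
       * bsum (fun k => ray_coef (c - a) c k * (/ - arc sg r s) ^ k) (S n)
   - a * beta * (arc_exp (2 * a - c) 1 sg r s
       * bsum (fun k => ray_coef a c k * (/ arc sg r s) ^ k) (S n)))%C.

Definition rem_a1 (a c alpha beta : C) (n : nat) (sg r s : R) : C :=
  (arc_exp (c - a - 1) (- (1)) sg r s * egf (kummer_coef (a + 1) c) (arc sg r s)
   + alpha * (c - a - 1) * Cexp (a * (0, sg * PI)%R)
       * (arc_exp (c - 2 * a - 2) (- (1)) sg r s
          * bsum (fun k => ray_coef (c - a - 1) c k * (/ - arc sg r s) ^ k) n)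
   - beta * bsum (fun k => ray_coef (a + 1) c k * (/ arc sg r s) ^ k) (S (S n)))%C.

Lemma is_Cderive_opp (F : R -> C) (t : R) (d : C) :
  is_Cderive F t d -> is_Cderive (fun u => - F u)%C t (- d)%C.
Proof. intros [h1 h2]. split; [exact (is_derive_Ropp _ _ _ h1)|exact (is_derive_Ropp _ _ _ h2)]. Qed.

Lemma Copp_neq_0 (z : C) : z <> 0%C -> (- z)%C <> 0%C.
Proof. intros h e. apply h. replace z with (- - z)%C by ring. rewrite e. ring. Qed.

(** The system satisfied by the two remainders; the product of the two couplings is
    [a (c-a-1) y^(-2)] times the square of the speed. *)
Lemma is_Cderive_rem_a (a c alpha beta : C) (n : nat) (sg r s : R) : not_nonpos_int c ->
  sg = 1 \/ sg = -1 -> 0 < r -> - r <= s <= r ->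
  is_Cderive (rem_a a c alpha beta n sg r) s
    (arc_speed sg r s * arc_exp (2 * a - c) 1 sg r s *
      (a * rem_a1 a c alpha beta n sg r s
       + a * beta * ray_coef a c (S n) * (/ arc sg r s) ^ (S n)))%C.
Proof.
  intros hc hsg hr hs. assert (h0 := arc_neq_0 sg r s hsg hr hs).
  assert (hy := is_Cderive_arc sg r s hr).
  eapply is_Cderive_eq.
  { apply is_Cderive_minus; [apply is_Cderive_minus|].
    - apply is_Cderive_mult; [apply is_Cderive_arc_exp; assumption|].
      apply is_Cderive_egf; [now apply geom_growth_kummer|exact hy].
    - apply is_Cderive_scal, (is_Cderive_inv_poly _ (fun s => - arc sg r s)%C);
        [now apply Copp_neq_0|apply is_Cderive_opp; exact hy].
    - apply is_Cderive_scal, is_Cderive_mult; [apply is_Cderive_arc_exp; assumption|].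
      apply (is_Cderive_inv_poly _ (arc sg r)); [exact h0|exact hy]. }
  assert (hM := kummer_contiguous_up a c (arc sg r s) hc).
  assert (hQ := ray_coef_sum_contiguous a c (/ arc sg r s) (S n)).
  assert (hE := ray_coef_euler (c - a) c (/ - arc sg r s) n).
  unfold rem_a1.
  assert (r1 : (arc_exp (2 * a - c) 1 sg r s * arc_exp (c - a - 1) (- (1)) sg r s)%C
    = (/ arc sg r s * arc_exp a 0 sg r s)%C).
  { rewrite <- (arc_exp_inv sg r s _ hsg hr hs eq_refl), !arc_exp_mult. f_equal; ring. }
  assert (r2 : (arc_exp (2 * a - c) 1 sg r s * arc_exp (c - 2 * a - 2) (- (1)) sg r s)%C
    = (/ arc sg r s * / arc sg r s)%C).
  { rewrite <- (arc_exp_inv sg r s _ hsg hr hs eq_refl), !arc_exp_mult. f_equal; ring. }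
  rewrite hE. replace (c - (c - a))%C with a by ring.
  set (S' := bsum (fun k => INR k * ray_coef a c k * (/ arc sg r s) ^ S k)%C (S n)) in *.
  set (S0 := bsum (fun k => ray_coef a c k * (/ arc sg r s) ^ k)%C (S n)) in *.
  set (W := bsum (fun k => ray_coef (a + 1) c k * (/ arc sg r s) ^ k)%C (S (S n))) in *.
  set (P := bsum (fun k => ray_coef (c - a - 1) c k * (/ - arc sg r s) ^ k)%C n) in *.
  set (M' := egf (fun n => kummer_coef a c (S n)) (arc sg r s)) in *.
  set (M := egf (kummer_coef a c) (arc sg r s)) in *.
  set (M1 := egf (kummer_coef (a + 1) c) (arc sg r s)) in *.
  set (E0 := arc_exp a 0 sg r s) in *. set (E1 := arc_exp (2 * a - c) 1 sg r s) in *.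
  set (F0 := arc_exp (c - a - 1) (- (1)) sg r s) in *.
  set (F1 := arc_exp (c - 2 * a - 2) (- (1)) sg r s) in *.
  set (om := Cexp (a * (0, (sg * PI)%R))) in *. set (sp := arc_speed sg r s) in *.
  set (y := arc sg r s) in *. set (ra := ray_coef a c (S n)) in *.
  replace M' with (/ y * (a * (M1 - M)))%C by (rewrite <- hM; field; easy).
  replace S' with ((1 + (2 * a - c) * / y) * S0 - (W - ra * (/ y) ^ S n))%C by (rewrite <- hQ; ring).
  transitivity (sp * (a * ((E1 * F0) * M1 + alpha * (c - a - 1) * om * ((E1 * F1) * P)
      - beta * E1 * W) + E1 * (a * beta * ra * (/ y) ^ S n)))%C.
  - rewrite r1, r2. replace (/ - y)%C with (- / y)%C by (field; easy). simpl Cpow. ring.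
  - ring.
Qed.

Lemma is_Cderive_rem_a1 (a c alpha beta : C) (n : nat) (sg r s : R) : not_nonpos_int c ->
  sg = 1 \/ sg = -1 -> 0 < r -> - r <= s <= r ->
  is_Cderive (rem_a1 a c alpha beta n sg r) s
    (arc_speed sg r s * arc_exp (c - 2 * a - 2) (- (1)) sg r s * (c - a - 1) *
      (rem_a a c alpha beta n sg r s
       + alpha * Cexp (a * (0, sg * PI)%R) * ray_coef (c - a - 1) c n * (/ - arc sg r s) ^ n))%C.
Proof.
  intros hc hsg hr hs. assert (h0 := arc_neq_0 sg r s hsg hr hs).
  assert (hy := is_Cderive_arc sg r s hr).
  eapply is_Cderive_eq.
  { apply is_Cderive_minus; [apply is_Cderive_plus|].
    - apply is_Cderive_mult; [apply is_Cderive_arc_exp; assumption|].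
      apply is_Cderive_egf; [now apply geom_growth_kummer|exact hy].
    - apply is_Cderive_scal, is_Cderive_mult; [apply is_Cderive_arc_exp; assumption|].
      apply (is_Cderive_inv_poly _ (fun s => - arc sg r s)%C);
        [now apply Copp_neq_0|apply is_Cderive_opp; exact hy].
    - apply is_Cderive_scal. apply (is_Cderive_inv_poly _ (arc sg r)); [exact h0|exact hy]. }
  assert (hM := kummer_contiguous_down (a + 1) c (arc sg r s) hc).
  assert (hQ := ray_coef_sum_contiguous (c - a - 1) c (/ - arc sg r s) n).
  assert (hE := ray_coef_euler (a + 1) c (/ arc sg r s) (S n)).
  replace (a + 1 - 1)%C with a in hM, hE by ring.
  replace (c - a - 1 + 1)%C with (c - a)%C in hQ by ring.
  unfold rem_a.
  assert (r1 : (arc_exp (c - 2 * a - 2) (- (1)) sg r s * arc_exp a 0 sg r s)%C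
    = (/ arc sg r s * arc_exp (c - a - 1) (- (1)) sg r s)%C).
  { rewrite <- (arc_exp_inv sg r s _ hsg hr hs eq_refl), !arc_exp_mult. f_equal; ring. }
  assert (r2 : (arc_exp (c - 2 * a - 2) (- (1)) sg r s * arc_exp (2 * a - c) 1 sg r s)%C
    = (/ arc sg r s * / arc sg r s)%C).
  { rewrite <- (arc_exp_inv sg r s _ hsg hr hs eq_refl), !arc_exp_mult. f_equal; ring. }
  rewrite hE.
  set (S' := bsum (fun k => INR k * ray_coef (c - a - 1) c k * (/ - arc sg r s) ^ S k)%C n) in *.
  set (S0 := bsum (fun k => ray_coef a c k * (/ arc sg r s) ^ k)%C (S n)) in *.
  set (W := bsum (fun k => ray_coef (c - a) c k * (/ - arc sg r s) ^ k)%C (S n)) in *.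
  set (P := bsum (fun k => ray_coef (c - a - 1) c k * (/ - arc sg r s) ^ k)%C n) in *.
  set (M' := egf (fun n => kummer_coef (a + 1) c (S n)) (arc sg r s)) in *.
  set (M := egf (kummer_coef a c) (arc sg r s)) in *.
  set (M1 := egf (kummer_coef (a + 1) c) (arc sg r s)) in *.
  set (E0 := arc_exp a 0 sg r s) in *. set (E1 := arc_exp (2 * a - c) 1 sg r s) in *.
  set (F0 := arc_exp (c - a - 1) (- (1)) sg r s) in *.
  set (F1 := arc_exp (c - 2 * a - 2) (- (1)) sg r s) in *.
  set (om := Cexp (a * (0, (sg * PI)%R))) in *. set (sp := arc_speed sg r s) in *.
  set (y := arc sg r s) in *. set (ra := ray_coef (c - a - 1) c n) in *.
  replace M' with (/ y * ((c - (a + 1)) * M + (a + 1 - c + y) * M1))%C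
    by (rewrite <- hM; field; easy).
  replace S' with ((1 + (2 * (c - a - 1) - c) * / - y) * P - (W - ra * (/ - y) ^ n))%C
    by (rewrite <- hQ; ring).
  transitivity (sp * (c - a - 1) * ((F1 * E0) * M - alpha * om * F1 * W
      - a * beta * ((F1 * E1) * S0) + F1 * (alpha * om * ra * (/ - y) ^ n)))%C.
  - rewrite r1, r2. replace (/ - y)%C with (- / y)%C by (field; easy).
    simpl Cpow. field. easy.
  - ring.
Qed.

Lemma arc_height_left (r : R) : 0 < r -> arc_height r (- r) = 0.
Proof. intros hr. unfold arc_height. field. lra. Qed.

Lemma arc_height_right (r : R) : 0 < r -> arc_height r r = 0.
Proof. intros hr. unfold arc_height. field. lra. Qed.

Lemma arc_left (sg r : R) : 0 < r -> arc sg r (- r) = (- r)%C.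
Proof.
  intros hr. unfold arc. rewrite arc_height_left, Rmult_0_r by easy. now rewrite <- RtoC_opp.
Qed.

Lemma arc_right (sg r : R) : 0 < r -> arc sg r r = RtoC r.
Proof. intros hr. unfold arc. now rewrite arc_height_right, Rmult_0_r by easy. Qed.

Lemma arc_log_left (sg r : R) : 0 < r -> arc_log sg r (- r) = (ln r + (0, sg * PI)%R)%C.
Proof.
  intros hr. unfold arc_log. rewrite arc_height_left by easy. unfold hlog.
  rewrite hlog_arg_acos by nra.
  replace (- r * - r + 0 * 0) with (Rsqr r) by (unfold Rsqr; ring).
  rewrite sqrt_Rsqr by lra. replace (- r / r) with (Ropp 1) by (field; lra).
  rewrite acos_opp, acos_1. unfold Cplus, RtoC; simpl. f_equal; ring.
Qed.

Lemma arc_log_right (sg r : R) : 0 < r -> arc_log sg r r = RtoC (ln r).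
Proof.
  intros hr. unfold arc_log. rewrite arc_height_right by easy. unfold hlog.
  rewrite hlog_arg_acos by nra.
  replace (r * r + 0 * 0) with (Rsqr r) by (unfold Rsqr; ring).
  rewrite sqrt_Rsqr by lra. replace (r / r) with 1 by (field; lra).
  rewrite acos_1. unfold RtoC. f_equal. ring.
Qed.

Lemma inv_pow_exp (r : R) (k : nat) : 0 < r -> (/ r) ^ k = exp (- INR k * ln r).
Proof.
  intros hr. induction k as [|k IH].
  - simpl. rewrite <- exp_0. f_equal. ring.
  - rewrite S_INR. simpl pow. rewrite IH.
    replace (- (INR k + 1) * ln r) with (- ln r + - INR k * ln r) by ring.
    rewrite exp_plus, exp_Ropp, exp_ln by easy. ring.
Qed.

Lemma Cmod_inv_R (r : R) : 0 < r -> Cmod (/ r)%C = / r.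
Proof. intros hr. now rewrite Cmod_inv, Cmod_R, Rabs_pos_eq by (try apply RtoC_neq_0; lra). Qed.

Lemma Cmod_inv_R_le_1 (r : R) : 1 <= r -> Cmod (/ r)%C <= 1.
Proof.
  intros hr. rewrite Cmod_inv_R by lra. rewrite <- Rinv_1. apply Rinv_le_contravar; lra.
Qed.

(** Each of the two scales is negligible at the end of the path where it is small. *)
Lemma arc_end_negligible (k w : C) (v sg : R) (f : nat -> C) (m N : nat) : sg = 1 \/ sg = -1 ->
  exists r0, 1 <= r0 /\ forall r s u, r0 <= r -> - r <= s <= r -> v * s = - r -> Cmod u <= 1 ->
    Cmod (k * (arc_exp w v sg r s * bsum (fun j => f j * u ^ j) m))%C <= (/ r) ^ N.
Proof.
  intros hsg. destruct (bsum_pow_bounded f m) as (B & hB & hb).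
  set (K := Cmod k * (exp (5 * Cmod w) * B)).
  assert (hK : 0 <= K).
  { unfold K. apply Rmult_le_pos; [apply Cmod_ge_0|].
    apply Rmult_le_pos; [left; apply exp_pos|easy]. }
  destruct (exp_neg_beats_power (Re w + INR N) K 1 hK Rlt_0_1) as (r0 & hr0 & h).
  exists r0. split; [easy|]. intros r s u hr hs hv hu. specialize (h r hr).
  assert (hE := Cmod_arc_exp w v sg r s hsg ltac:(lra) hs).
  rewrite inv_pow_exp by lra. rewrite !Cmod_mult.
  apply Rle_trans with (K * exp ((Re w + INR N) * ln r - r) * exp (- INR N * ln r)).
  - unfold K. rewrite !Rmult_assoc. apply Rmult_le_compat_l; [apply Cmod_ge_0|].
    rewrite <- exp_plus.
    replace ((Re w + INR N) * ln r - r + - INR N * ln r) with (Re w * ln r + v * s)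
      by (rewrite hv; ring).
    rewrite (Rmult_comm B), <- Rmult_assoc.
    apply Rmult_le_compat; [apply Cmod_ge_0|apply Cmod_ge_0|exact hE|now apply hb].
  - rewrite <- (Rmult_1_l (exp (- INR N * ln r))) at 2.
    apply Rmult_le_compat_r; [left; apply exp_pos|exact h].
Qed.

Lemma rem_a_left (a c alpha beta : C) (n : nat) (sg : R) : not_nonpos_int c ->
  sg = 1 \/ sg = -1 -> kummer_limit (c - a) c alpha ->
  exists K r0, 0 <= K /\ 1 <= r0 /\ forall r, r0 <= r ->
    Cmod (rem_a a c alpha beta n sg r (- r)) <= K * (/ r) ^ (S n).
Proof.
  intros hc hsg hlim.
  destruct (kummer_ray_expansion c (S n) hc _ _ hlim) as (K1 & r1 & hK1 & hr1 & h1).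
  destruct (arc_end_negligible (a * beta)%C (2 * a - c)%C 1 sg (ray_coef a c) (S n) (S n) hsg)
    as (r2 & hr2 & h2).
  set (om := Cexp (a * (0, sg * PI)%R)).
  exists (Cmod om * K1 + 1), (Rmax r1 r2).
  split; [pose proof (Cmod_ge_0 om); nra|]. split; [max_lra|]. intros r hr.
  specialize (h1 r ltac:(max_lra)). assert (hr2' : r2 <= r) by max_lra.
  assert (r0C : RtoC r <> 0%C) by (apply RtoC_neq_0; lra).
  specialize (h2 r (- r) (/ - r)%C hr2' ltac:(lra) ltac:(ring)).
  unfold rem_a. fold om. rewrite arc_left by lra.
  replace (- - RtoC r)%C with (RtoC r) by ring.
  replace (arc_exp a 0 sg r (- r)) with (rpow r a * om)%C.
  2:{ unfold arc_exp, rpow, om. rewrite arc_log_left, <- Cexp_add by lra. f_equal. ring. }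
  rewrite kummer_scaled_reflect in h1 by easy.
  set (S1 := bsum (fun k => ray_coef (c - a) c k * (/ r) ^ k)%C (S n)) in *.
  set (T := (a * beta * (arc_exp (2 * a - c) 1 sg r (- r) *
    bsum (fun k => ray_coef a c k * (/ - r) ^ k) (S n)))%C) in *.
  set (M := egf (kummer_coef a c) (- r)) in *.
  replace (rpow r a * om * M - alpha * om * S1 - T)%C
    with (om * (rpow r a * M - alpha * S1) - T)%C by ring.
  eapply Rle_trans; [apply Cmod_sub_le|].
  rewrite (Cmod_mult om), Rmult_plus_distr_r, Rmult_1_l, Rmult_assoc. apply Rplus_le_compat.
  - apply Rmult_le_compat_l; [apply Cmod_ge_0|exact h1].
  - apply h2. replace (/ - RtoC r)%C with (- / r)%C by (field; easy).
    rewrite Cmod_opp. apply Cmod_inv_R_le_1. lra.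
Qed.

Lemma rem_a1_right (a c alpha beta : C) (n : nat) (sg : R) : not_nonpos_int c ->
  sg = 1 \/ sg = -1 -> kummer_limit (a + 1) c beta ->
  exists K r0, 0 <= K /\ 1 <= r0 /\ forall r, r0 <= r ->
    Cmod (rem_a1 a c alpha beta n sg r r) <= K * (/ r) ^ (S n).
Proof.
  intros hc hsg hlim.
  destruct (kummer_ray_expansion c (S (S n)) hc _ _ hlim) as (K1 & r1 & hK1 & hr1 & h1).
  set (om := Cexp (a * (0, sg * PI)%R)).
  destruct (arc_end_negligible (alpha * (c - a - 1) * om)%C (c - 2 * a - 2)%C (- (1)) sg
    (ray_coef (c - a - 1) c) n (S n) hsg) as (r2 & hr2 & h2).
  exists (K1 + 1), (Rmax r1 r2). split; [lra|]. split; [max_lra|]. intros r hr.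
  specialize (h1 r ltac:(max_lra)). assert (hr2' : r2 <= r) by max_lra.
  assert (r0C : RtoC r <> 0%C) by (apply RtoC_neq_0; lra).
  specialize (h2 r r (/ - r)%C hr2' ltac:(lra) ltac:(ring)). rewrite RtoC_opp in h2.
  unfold rem_a1. fold om. rewrite arc_right by lra.
  replace (arc_exp (c - a - 1) (- (1)) sg r r) with (rpow r (- (a + 1 - c)) * exp (- r))%C.
  2:{ unfold arc_exp, rpow. rewrite arc_log_right, arc_right, <- Cexp_RtoC, <- Cexp_add by lra.
      f_equal. rewrite RtoC_opp. ring. }
  fold (kummer_scaled (a + 1) c r).
  set (S1 := bsum (fun k => ray_coef (a + 1) c k * (/ r) ^ k)%C (S (S n))) in *.
  set (T := (alpha * (c - a - 1) * om * (arc_exp (c - 2 * a - 2) (- (1)) sg r r *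
    bsum (fun k => ray_coef (c - a - 1) c k * (/ - r) ^ k) n))%C) in *.
  replace (kummer_scaled (a + 1) c r + T - beta * S1)%C
    with ((kummer_scaled (a + 1) c r - beta * S1) + T)%C by ring.
  eapply Rle_trans; [apply Cmod_triangle|].
  rewrite Rmult_plus_distr_r, Rmult_1_l. apply Rplus_le_compat.
  - eapply Rle_trans; [exact h1|]. apply Rmult_le_compat_l; [easy|].
    assert (hi : 0 < / r <= 1).
    { split; [apply Rinv_0_lt_compat; lra|]. rewrite <- Rinv_1. apply Rinv_le_contravar; lra. }
    assert (0 < (/ r) ^ S n) by now apply pow_lt.
    change ((/ r) ^ S (S n)) with (/ r * (/ r) ^ S n). nra.
  - apply h2. replace (/ - RtoC r)%C with (- / r)%C by (field; easy).
    rewrite Cmod_opp. apply Cmod_inv_R_le_1. lra.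
Qed.

(** The two remainders solve a problem of the kind treated in [two_point_bound], with
    [eps = r^(-n-1)] and weight [|y^(2a-c) exp y|]. *)
Lemma rem_a_bound (a c alpha beta : C) (n : nat) (sg : R) : not_nonpos_int c ->
  sg = 1 \/ sg = -1 -> kummer_limit (c - a) c alpha -> kummer_limit (a + 1) c beta ->
  exists K r0, 0 <= K /\ 1 <= r0 /\ forall r s, r0 <= r -> - r <= s <= r ->
    Cmod (rem_a a c alpha beta n sg r s)
    <= K * (/ r) ^ (S n) * (1 + exp (Re (2 * a - c)%C * ln r + s)).
Proof.
  intros hc hsg hla hlb.
  destruct (rem_a_left a c alpha beta n sg hc hsg hla) as (q3 & r1 & hq3 & hr1 & h1).
  destruct (rem_a1_right a c alpha beta n sg hc hsg hlb) as (q4 & r2 & hq4 & hr2 & h2).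
  set (om := Cexp (a * (0, sg * PI)%R)).
  set (m1 := Cmod (a * beta * ray_coef a c (S n))%C).
  set (m2 := Cmod (alpha * om * ray_coef (c - a - 1) c n)%C).
  set (x1 := exp (5 * Cmod (2 * a - c)%C)). set (x2 := exp (5 * Cmod (c - 2 * a - 2)%C)).
  assert (hx1 : 0 < x1) by apply exp_pos. assert (hx2 : 0 < x2) by apply exp_pos.
  assert (hm1 : 0 <= m1) by apply Cmod_ge_0. assert (hm2 : 0 <= m2) by apply Cmod_ge_0.
  assert (p1 : 0 < 2 ^ S n) by (apply pow_lt; lra). assert (p2 : 0 < 2 ^ n) by (apply pow_lt; lra).
  set (q1 := 3 * x1 * (Cmod a + m1 * 2 ^ S n)).
  set (q2 := 3 * x2 * Cmod (c - a - 1)%C * (1 + m2 * 2 ^ n)).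
  pose proof (Cmod_ge_0 a) as ha0. pose proof (Cmod_ge_0 (c - a - 1)%C) as hc0.
  assert (hq1 : 0 <= q1).
  { unfold q1. repeat apply Rmult_le_pos; try lra.
    apply Rplus_le_le_0_compat; [easy|]. apply Rmult_le_pos; lra. }
  assert (hq2 : 0 <= q2).
  { unfold q2. repeat apply Rmult_le_pos; try lra.
    apply Rplus_le_le_0_compat; [lra|]. apply Rmult_le_pos; lra. }
  set (Q := q1 + q2 + q3 + q4). assert (hQ : 0 <= Q) by (unfold Q; lra).
  destruct (two_point_bound Q hQ) as (K & hK & H).
  exists K, (Rmax (Rmax r1 r2) (8 * (Q * Q))). split; [easy|].
  split; [max_lra|].
  intros r s hr hs.
  assert (hrr1 : r1 <= r) by max_lra.
  assert (hrr2 : r2 <= r) by max_lra.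
  assert (hrr3 : 8 * (Q * Q) <= r) by max_lra.
  assert (r0 : 0 < r) by lra. assert (hi : 0 < / r) by now apply Rinv_0_lt_compat.
  set (eps := (/ r) ^ S n). assert (heps : 0 < eps) by now apply pow_lt.
  specialize (h1 r hrr1). specialize (h2 r hrr2). fold eps in h1, h2.
  set (G := exp (Re (2 * a - c)%C * ln r)).
  assert (hG : 0 < G) by apply exp_pos.
  assert (hu : forall t, - r <= t <= r -> forall k, Cmod (/ arc sg r t)%C ^ k <= 2 ^ k * (/ r) ^ k).
  { intros t ht k. destruct (Cmod_arc sg r t hsg r0 ht) as [hl _].
    rewrite Cmod_inv by now apply arc_neq_0.
    rewrite <- Rpow_mult_distr. apply pow_incr. split.
    - left. apply Rinv_0_lt_compat. lra.
    - replace (2 * / r) with (/ (r / 2)) by (field; lra). apply Rinv_le_contravar; lra. }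
  assert (hreps : r * eps = (/ r) ^ n) by (unfold eps; simpl; field; lra).
  rewrite exp_plus. fold G.
  apply (H r G eps (rem_a a c alpha beta n sg r) (rem_a1 a c alpha beta n sg r)
    (fun s => arc_speed sg r s * arc_exp (2 * a - c) 1 sg r s *
      (a * rem_a1 a c alpha beta n sg r s
       + a * beta * ray_coef a c (S n) * (/ arc sg r s) ^ (S n)))%C
    (fun s => arc_speed sg r s * arc_exp (c - 2 * a - 2) (- (1)) sg r s * (c - a - 1) *
      (rem_a a c alpha beta n sg r s
       + alpha * om * ray_coef (c - a - 1) c n * (/ - arc sg r s) ^ n))%C);
    try assumption; try lra.
  - intros t ht. now apply is_Cderive_rem_a.
  - intros t ht. now apply is_Cderive_rem_a1.
  - intros t ht. set (R1 := rem_a1 a c alpha beta n sg r t).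
    rewrite !(Cmod_mult (arc_speed sg r t * arc_exp (2 * a - c) 1 sg r t)), (Cmod_mult (arc_speed sg r t)).
    assert (b1 := Cmod_arc_speed sg r t hsg r0 ht).
    assert (b2 := Cmod_arc_exp (2 * a - c) 1 sg r t hsg r0 ht).
    rewrite Rmult_1_l, exp_plus in b2. fold x1 G in b2.
    assert (b3 : Cmod (a * R1 + a * beta * ray_coef a c (S n) * (/ arc sg r t) ^ (S n))%C
      <= (Cmod a + m1 * 2 ^ S n) * (Cmod R1 + eps)).
    { eapply Rle_trans; [apply Cmod_triangle|].
      rewrite (Cmod_mult a R1), (Cmod_mult (a * beta * ray_coef a c (S n))), Cmod_pow. fold m1.
      specialize (hu t ht (S n)). fold eps in hu. pose proof (Cmod_ge_0 R1).
      assert (m1 * Cmod (/ arc sg r t)%C ^ S n <= m1 * (2 ^ S n * eps))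
        by now apply Rmult_le_compat_l.
      assert (0 <= Cmod a * eps) by (apply Rmult_le_pos; lra).
      assert (0 <= m1 * 2 ^ S n * Cmod R1) by (apply Rmult_le_pos; [apply Rmult_le_pos; lra|lra]). lra. }
    pose proof (Cmod_ge_0 (arc_speed sg r t)). pose proof (Cmod_ge_0 (arc_exp (2 * a - c) 1 sg r t)).
    pose proof (Cmod_ge_0 (a * R1 + a * beta * ray_coef a c (S n) * (/ arc sg r t) ^ (S n))%C).
    pose proof (exp_pos t) as het. pose proof (Cmod_ge_0 R1).
    assert (hGe : 0 < G * exp t) by now apply Rmult_lt_0_compat.
    apply Rle_trans with (3 * (x1 * (G * exp t)) * ((Cmod a + m1 * 2 ^ S n) * (Cmod R1 + eps))).
    + apply Rmult_le_compat; [now apply Rmult_le_pos|easy| |easy].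
      apply Rmult_le_compat; easy.
    + replace (3 * (x1 * (G * exp t)) * ((Cmod a + m1 * 2 ^ S n) * (Cmod R1 + eps)))
        with (q1 * (G * exp t) * (Cmod R1 + eps)) by (unfold q1; ring).
      apply Rmult_le_compat_r; [lra|]. apply Rmult_le_compat_r; [lra|]. unfold Q; lra.
  - intros t ht. set (R1 := rem_a a c alpha beta n sg r t). set (w := (c - 2 * a - 2)%C) in *.
    rewrite !(Cmod_mult (arc_speed sg r t * arc_exp w (- (1)) sg r t * (c - a - 1))),
      (Cmod_mult (arc_speed sg r t * arc_exp w (- (1)) sg r t)), (Cmod_mult (arc_speed sg r t)).
    assert (b1 := Cmod_arc_speed sg r t hsg r0 ht).
    assert (b2 := Cmod_arc_exp w (- (1)) sg r t hsg r0 ht).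
    replace (RtoC (- (1))) with (- (1))%C in b2 by (now rewrite RtoC_opp). fold x2 in b2.
    pose proof (exp_pos t) as het.
    assert (hGe : 0 < G * exp t) by now apply Rmult_lt_0_compat.
    replace (exp (Re w * ln r + - (1) * t)) with (/ (r * r) * / (G * exp t)) in b2.
    2:{ unfold G. rewrite <- exp_plus, <- exp_Ropp.
        replace (/ (r * r)) with (exp (- 2 * ln r)).
        - rewrite <- exp_plus. f_equal. unfold w, Re. simpl. ring.
        - replace (- 2 * ln r) with (- INR 2 * ln r) by (simpl; ring).
          rewrite <- inv_pow_exp by easy. simpl. field. lra. }
    assert (b3 : Cmod (R1 + alpha * om * ray_coef (c - a - 1) c n * (/ - arc sg r t) ^ n)%C
      <= (1 + m2 * 2 ^ n) * (Cmod R1 + r * eps)).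
    { eapply Rle_trans; [apply Cmod_triangle|].
      rewrite (Cmod_mult (alpha * om * ray_coef (c - a - 1) c n)), Cmod_pow. fold m2.
      replace (/ - arc sg r t)%C with (- / arc sg r t)%C by (field; now apply arc_neq_0).
      rewrite Cmod_opp. specialize (hu t ht n). rewrite <- hreps in hu. pose proof (Cmod_ge_0 R1).
      assert (m2 * Cmod (/ arc sg r t)%C ^ n <= m2 * (2 ^ n * (r * eps)))
        by now apply Rmult_le_compat_l.
      assert (0 <= r * eps) by (apply Rmult_le_pos; lra).
      assert (0 <= m2 * 2 ^ n * Cmod R1) by (apply Rmult_le_pos; [apply Rmult_le_pos; lra|lra]). lra. }
    assert (hre : 0 <= r * eps) by (apply Rmult_le_pos; lra).
    pose proof (Cmod_ge_0 (arc_speed sg r t)). pose proof (Cmod_ge_0 (arc_exp w (- (1)) sg r t)).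
    pose proof (Cmod_ge_0 (R1 + alpha * om * ray_coef (c - a - 1) c n * (/ - arc sg r t) ^ n)%C).
    pose proof (Cmod_ge_0 R1).
    assert (hV : 0 <= / (r * r) * / (G * exp t)).
    { apply Rmult_le_pos; left; apply Rinv_0_lt_compat; [nra|easy]. }
    apply Rle_trans with (3 * (x2 * (/ (r * r) * / (G * exp t))) * Cmod (c - a - 1)%C *
      ((1 + m2 * 2 ^ n) * (Cmod R1 + r * eps))).
    + apply Rmult_le_compat; [|easy| |easy].
      * apply Rmult_le_pos; [now apply Rmult_le_pos|easy].
      * apply Rmult_le_compat_r; [easy|]. apply Rmult_le_compat; easy.
    + replace (3 * (x2 * (/ (r * r) * / (G * exp t))) * Cmod (c - a - 1)%C *
        ((1 + m2 * 2 ^ n) * (Cmod R1 + r * eps)))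
        with (q2 * (/ (r * r) * / (G * exp t)) * (Cmod R1 + r * eps)) by (unfold q2; ring).
      rewrite (Rmult_assoc Q). apply Rmult_le_compat_r; [lra|].
      apply Rmult_le_compat_r; [easy|]. unfold Q; lra.
  - eapply Rle_trans; [exact h1|]. apply Rmult_le_compat_r; [lra|]. unfold Q; lra.
  - eapply Rle_trans; [exact h2|]. apply Rmult_le_compat_r; [lra|]. unfold Q; lra.
Qed.

(** * The compound expansion of Kummer's function *)

(** The radius is the positive root of [r^2 - T r - X^2 = 0]. *)
Lemma arc_through (X T : R) : 0 <= T -> (T = 0 -> X <> 0) ->
  exists r, 0 < r /\ - r <= X <= r /\ arc_height r X = T.
Proof.
  intros hT h0. set (D := sqrt (T * T + 4 * (X * X))).
  assert (hD : D * D = T * T + 4 * (X * X)) by (apply sqrt_sqrt; nra).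
  assert (hD0 : 0 <= D) by apply sqrt_pos.
  exists ((T + D) / 2).
  assert (hr : 0 < (T + D) / 2).
  { destruct (Req_dec T 0) as [e|e]; [|lra]. specialize (h0 e).
    assert (0 < D); [|lra]. apply sqrt_lt_R0. subst T. 
    assert (0 < X * X) by (apply Rsqr_pos_lt in h0; exact h0). lra. }
  assert (hX : Rabs X <= (T + D) / 2).
  { apply Rsqr_incr_0_var; [|lra]. rewrite <- Rsqr_abs. unfold Rsqr. nra. }
  split; [exact hr|]. split; [split_Rabs; lra|].
  unfold arc_height. apply Rmult_eq_reg_r with ((T + D) / 2); [|lra].
  field_simplify; [|lra]. nra.
Qed.

Definition kummer_weight (a c y : C) : R :=
  exp (- Re a * ln (Cmod y)) + exp (Re (a - c)%C * ln (Cmod y) + Re y).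

Lemma exp_ln_compare (w r m : R) : 0 < m -> m <= r -> r / 2 <= m ->
  exp (w * ln r) <= exp (Rabs w) * exp (w * ln m).
Proof.
  intros hm h1 h2. rewrite <- exp_plus. apply exp_le_compat.
  assert (l1 : ln m <= ln r) by (apply ln_le; lra).
  assert (l2 : ln (r / 2) <= ln m) by (apply ln_le; lra).
  rewrite ln_div in l2 by lra.
  assert (l3 : ln 2 <= 1).
  { pose proof (exp_ineq1_le 1). rewrite <- (ln_exp 1). apply ln_le; lra. }
  assert (hw : w * (ln r - ln m) <= Rabs w * (ln r - ln m))
    by (apply Rmult_le_compat_r; [lra|apply Rle_abs]).
  assert (Rabs w * (ln r - ln m) <= Rabs w * 1)
    by (apply Rmult_le_compat_l; [apply Rabs_pos|lra]).
  lra.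
Qed.

(** Dividing [rem_a_bound] by [y^a] turns the weight [1 + |y^(2a-c) exp y|] into the sum of
    the two scales. *)
Lemma kummer_half_plane (a c : C) (n : nat) (sg : R) : not_nonpos_int a -> not_nonpos_int c ->
  not_nonpos_int (c - a)%C -> sg = 1 \/ sg = -1 ->
  exists K R0, 0 <= K /\ 1 <= R0 /\ forall X T, 0 <= T -> (T = 0 -> X < 0 /\ sg = 1) ->
    forall y : C, y = (X, sg * T) -> Clog y = hlog sg X T -> R0 <= Cmod y ->
    Cmod (egf (kummer_coef a c) y
      - (Gamma c / Gamma (c - a) * Cpower (- y) (- a)
           * bsum (fun k => ray_coef (c - a) c k * (/ - y) ^ k) (S n)
         + Gamma c / Gamma a * (Cpower y (a - c) * Cexp y)
           * bsum (fun k => ray_coef a c k * (/ y) ^ k) (S n)))%C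
    <= K * (/ Cmod y) ^ S n * kummer_weight a c y.
Proof.
  intros ha hc hca hsg.
  assert (ha1 := not_nonpos_int_succ a ha).
  assert (ha0 : a <> 0%C) by (rewrite <- (Cplus_0_r a); apply (not_nonpos_int_add a 0 ha)).
  destruct (rem_a_bound a c _ _ n sg hc hsg (kummer_limit_Gamma _ _ hca hc)
    (kummer_limit_Gamma _ _ ha1 hc)) as (K & r0 & hK & hr0 & H).
  set (alpha := (Gamma c / Gamma (c - a))%C) in *. set (beta := (Gamma c / Gamma (a + 1))%C) in *.
  assert (hbeta : (a * beta)%C = (Gamma c / Gamma a)%C).
  { unfold beta. rewrite Gamma_succ by easy. field. split; [now apply Gamma_neq_0|easy]. }
  set (K1 := exp (Rabs (- Re a))). set (K2 := exp (Rabs (Re (a - c)%C))).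
  assert (hK1 : 0 < K1) by apply exp_pos. assert (hK2 : 0 < K2) by apply exp_pos.
  set (K3 := exp (5 * Cmod (- a)%C)). assert (hK3 : 0 < K3) by apply exp_pos.
  exists (K3 * K * (K1 + K2)), r0. split; [repeat apply Rmult_le_pos; lra|]. split; [easy|].
  intros X T hT h0 y hy hl hm.
  destruct (arc_through X T hT) as (r & hr & hX & hh).
  { intros e. destruct (h0 e). lra. }
  assert (ey : arc sg r X = y) by (unfold arc; now rewrite hh).
  assert (el : arc_log sg r X = Clog y) by (unfold arc_log; now rewrite hh).
  destruct (Cmod_arc sg r X hsg hr hX) as [m1 m2]. rewrite ey in m1, m2.
  specialize (H r X ltac:(lra) hX).
  assert (hy0 : y <> 0%C) by (rewrite <- ey; now apply arc_neq_0).
  set (om := Cexp (a * (0, sg * PI)%R)).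
  assert (e1 : Cpower (- y) (- a) = (om * arc_exp (- a) 0 sg r X)%C).
  { unfold Cpower, arc_exp, om. rewrite hy at 1. rewrite (Clog_opp sg X T hsg hT h0).
    rewrite el, hl, <- Cexp_add. f_equal. unfold Cminus. ring. }
  assert (e2 : (Cpower y (a - c) * Cexp y)%C = arc_exp (a - c) 1 sg r X).
  { unfold Cpower, arc_exp. rewrite el, ey, <- Cexp_add. f_equal. ring. }
  assert (e3 : (arc_exp (- a) 0 sg r X * arc_exp a 0 sg r X)%C = 1%C).
  { rewrite arc_exp_mult. unfold arc_exp. rewrite <- Cexp_0. f_equal. ring. }
  assert (e4 : (arc_exp (- a) 0 sg r X * arc_exp (2 * a - c) 1 sg r X)%C = arc_exp (a - c) 1 sg r X).
  { rewrite arc_exp_mult. f_equal; ring. }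
  rewrite e1, e2, <- hbeta, <- e4.
  unfold rem_a in H. rewrite ey in H. fold om in H.
  set (S1 := bsum (fun k => ray_coef (c - a) c k * (/ - y) ^ k)%C (S n)) in *.
  set (S2 := bsum (fun k => ray_coef a c k * (/ y) ^ k)%C (S n)) in *.
  set (M := egf (kummer_coef a c) y) in *.
  set (E0 := arc_exp a 0 sg r X) in *. set (E1 := arc_exp (2 * a - c) 1 sg r X) in *.
  assert (hE := Cmod_arc_exp (- a) 0 sg r X hsg hr hX).
  set (Em := arc_exp (- a) 0 sg r X) in *.
  replace (M - (alpha * (om * Em) * S1 + a * beta * (Em * E1) * S2))%C
    with (Em * (E0 * M - alpha * om * S1 - a * beta * (E1 * S2)))%C.
  2:{ transitivity ((Em * E0) * M - (alpha * (om * Em) * S1 + a * beta * (Em * E1) * S2))%C;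
      [ring|rewrite e3; ring]. }
  rewrite Cmod_mult.
  eapply Rle_trans; [apply Rmult_le_compat; [apply Cmod_ge_0|apply Cmod_ge_0|exact hE|exact H]|].
  fold K3. replace (Re (- a)%C) with (- Re a) by reflexivity.
  rewrite Rmult_0_l, Rplus_0_r.
  replace (K3 * exp (- Re a * ln r) * (K * (/ r) ^ S n * (1 + exp (Re (2 * a - c)%C * ln r + X))))
    with (K3 * K * (/ r) ^ S n * (exp (- Re a * ln r) + exp (Re (a - c)%C * ln r) * exp X)).
  2:{ replace (Re (2 * a - c)%C * ln r + X) with (Re a * ln r + (Re (a - c)%C * ln r + X))
        by (unfold Re; simpl; ring).
      rewrite exp_plus, exp_plus. replace (- Re a * ln r) with (- (Re a * ln r)) by ring.
      rewrite exp_Ropp. field. apply Rgt_not_eq, exp_pos. }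
  assert (hwt : exp (- Re a * ln r) + exp (Re (a - c)%C * ln r) * exp X
    <= (K1 + K2) * kummer_weight a c y).
  { unfold kummer_weight. rewrite exp_plus. replace (Re y) with X by (rewrite hy; reflexivity).
    assert (b1 := exp_ln_compare (- Re a) r (Cmod y) ltac:(lra) m2 m1).
    assert (b2 := exp_ln_compare (Re (a - c)%C) r (Cmod y) ltac:(lra) m2 m1).
    fold K1 in b1. fold K2 in b2.
    pose proof (exp_pos X). pose proof (exp_pos (- Re a * ln (Cmod y))).
    pose proof (exp_pos (Re (a - c)%C * ln (Cmod y))).
    apply (Rmult_le_compat_r (exp X)) in b2; [|lra].
    assert (0 < K1 * (exp (Re (a - c)%C * ln (Cmod y)) * exp X))
      by (repeat apply Rmult_lt_0_compat; easy).
    assert (0 < K2 * exp (- Re a * ln (Cmod y))) by (repeat apply Rmult_lt_0_compat; easy).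
    lra. }
  assert (hpw : (/ r) ^ S n <= (/ Cmod y) ^ S n).
  { apply pow_incr. split; [left; now apply Rinv_0_lt_compat|]. apply Rinv_le_contravar; lra. }
  assert (hp0 : 0 <= (/ r) ^ S n) by (apply pow_le; left; now apply Rinv_0_lt_compat).
  assert (hw0 : 0 <= kummer_weight a c y).
  { unfold kummer_weight. apply Rplus_le_le_0_compat; left; apply exp_pos. }
  apply Rle_trans with (K3 * K * (/ Cmod y) ^ S n * ((K1 + K2) * kummer_weight a c y)).
  - apply Rmult_le_compat; [| | |exact hwt].
    3:{ apply Rmult_le_compat_l; [apply Rmult_le_pos; lra|exact hpw]. }
    + apply Rmult_le_pos; [apply Rmult_le_pos; lra|exact hp0].
    + apply Rplus_le_le_0_compat; [|apply Rmult_le_pos]; left; apply exp_pos.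
  - right. ring.
Qed.

(** The expansion of Kummer's function from the two half planes, the negative axis being
    covered by the upper one. *)
Lemma kummer_plane_expansion (a c : C) (n : nat) : not_nonpos_int a -> not_nonpos_int c ->
  not_nonpos_int (c - a)%C ->
  exists K R0, 0 <= K /\ 1 <= R0 /\ forall y, slit_plane (- y) -> R0 <= Cmod y ->
    Cmod (egf (kummer_coef a c) y
      - (Gamma c / Gamma (c - a) * Cpower (- y) (- a)
           * bsum (fun k => ray_coef (c - a) c k * (/ - y) ^ k) (S n)
         + Gamma c / Gamma a * (Cpower y (a - c) * Cexp y)
           * bsum (fun k => ray_coef a c k * (/ y) ^ k) (S n)))%C
    <= K * (/ Cmod y) ^ S n * kummer_weight a c y.
Proof.
  intros ha hc hca.
  destruct (kummer_half_plane a c n 1 ha hc hca (or_introl eq_refl)) as (K1 & R1 & hK1 & hR1 & H1).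
  destruct (kummer_half_plane a c n (-1) ha hc hca (or_intror eq_refl)) as (K2 & R2 & hK2 & hR2 & H2).
  exists (K1 + K2), (Rmax R1 R2). split; [lra|]. split; [max_lra|].
  intros y hs hm.
  assert (hm1 : R1 <= Cmod y) by max_lra.
  assert (hm2 : R2 <= Cmod y) by max_lra.
  assert (hP : 0 <= (/ Cmod y) ^ S n * kummer_weight a c y).
  { apply Rmult_le_pos; [apply pow_le; left; apply Rinv_0_lt_compat; lra|].
    unfold kummer_weight. apply Rplus_le_le_0_compat; left; apply exp_pos. }
  destruct y as [X Y]. destruct (Rle_lt_dec 0 Y) as [hY|hY].
  - assert (h0 : Y = 0 -> X < 0 /\ 1 = 1).
    { intros ->. split; [|easy]. destruct hs as [hne harg].
      apply Rnot_le_lt. intros hX.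
      assert (hX0 : X <> 0).
      { intros ->. apply hne. unfold Copp, RtoC; simpl. f_equal; ring. }
      unfold Arg in harg. rewrite Cmod_opp, Cmod_pair in harg. simpl in harg.
      replace (X * X + 0 * 0) with (Rsqr X) in harg by (unfold Rsqr; ring).
      rewrite sqrt_Rsqr in harg by easy.
      replace (- X / X) with (Ropp 1) in harg by (field; easy).
      rewrite acos_opp, acos_1 in harg. destruct (Rle_dec 0 (- 0)); split_Rabs; lra. }
    assert (hR : 0 < X * X + Y * Y).
    { destruct (Req_dec Y 0) as [e|e]; [destruct (h0 e); nra|nra]. }
    eapply Rle_trans; [apply (H1 X Y hY h0)|].
    + now rewrite Rmult_1_l.
    + now apply Clog_upper.
    + exact hm1.
    + rewrite !Rmult_assoc. apply Rmult_le_compat_r; [exact hP|lra].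
  - eapply Rle_trans; [apply (H2 X (- Y) ltac:(lra) ltac:(intros; lra))|].
    + f_equal. ring.
    + replace (X, Y) with (X, - - Y) by (f_equal; ring). apply Clog_lower. lra.
    + exact hm2.
    + rewrite !Rmult_assoc. apply Rmult_le_compat_r; [exact hP|lra].
Qed.

(** * The Humbert function as a series of derivatives of Kummer's function *)

Lemma Cmod_poch_le (b : C) (m : nat) : Cmod (poch b m) <= (Cmod b + 1) ^ m * INR (fact m).
Proof.
  pose proof (Cmod_ge_0 b) as hb.
  induction m as [|m IH]; [simpl; rewrite Cmod_1; lra|].
  simpl poch. rewrite Cmod_mult, fact_simpl, mult_INR. simpl pow.
  assert (h : Cmod (b + INR m)%C <= (Cmod b + 1) * INR (S m)).
  { eapply Rle_trans; [apply Cmod_triangle|]. rewrite Cmod_INR, S_INR.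
    pose proof (pos_INR m). nra. }
  replace ((Cmod b + 1) * (Cmod b + 1) ^ m * (INR (S m) * INR (fact m)))
    with ((Cmod b + 1) ^ m * INR (fact m) * ((Cmod b + 1) * INR (S m))) by ring.
  apply Rmult_le_compat; try apply Cmod_ge_0; easy.
Qed.

(** The [m]-th derivative of Kummer's function. *)
Definition kummer_deriv (a c : C) (m : nat) (y : C) : C :=
  egf (fun n => kummer_coef a c (n + m)) y.

Lemma kummer_coef_add (a c : C) (m n : nat) : not_nonpos_int c ->
  kummer_coef a c (n + m)
  = (kummer_coef a c m * kummer_coef (a + INR m) (c + INR m) n)%C.
Proof.
  intros hc. unfold kummer_coef. rewrite (Nat.add_comm n m), !poch_add.
  assert (h := poch_neq_0 c (m + n) hc). rewrite poch_add in h.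
  field. split; intros e; apply h; rewrite e; ring.
Qed.

Lemma not_nonpos_int_add_INR (c : C) (m : nat) : not_nonpos_int c -> not_nonpos_int (c + INR m)%C.
Proof.
  intros hc. induction m as [|m IH].
  - simpl. now rewrite Cplus_0_r.
  - rewrite INR_C_S, Cplus_assoc. now apply not_nonpos_int_succ.
Qed.

Lemma kummer_deriv_eq (a c : C) (m : nat) (y : C) : not_nonpos_int c ->
  kummer_deriv a c m y
  = (kummer_coef a c m * egf (kummer_coef (a + INR m) (c + INR m)) y)%C.
Proof.
  intros hc. unfold kummer_deriv. rewrite <- egf_scal.
  - apply egf_ext. intros n. now apply kummer_coef_add.
  - now apply geom_growth_kummer, not_nonpos_int_add_INR.
Qed.

(** Kummer's equation, differentiated [m] times. *)
Lemma kummer_deriv_recursion (a c y : C) (m : nat) : not_nonpos_int c ->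
  (y * kummer_deriv a c (S (S m)) y
   = (y - c - INR m) * kummer_deriv a c (S m) y + (a + INR m) * kummer_deriv a c m y)%C.
Proof.
  intros hc. unfold kummer_deriv.
  assert (g : forall j, geom_growth (fun n => kummer_coef a c (n + j))).
  { intros j. now apply geom_growth_shift, geom_growth_kummer. }
  set (f := kummer_coef a c) in *.
  replace ((y - c - INR m) * egf (fun n => f (n + S m)%nat) y + (a + INR m) * egf (fun n => f (n + m)%nat) y)%C
    with (y * egf (fun n => f (n + S m)%nat) y +
      ((- (c + INR m)) * egf (fun n => f (n + S m)%nat) y + (a + INR m) * egf (fun n => f (n + m)%nat) y))%C
    by ring.
  rewrite <- (egf_mul_var _ y (g (S (S m)))), <- (egf_mul_var _ y (g (S m))).
  rewrite <- (egf_scal _ _ y (g (S m))), <- (egf_scal _ _ y (g m)).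
  rewrite <- egf_plus by (apply geom_growth_scal, g).
  rewrite <- egf_plus.
  - apply egf_ext. intros [|j].
    + simpl INR. rewrite !Cmult_0_l, !Nat.add_0_l, Cplus_0_l.
      unfold f. rewrite kummer_coef_S by easy. field. now apply not_nonpos_int_add.
    + simpl pred.
      replace (S j + S m)%nat with (S (S (j + m))) by lia.
      replace (j + S (S m))%nat with (S (S (j + m))) by lia.
      replace (j + S m)%nat with (S (j + m)) by lia.
      replace (S j + m)%nat with (S (j + m)) by lia.
      unfold f. rewrite (kummer_coef_S a c (S (j + m))) by easy.
      assert (h := not_nonpos_int_add c (S (j + m)) hc).
      assert (e : RtoC (INR (S (j + m))) = (INR (S j) + INR m)%C).
      { rewrite <- RtoC_plus, <- plus_INR. f_equal. }
      rewrite e in *. field. exact h.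
  - apply (geom_growth_mul_INR (fun n => f (pred n + S m)%nat)).
    apply (geom_growth_pred (fun n => f (n + S m)%nat)), g.
  - apply geom_growth_plus; apply geom_growth_scal, g.
Qed.

(** As long as [m <= |y|] the coefficients of the recursion, divided by [y], are at most [3] and
    [2], and [3 * 4 + 2 <= 16]. *)
Lemma kummer_deriv_growth (a c y : C) : not_nonpos_int c -> 1 + Cmod a + Cmod c <= Cmod y ->
  forall m, INR m <= Cmod y ->
    Cmod (kummer_deriv a c m y)
      <= 4 ^ m * (Cmod (kummer_deriv a c 0 y) + Cmod (kummer_deriv a c 1 y)) /\
    Cmod (kummer_deriv a c (S m) y)
      <= 4 ^ (S m) * (Cmod (kummer_deriv a c 0 y) + Cmod (kummer_deriv a c 1 y)).
Proof.
  intros hc hy. set (mu := Cmod (kummer_deriv a c 0 y) + Cmod (kummer_deriv a c 1 y)).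
  pose proof (Cmod_ge_0 (kummer_deriv a c 0 y)) as h0.
  pose proof (Cmod_ge_0 (kummer_deriv a c 1 y)) as h1.
  pose proof (Cmod_ge_0 a) as ha0. pose proof (Cmod_ge_0 c) as hc0.
  assert (hmu : 0 <= mu) by (unfold mu; lra).
  induction m as [|m IH]; intros hm.
  - simpl pow. unfold mu. split; lra.
  - rewrite S_INR in hm. pose proof (pos_INR m) as hm0.
    destruct (IH ltac:(lra)) as [i1 i2]. split; [exact i2|].
    assert (y0 : y <> 0%C) by (apply Cmod_gt_0; lra).
    assert (e := kummer_deriv_recursion a c y m hc).
    apply (f_equal Cmod) in e. rewrite Cmod_mult in e.
    assert (b1 : Cmod (y - c - INR m)%C <= 3 * Cmod y).
    { eapply Rle_trans; [apply Cmod_sub_le|]. rewrite Cmod_INR.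
      pose proof (Cmod_sub_le y c). lra. }
    assert (b2 : Cmod (a + INR m)%C <= 2 * Cmod y).
    { eapply Rle_trans; [apply Cmod_triangle|]. rewrite Cmod_INR. lra. }
    assert (b3 : Cmod y * Cmod (kummer_deriv a c (S (S m)) y)
      <= 3 * Cmod y * (4 ^ S m * mu) + 2 * Cmod y * (4 ^ m * mu)).
    { rewrite e. eapply Rle_trans; [apply Cmod_triangle|]. rewrite !Cmod_mult.
      apply Rplus_le_compat; apply Rmult_le_compat; try apply Cmod_ge_0; easy. }
    apply Rmult_le_reg_l with (Cmod y); [lra|]. eapply Rle_trans; [exact b3|].
    simpl pow. assert (0 <= 4 ^ m * mu) by (apply Rmult_le_pos; [apply pow_le|]; lra).
    assert (0 <= Cmod y * (4 ^ m * mu)) by (apply Rmult_le_pos; lra). nra.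
Qed.

(** The recursion controls the derivatives of order up to [|y|]; beyond that the crude bound
    from the power series wins, because the order exceeds the exponential type. *)
Lemma kummer_deriv_uniform (a c : C) : not_nonpos_int c ->
  exists Q K, 1 <= Q /\ 0 <= K /\ forall y, 1 + Cmod a + Cmod c <= Cmod y -> forall m,
    Cmod (kummer_deriv a c m y) <= Q ^ m *
      (Cmod (kummer_deriv a c 0 y) + Cmod (kummer_deriv a c 1 y) + K * exp (- 2 * Cmod y)).
Proof.
  intros hc. destruct (geom_growth_kummer a c hc) as (K & q & hK & hq & h).
  set (E := exp (q + 2)). assert (hE : 0 < E) by apply exp_pos.
  assert (hqE : 0 < q * E) by (apply Rmult_lt_0_compat; lra).
  (* 4 comes from the recursion; in the other case [exp ((q+2)(m-|y|)) >= 1] converts the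
     bound [exp (q |y|)] into [exp (-2 |y|)] at the cost of the factor [E^m]. *)
  exists (4 + q * E), K. split; [lra|]. split; [easy|]. intros y hy m.
  set (mu := Cmod (kummer_deriv a c 0 y) + Cmod (kummer_deriv a c 1 y)).
  assert (hmu : 0 <= mu) by (unfold mu; apply Rplus_le_le_0_compat; apply Cmod_ge_0).
  assert (hx : 0 <= K * exp (- 2 * Cmod y)) by (apply Rmult_le_pos; [easy|left; apply exp_pos]).
  assert (p1 : 4 ^ m <= (4 + q * E) ^ m) by (apply pow_incr; lra).
  assert (p2 : (q * E) ^ m <= (4 + q * E) ^ m) by (apply pow_incr; lra).
  assert (p3 : 0 <= 4 ^ m) by (apply pow_le; lra).
  assert (p4 : 0 <= (q * E) ^ m) by (apply pow_le; lra).
  destruct (Rle_lt_dec (INR m) (Cmod y)) as [hm|hm].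
  - destruct (kummer_deriv_growth a c y hc hy m hm) as [h1 _]. fold mu in h1.
    eapply Rle_trans; [exact h1|]. apply Rmult_le_compat; lra.
  - assert (hb : Cmod (kummer_deriv a c m y) <= K * q ^ m * exp (q * Cmod y)).
    { apply egf_bound. intros n. eapply Rle_trans; [apply h|]. rewrite pow_add. right; ring. }
    eapply Rle_trans; [exact hb|].
    apply Rle_trans with ((q * E) ^ m * (K * exp (- 2 * Cmod y))).
    2:{ apply Rmult_le_compat; lra. }
    rewrite Rpow_mult_distr.
    replace (q ^ m * E ^ m * (K * exp (- 2 * Cmod y)))
      with (K * q ^ m * (E ^ m * exp (- 2 * Cmod y))) by ring.
    apply Rmult_le_compat_l; [apply Rmult_le_pos; [easy|apply pow_le; lra]|].
    replace (E ^ m) with (exp (INR m * (q + 2))).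
    2:{ unfold E. clear. induction m as [|m IH]; [simpl; rewrite <- exp_0; f_equal; ring|].
        rewrite S_INR. simpl pow. rewrite <- IH, <- exp_plus. f_equal. ring. }
    rewrite <- exp_plus. apply exp_le_compat. nra.
Qed.

Lemma Phi1_kummer (a b c x y : C) : not_nonpos_int c -> Cmod x < 1 ->
  Phi1 a b c x y
  = CSeries (fun m => poch b m * (x ^ m / INR (fact m)) * kummer_deriv a c m y)%C.
Proof.
  intros hc hx. unfold Phi1. destruct (Rlt_dec (Cmod x) 1); [|easy].
  unfold Phi1_series. apply CSeries_ext. intros m. unfold kummer_deriv, egf.
  rewrite <- CSeries_scal.
  - apply CSeries_ext. intros n. unfold kummer_coef. rewrite (Nat.add_comm n m).
    unfold Cdiv. ring.
  - apply (egf_summable (fun n => kummer_coef a c (n + m))).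
    now apply geom_growth_shift, geom_growth_kummer.
Qed.

(** The terms decay geometrically with ratio [O(1/|y|)], as [x] is [O(1/|y|)]. *)
Lemma Phi1_tail (a b c : C) (eta2 : R) (N : nat) : not_nonpos_int c -> 0 <= eta2 ->
  exists K K' R0, 0 <= K /\ 0 <= K' /\ 1 <= R0 /\ forall x y, R0 <= Cmod y -> Cmod (x * y)%C <= eta2 ->
    Cmod (Phi1 a b c x y
      - bsum (fun m => poch b m * (x ^ m / INR (fact m)) * kummer_deriv a c m y) N)%C
    <= K * (/ Cmod y) ^ N *
       (Cmod (kummer_deriv a c 0 y) + Cmod (kummer_deriv a c 1 y) + K' * exp (- 2 * Cmod y)).
Proof.
  intros hc heta. destruct (kummer_deriv_uniform a c hc) as (Q & K' & hQ & hK' & H).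
  set (q1 := Cmod b + 1). pose proof (Cmod_ge_0 b) as hb.
  set (th := q1 * eta2 * Q).
  assert (hth : 0 <= th) by (unfold th, q1; repeat apply Rmult_le_pos; lra).
  set (R0 := Rmax (1 + Cmod a + Cmod c) (Rmax (2 * th) (eta2 + 1))).
  exists (2 * th ^ N), K', R0.
  assert (hR1 : 1 + Cmod a + Cmod c <= R0) by apply Rmax_l.
  assert (hR2 : 2 * th <= R0) by (unfold R0; max_lra).
  assert (hR3 : eta2 + 1 <= R0) by (unfold R0; max_lra).
  pose proof (Cmod_ge_0 a) as ha0. pose proof (Cmod_ge_0 c) as hc0.
  assert (hthN : 0 <= th ^ N) by now apply pow_le.
  repeat split; try lra. intros x y hy hxy.
  specialize (H y ltac:(lra)).
  set (V := Cmod (kummer_deriv a c 0 y) + Cmod (kummer_deriv a c 1 y) + K' * exp (- 2 * Cmod y)) in *.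
  assert (hV : 0 <= V).
  { unfold V. repeat apply Rplus_le_le_0_compat; try apply Cmod_ge_0.
    apply Rmult_le_pos; [easy|left; apply exp_pos]. }
  set (iy := / Cmod y). assert (hiy : 0 < iy) by (apply Rinv_0_lt_compat; lra).
  assert (hx : Cmod x <= eta2 * iy).
  { rewrite Cmod_mult in hxy. unfold iy. apply (Rle_div_r (Cmod x)); lra. }
  assert (hx1 : Cmod x < 1).
  { eapply Rle_lt_trans; [exact hx|]. unfold iy. apply (Rlt_div_l eta2 1); lra. }
  rewrite Phi1_kummer by easy.
  set (u := fun m => (poch b m * (x ^ m / INR (fact m)) * kummer_deriv a c m y)%C).
  set (z := th * iy). assert (hz0 : 0 <= z) by (unfold z; apply Rmult_le_pos; lra).
  assert (hz : z <= 1/2) by (unfold z, iy; apply (Rle_div_l th); lra).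
  assert (hu : forall m, Cmod (u m) <= V * z ^ m).
  { intros m. unfold u. rewrite !Cmod_mult, Cmod_pow_fact.
    assert (b1 : Cmod (poch b m) * (Cmod x ^ m / INR (fact m)) <= (q1 * (eta2 * iy)) ^ m).
    { rewrite Rpow_mult_distr. unfold Rdiv.
      assert (f0 := INR_fact_lt_0 m).
      apply Rle_trans with ((q1 ^ m * INR (fact m)) * ((eta2 * iy) ^ m * / INR (fact m))).
      - apply Rmult_le_compat; [apply Cmod_ge_0| |apply Cmod_poch_le|].
        + apply Rmult_le_pos; [apply pow_le, Cmod_ge_0|left; now apply Rinv_0_lt_compat].
        + apply Rmult_le_compat_r; [left; now apply Rinv_0_lt_compat|].
          apply pow_incr. split; [apply Cmod_ge_0|exact hx].
      - right. field. lra. }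
    apply Rle_trans with ((q1 * (eta2 * iy)) ^ m * (Q ^ m * V)).
    - apply Rmult_le_compat; [|apply Cmod_ge_0|exact b1|apply H].
      apply Rmult_le_pos; [apply Cmod_ge_0|].
      apply Rdiv_le_0_compat; [apply pow_le, Cmod_ge_0|apply INR_fact_lt_0].
    - right. unfold z, th. rewrite !Rpow_mult_distr. ring. }
  assert (hgeo : ex_series (fun m => V * z ^ m)).
  { apply ex_series_scal_R, ex_series_geom. rewrite Rabs_pos_eq; lra. }
  assert (hsum : abs_summable u) by (now apply abs_summable_le with (fun m => V * z ^ m)).
  rewrite (CSeries_split u N hsum).
  replace (bsum u N + CSeries (fun n => u (N + n)%nat) - bsum u N)%C
    with (CSeries (fun n => u (N + n)%nat)) by ring.
  assert (hgeo2 : ex_series (fun n => V * z ^ N * z ^ n)).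
  { apply ex_series_scal_R, ex_series_geom. rewrite Rabs_pos_eq; lra. }
  eapply Rle_trans; [apply (Cmod_CSeries_le _ (fun n => V * z ^ N * z ^ n))|].
  - intros n. eapply Rle_trans; [apply hu|]. rewrite pow_add. right; ring.
  - exact hgeo2.
  - rewrite Series_scal_l, Series_geom by (rewrite Rabs_pos_eq; lra).
    assert (hs : / (1 - z) <= 2).
    { replace 2 with (/ (1 / 2)) by field. apply Rinv_le_contravar; lra. }
    assert (hzN : 0 <= z ^ N) by now apply pow_le.
    replace (2 * th ^ N * iy ^ N * V) with (V * z ^ N * 2)
      by (unfold z; rewrite Rpow_mult_distr; ring).
    apply Rmult_le_compat_l; [now apply Rmult_le_pos|exact hs].
Qed.

(** * Rearrangement of truncated double sums *)

Lemma bsum_exchange (f : nat -> nat -> C) (m n : nat) :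
  bsum (fun i => bsum (fun j => f i j) n) m = bsum (fun j => bsum (fun i => f i j) m) n.
Proof.
  induction m as [|m IH]; cbn [bsum].
  - induction n as [|n IHn]; cbn [bsum]; [easy|rewrite <- IHn; ring].
  - rewrite IH, <- bsum_plus. easy.
Qed.

Lemma bsum_0 (n : nat) : bsum (fun _ => 0%C) n = 0%C.
Proof. induction n as [|n IH]; cbn [bsum]; [easy|rewrite IH; ring]. Qed.

Lemma bsum_extend (f : nat -> C) (n N : nat) : (n <= N)%nat ->
  bsum f n = bsum (fun i => if Nat.ltb i n then f i else 0%C) N.
Proof.
  intros h. replace N with (n + (N - n))%nat by lia. rewrite bsum_add.
  rewrite (bsum_ext (fun k => if Nat.ltb (n + k) n then f (n + k)%nat else 0%C) (fun _ => 0%C)).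
  - rewrite bsum_0, Cplus_0_r. apply bsum_ext. intros k hk.
    destruct (Nat.ltb_spec k n); [easy|lia].
  - intros k _. destruct (Nat.ltb_spec (n + k) n); [lia|easy].
Qed.

Lemma bsum_minus (f g : nat -> C) (n : nat) :
  bsum (fun k => f k - g k)%C n = (bsum f n - bsum g n)%C.
Proof. induction n as [|n IH]; cbn [bsum]; [ring|rewrite IH; ring]. Qed.

(** Collecting the terms of a square table by the weighted degree [d i + k]: the terms of
    degree at least [N] that the square contains in excess are [O(u^N)]. *)
Lemma bsum_collect (A : nat -> nat -> C) (d N : nat) (B : R) (u : C) : (1 <= d)%nat ->
  Cmod u <= 1 -> 0 <= B -> (forall i k, (i < N)%nat -> (k < N)%nat -> Cmod (A i k) <= B) ->
  Cmod (bsum (fun i => bsum (fun k => A i k * u ^ (d * i + k)) N) N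
        - bsum (fun j => bsum (fun i => A i (j - d * i)%nat) (S (j / d)) * u ^ j) N)%C
  <= INR N * (INR (d * N) * (B * Cmod u ^ N)).
Proof.
  intros hd hu hB hA.
  set (F := fun i j => if Nat.ltb i (S (j / d)) then (A i (j - d * i)%nat * u ^ j)%C else 0%C).
  assert (e1 : bsum (fun j => bsum (fun i => A i (j - d * i)%nat) (S (j / d)) * u ^ j)%C N
    = bsum (fun i => bsum (fun j => F i j) N) N).
  { rewrite (bsum_exchange F). apply bsum_ext. intros j hj.
    rewrite (bsum_ext (fun i => F i j) (fun i => u ^ j *
       (if Nat.ltb i (S (j / d)) then A i (j - d * i)%nat else 0))%C).
    - rewrite bsum_scal, <- bsum_extend; [ring|].
      pose proof (Nat.Div0.div_le_upper_bound j d j ltac:(nia)). lia.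
    - intros i _. unfold F. destruct (Nat.ltb i (S (j / d))); ring. }
  rewrite e1, <- bsum_minus. apply Cmod_bsum_le. intros i hi.
  assert (hF : forall k, F i (d * i + k)%nat = (A i k * u ^ (d * i + k))%C).
  { intros k. unfold F. destruct (Nat.ltb_spec i (S ((d * i + k) / d))) as [h|h].
    - f_equal. f_equal. lia.
    - exfalso. assert (i <= (d * i + k) / d)%nat by (apply Nat.div_le_lower_bound; lia). lia. }
  assert (hF0 : forall j, (j < d * i)%nat -> F i j = 0%C).
  { intros j hj. unfold F. destruct (Nat.ltb_spec i (S (j / d))) as [h|h]; [|easy].
    exfalso. assert (j / d < i)%nat by (apply Nat.Div0.div_lt_upper_bound; lia). lia. }
  assert (e2 : bsum (fun k => A i k * u ^ (d * i + k))%C N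
     = (bsum (fun j => F i j) N + bsum (fun k => F i (N + k)%nat) (d * i))%C).
  { rewrite <- bsum_add, Nat.add_comm, bsum_add.
    rewrite (bsum_ext (fun j => F i j) (fun _ => 0%C) (d * i)) by apply hF0.
    rewrite bsum_0, Cplus_0_l. apply bsum_ext. intros k _. now rewrite hF. }
  rewrite e2.
  replace (bsum (fun j => F i j) N + bsum (fun k => F i (N + k)%nat) (d * i) - bsum (fun j => F i j) N)%C
    with (bsum (fun k => F i (N + k)%nat) (d * i)) by ring.
  assert (hpow : 0 <= Cmod u ^ N) by (apply pow_le, Cmod_ge_0).
  assert (hBu : 0 <= B * Cmod u ^ N) by now apply Rmult_le_pos.
  eapply Rle_trans.
  - apply (Cmod_bsum_le _ (B * Cmod u ^ N)). intros k hk. unfold F.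
    destruct (Nat.ltb_spec i (S ((N + k) / d))) as [h|h]; [|rewrite Cmod_0; exact hBu].
    rewrite Cmod_mult, Cmod_pow, pow_add.
    assert (hk1 : Cmod u ^ k <= 1).
    { rewrite <- (pow1 k). apply pow_incr. split; [apply Cmod_ge_0|easy]. }
    assert (hk0 : 0 <= Cmod u ^ k) by (apply pow_le, Cmod_ge_0).
    apply Rmult_le_compat; [apply Cmod_ge_0|now apply Rmult_le_pos|apply hA; lia|].
    rewrite <- (Rmult_1_r (Cmod u ^ N)) at 2. now apply Rmult_le_compat_l.
  - apply Rmult_le_compat_r; [exact hBu|]. apply le_INR. nia.
Qed.

(** * Collecting the expansion of the Humbert function *)

(** [F = O(g)] as [y] tends to infinity, uniformly for [y] in [Dom] and [x y] bounded. *)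
Definition bigO (Dom : C -> Prop) (eta2 : R) (F : C -> C -> C) (g : C -> R) : Prop :=
  exists K M, forall x y, Dom y -> Cmod (x * y)%C <= eta2 -> M <= Cmod y ->
    Cmod (F x y) <= K * g y.

Lemma bigO_ext (Dom : C -> Prop) (eta2 : R) (F G : C -> C -> C) (g : C -> R) (M0 : R) :
  (forall x y, Dom y -> Cmod (x * y)%C <= eta2 -> M0 <= Cmod y -> F x y = G x y) ->
  bigO Dom eta2 F g -> bigO Dom eta2 G g.
Proof.
  intros h (K & M & H). exists K, (Rmax M M0). intros x y hd hx hm.
  rewrite <- h by (try easy; max_lra). apply H; try easy; max_lra.
Qed.

Lemma bigO_plus (Dom : C -> Prop) (eta2 : R) (F G : C -> C -> C) (g : C -> R) :
  bigO Dom eta2 F g -> bigO Dom eta2 G g -> bigO Dom eta2 (fun x y => F x y + G x y)%C g.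
Proof.
  intros (K & M & H) (K' & M' & H'). exists (K + K'), (Rmax M M'). intros x y hd hx hm.
  specialize (H x y hd hx ltac:(max_lra)). specialize (H' x y hd hx ltac:(max_lra)).
  eapply Rle_trans; [apply Cmod_triangle|]. lra.
Qed.

Lemma bigO_bsum (Dom : C -> Prop) (eta2 : R) (F : nat -> C -> C -> C) (g : C -> R) (n : nat) :
  (forall y, 0 <= g y) -> (forall i, bigO Dom eta2 (F i) g) ->
  bigO Dom eta2 (fun x y => bsum (fun i => F i x y) n) g.
Proof.
  intros hg h. induction n as [|n IH]; cbn [bsum].
  - exists 0, 0. intros. rewrite Cmod_0. lra.
  - now apply bigO_plus.
Qed.

Lemma bigO_mult (Dom : C -> Prop) (eta2 : R) (u F : C -> C -> C) (g h : C -> R) :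
  bigO Dom eta2 u h -> bigO Dom eta2 F g ->
  bigO Dom eta2 (fun x y => u x y * F x y)%C (fun y => h y * g y).
Proof.
  intros (B & M & H) (K & M' & H'). exists (B * K), (Rmax M M'). intros x y hd hx hm.
  specialize (H x y hd hx ltac:(max_lra)). specialize (H' x y hd hx ltac:(max_lra)).
  rewrite Cmod_mult. replace (B * K * (h y * g y)) with ((B * h y) * (K * g y)) by ring.
  apply Rmult_le_compat; try apply Cmod_ge_0; easy.
Qed.

Lemma bigO_weight (Dom : C -> Prop) (eta2 : R) (F : C -> C -> C) (g h : C -> R) :
  (exists K, 0 <= K /\ exists M, forall y, Dom y -> M <= Cmod y -> 0 <= g y <= K * h y) ->
  bigO Dom eta2 F g -> bigO Dom eta2 F h.
Proof.
  intros (K & hK & M & H) (K' & M' & H').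
  exists (Rmax 0 K' * K), (Rmax M M'). intros x y hd hx hm.
  specialize (H y hd ltac:(max_lra)). specialize (H' x y hd hx ltac:(max_lra)).
  pose proof (Rmax_l 0 K'). pose proof (Rmax_r 0 K').
  apply Rle_trans with (Rmax 0 K' * g y).
  - eapply Rle_trans; [exact H'|]. now apply Rmult_le_compat_r.
  - rewrite Rmult_assoc. now apply Rmult_le_compat_l.
Qed.

Lemma finite_upper_bound2 (g : nat -> nat -> R) (N : nat) :
  exists B, 0 <= B /\ forall i k, (i < N)%nat -> (k < N)%nat -> g i k <= B.
Proof.
  assert (H : forall n, exists B, 0 <= B /\ forall i k, (i < n)%nat -> (k < N)%nat -> g i k <= B).
  { induction n as [|n (B & hB & h)].
    - exists 0. split; [lra|]. intros; lia.
    - destruct (finite_upper_bound (g n) N) as (B' & hB' & h').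
      exists (B + B'). split; [lra|]. intros i k hi hk.
      destruct (Nat.eq_dec i n) as [->|hne].
      + specialize (h' k hk). lra.
      + specialize (h i k ltac:(lia) hk). lra. }
  apply H.
Qed.

Lemma Cmod_inv_le_1 (y : C) : 1 <= Cmod y -> Cmod (/ y)%C <= 1.
Proof.
  intros h. rewrite Cmod_inv by (apply Cmod_gt_0; lra).
  rewrite <- Rinv_1. apply Rinv_le_contravar; lra.
Qed.

Lemma bigO_collect (Dom : C -> Prop) (eta2 : R) (A : nat -> nat -> C -> C) (d N : nat) :
  (1 <= d)%nat -> 0 <= eta2 ->
  (forall i k, exists w, forall eta, A i k eta = (w * eta ^ i)%C) ->
  bigO Dom eta2 (fun x y =>
    bsum (fun i => bsum (fun k => A i k (x * y)%C * (/ y) ^ (d * i + k)) N) N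
    - bsum (fun j => bsum (fun i => A i (j - d * i)%nat (x * y)%C) (S (j / d)) * (/ y) ^ j) N)%C
    (fun y => (/ Cmod y) ^ N).
Proof.
  intros hd heta hA.
  assert (hA1 : forall i k, A i k = fun eta => A i k eta) by easy.
  destruct (finite_upper_bound2 (fun i k => Cmod (A i k 1%C) * (1 + eta2) ^ i) N) as (B & hB & h).
  exists (INR N * (INR (d * N) * B)), 1. intros x y _ hx hy.
  eapply Rle_trans.
  - apply (bsum_collect (fun i k => A i k (x * y)%C) d N B (/ y)%C hd); [|easy|].
    + now apply Cmod_inv_le_1.
    + intros i k hi hk. eapply Rle_trans; [|apply (h i k hi hk)].
      destruct (hA i k) as [w hw]. rewrite !hw, Cpow_1_l, Cmult_1_r, Cmod_mult, Cmod_pow.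
      apply Rmult_le_compat_l; [apply Cmod_ge_0|]. apply pow_incr.
      split; [apply Cmod_ge_0|lra].
  - rewrite Cmod_inv by (apply Cmod_gt_0; lra). right. ring.
Qed.

Lemma Cpow_opp (z : C) (n : nat) : ((- z) ^ n = (-1) ^ n * z ^ n)%C.
Proof. rewrite <- Cpow_mult_l. f_equal. ring. Qed.

Lemma Cpow_m1_add_double (j i : nat) : (2 * i <= j)%nat ->
  ((-1) ^ j = (-1) ^ (j - 2 * i))%C.
Proof.
  intros h. replace j with (2 * i + (j - 2 * i))%nat at 1 by lia.
  rewrite Cpow_add_r, Cpow_mult_r. replace ((-1) ^ 2)%C with (RtoC 1) by (simpl; ring).
  rewrite Cpow_1_l. ring.
Qed.

(** Tables whose diagonal sums are the coefficients of the two expansions. *)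
Definition table1 (a b c : C) (m k : nat) (eta : C) : C :=
  (poch b m / INR (fact m) * poch a m
   * ray_coef (c + INR m - (a + INR m)) (c + INR m) k * (-1) ^ m * (-1) ^ k * eta ^ m)%C.

Definition table2 (a b c : C) (m k : nat) (eta : C) : C :=
  (poch b m / INR (fact m) * ray_coef (a + INR m) (c + INR m) k * eta ^ m)%C.

(** A term of the algebraic expansion has degree [2 m + k]: one [y^(-m)] stems from
    [(eta / y)^m], the other from the parameter [a + m]. *)
Lemma coef1_table (a b c eta : C) (j : nat) :
  bsum (fun i => table1 a b c i (j - 2 * i) eta) (S (j / 2)) = coef1 a b c j eta.
Proof.
  unfold coef1. rewrite <- bsum_sum_n, <- bsum_scal. apply bsum_ext. intros i hi.
  assert (h : (2 * i <= j)%nat).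
  { assert (2 * (j / 2) <= j)%nat by apply Nat.Div0.mul_div_le. lia. }
  cbv zeta. rewrite (Cpow_m1_add_double j i h).
  replace (j - 2 * i + i)%nat with (i + (j - 2 * i))%nat by lia.
  unfold table1, ray_coef. rewrite poch_add, Cpow_opp.
  replace (c + INR i - (c + INR i - (a + INR i)))%C with (a + INR i)%C by ring.
  replace (1 - (c + INR i - (a + INR i)))%C with (a - c + 1)%C by ring.
  field. split; apply INR_fact_neq_0_C.
Qed.

(** The factor [(1-a)_(k-m)] arises from [(1-a-m)_k] by reflection, which also disposes of
    positive integers [a]. *)
Lemma coef2_table (a b c eta : C) (j : nat) : not_nonpos_int a ->
  bsum (fun i => table2 a b c i (j - 1 * i) eta) (S (j / 1)) = coef2 a b c j eta.
Proof.
  intros ha. rewrite Nat.div_1_r. unfold coef2. rewrite <- bsum_sum_n. apply bsum_ext. intros i hi.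
  cbv zeta. rewrite Nat.mul_1_l. unfold table2, ray_coef.
  replace (c + INR i - (a + INR i))%C with (c - a)%C by ring.
  replace (1 - (a + INR i))%C with (1 - a - INR i)%C by ring.
  rewrite <- (pochZ_reflect a (j - i) i ha), Cpow_opp.
  field. split; apply INR_fact_neq_0_C.
Qed.

(** From Kummer's function to the Humbert function.  The leading factors [U1], [U2] and the
    scale [Wt] are abstract so that the slit plane and the positive axis, where there is no
    algebraic part ([U1 = 0]), are both instances. *)
Lemma Phi1_expansion_of_kummer (a b c : C) (eta2 : R) (N : nat) (U1 U2 : C -> C)
  (Wt : C -> R) (Dom : C -> Prop) :
  not_nonpos_int a -> not_nonpos_int c -> 0 <= eta2 -> (forall y, 0 <= Wt y) ->
  (forall m, bigO Dom eta2 (fun _ y => kummer_deriv a c m y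
      - (U1 y * (poch a m * (/ - y) ^ m
           * bsum (fun k => ray_coef (c + INR m - (a + INR m)) (c + INR m) k * (/ - y) ^ k) N)
         + U2 y * bsum (fun k => ray_coef (a + INR m) (c + INR m) k * (/ y) ^ k) N))%C
      (fun y => (/ Cmod y) ^ N * Wt y)) ->
  bigO Dom eta2 (fun _ y => U1 y) Wt -> bigO Dom eta2 (fun _ y => U2 y) Wt ->
  bigO Dom eta2 (fun _ y => RtoC (exp (- 2 * Cmod y))) Wt ->
  bigO Dom eta2 (fun x y => Phi1 a b c x y
      - (U1 y * bsum (fun k => coef1 a b c k (x * y) / y ^ k) N
         + U2 y * bsum (fun k => coef2 a b c k (x * y) / y ^ k) N))%C
      (fun y => (/ Cmod y) ^ N * Wt y).
Proof.
  intros ha hc heta hWt hD hU1 hU2 hE.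
  set (main := fun m y => (U1 y * (poch a m * (/ - y) ^ m
           * bsum (fun k => ray_coef (c + INR m - (a + INR m)) (c + INR m) k * (/ - y) ^ k) N)
         + U2 y * bsum (fun k => ray_coef (a + INR m) (c + INR m) k * (/ y) ^ k) N)%C) in *.
  set (g := fun y => (/ Cmod y) ^ N * Wt y) in *.
  assert (hpowy : forall y : C, 0 <= (/ Cmod y) ^ N).
  { intros y. apply pow_le. destruct (Ceq_dec y 0) as [->|hy].
    - rewrite Cmod_0, Rinv_0. lra.
    - left. apply Rinv_0_lt_compat. now apply Cmod_gt_0. }
  assert (hg : forall y, 0 <= g y) by (intros y; apply Rmult_le_pos; auto).
  assert (hgW : forall F, bigO Dom eta2 F g -> bigO Dom eta2 F Wt).
  { intros F. apply bigO_weight. exists 1. split; [lra|]. exists 1. intros y _ hy. split; [auto|].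
    unfold g. apply Rmult_le_compat_r; [auto|]. rewrite <- (pow1 N). apply pow_incr.
    split; [left; apply Rinv_0_lt_compat; lra|]. rewrite <- Rinv_1. apply Rinv_le_contravar; lra. }
  assert (hpoly : forall (f : nat -> C) (s : C), Cmod s = 1 ->
     bigO Dom eta2 (fun _ y => bsum (fun k => f k * (/ (s * y)) ^ k)%C N) (fun _ => 1)).
  { intros f s hs. destruct (bsum_pow_bounded f N) as (B & hB & h). exists B, 1.
    intros x y _ _ hy. rewrite Rmult_1_r. apply h. apply Cmod_inv_le_1.
    rewrite Cmod_mult, hs. lra. }
  assert (hscale : forall F, bigO Dom eta2 F (fun y => Wt y * 1) -> bigO Dom eta2 F Wt).
  { intros F. apply bigO_weight. exists 1. split; [lra|]. exists 0. intros y _ _.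
    specialize (hWt y). lra. }
  assert (hmain : forall m, bigO Dom eta2 (fun _ y => main m y) Wt).
  { intros m. unfold main. apply bigO_plus.
    - apply hscale.
      apply (bigO_mult _ _ (fun _ y => U1 y) _ (fun _ => 1) Wt hU1).
      apply (bigO_weight _ _ _ (fun _ => 1 * 1)).
      { exists 1. split; [lra|]. exists 0. intros. lra. }
      apply (bigO_mult _ _ (fun _ y => poch a m * (/ - y) ^ m)%C _ (fun _ => 1) (fun _ => 1)).
      + exists (Cmod (poch a m)), 1. intros x y _ _ hy. rewrite Cmod_mult, Cmod_pow, Rmult_1_r.
        rewrite <- (Rmult_1_r (Cmod (poch a m))) at 2. apply Rmult_le_compat_l; [apply Cmod_ge_0|].
        rewrite <- (pow1 m). apply pow_incr. split; [apply Cmod_ge_0|].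
        apply Cmod_inv_le_1. now rewrite Cmod_opp.
      + eapply (bigO_ext _ _ _ _ _ 0); [|apply (hpoly (ray_coef (c + INR m - (a + INR m)) (c + INR m)) (- (1))%C)].
        * intros x y _ _ _. apply bsum_ext. intros k _.
          replace (- (1) * y)%C with (- y)%C by ring. reflexivity.
        * now rewrite Cmod_opp, Cmod_1.
    - apply hscale.
      apply (bigO_mult _ _ (fun _ y => U2 y) _ (fun _ => 1) Wt hU2).
      eapply (bigO_ext _ _ _ _ _ 0); [|apply (hpoly (ray_coef (a + INR m) (c + INR m)) 1%C), Cmod_1].
      intros x y _ _ _. apply bsum_ext. intros k _. now rewrite Cmult_1_l. }
  assert (hderiv : forall m, bigO Dom eta2 (fun _ y => kummer_deriv a c m y) Wt).
  { intros m. eapply (bigO_ext _ _ _ _ _ 0); [|apply bigO_plus; [apply hgW, (hD m)|apply (hmain m)]].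
    intros x y _ _ _. cbv beta. unfold main. ring. }
  set (v := fun m x => (poch b m * (x ^ m / INR (fact m)))%C).
  assert (hv : forall m, bigO Dom eta2 (fun x _ => v m x) (fun _ => 1)).
  { intros m. exists (Cmod (poch b m / INR (fact m))%C), (eta2 + 1). intros x y _ hx hy.
    unfold v. replace (poch b m * (x ^ m / INR (fact m)))%C with (poch b m / INR (fact m) * x ^ m)%C
      by (field; apply INR_fact_neq_0_C).
    rewrite Cmod_mult, Cmod_pow. apply Rmult_le_compat_l; [apply Cmod_ge_0|].
    rewrite <- (pow1 m). apply pow_incr. split; [apply Cmod_ge_0|].
    rewrite Cmod_mult in hx. pose proof (Cmod_ge_0 x). nra. }
  assert (T1 : bigO Dom eta2 (fun x y => Phi1 a b c x y
      - bsum (fun m => v m x * kummer_deriv a c m y) N)%C g).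
  { destruct (Phi1_tail a b c eta2 N hc heta) as (K & K' & R0 & hK & hK' & hR0 & H).
    destruct (hderiv 0%nat) as (K0 & M0 & H0). destruct (hderiv 1%nat) as (K1 & M1 & H1).
    destruct hE as (K2 & M2 & H2).
    exists (K * (K0 + K1 + K' * K2)), (Rmax R0 (Rmax M0 (Rmax M1 M2))). intros x y hd hx hm.
    specialize (H0 x y hd hx ltac:(max_lra)). specialize (H1 x y hd hx ltac:(max_lra)).
    specialize (H2 x y hd hx ltac:(max_lra)).
    rewrite Cmod_R, Rabs_pos_eq in H2 by (left; apply exp_pos).
    eapply Rle_trans; [apply (H x y); [max_lra|easy]|].
    unfold g. replace (K * (K0 + K1 + K' * K2) * ((/ Cmod y) ^ N * Wt y))
      with (K * (/ Cmod y) ^ N * (K0 * Wt y + K1 * Wt y + K' * (K2 * Wt y))) by ring.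
    apply Rmult_le_compat_l; [apply Rmult_le_pos; auto|].
    apply Rplus_le_compat; [lra|]. now apply Rmult_le_compat_l. }
  assert (T2 : bigO Dom eta2 (fun x y =>
      bsum (fun m => v m x * (kummer_deriv a c m y - main m y)) N)%C g).
  { apply (bigO_bsum _ _ (fun m x y => v m x * (kummer_deriv a c m y - main m y))%C); [exact hg|].
    intros m. apply (bigO_weight _ _ _ (fun y => 1 * g y)).
    { exists 1. split; [lra|]. exists 0. intros y _ _. specialize (hg y). lra. }
    apply (bigO_mult _ _ (fun x _ => v m x) (fun _ y => kummer_deriv a c m y - main m y)%C);
      [apply hv|apply (hD m)]. }
  assert (C1 := bigO_collect Dom eta2 (table1 a b c) 2 N ltac:(lia) heta).
  assert (C2 := bigO_collect Dom eta2 (table2 a b c) 1 N ltac:(lia) heta).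
  specialize (C1 ltac:(intros i k; eexists; intros; reflexivity)).
  specialize (C2 ltac:(intros i k; eexists; intros; reflexivity)).
  assert (hsw : forall F, bigO Dom eta2 F (fun y => Wt y * (/ Cmod y) ^ N) -> bigO Dom eta2 F g).
  { intros F. apply bigO_weight. exists 1. split; [lra|]. exists 0. intros y _ _.
    specialize (hg y). unfold g in *. lra. }
  assert (T3 := hsw _ (bigO_mult _ _ _ _ _ _ hU1 C1)).
  assert (T4 := hsw _ (bigO_mult _ _ _ _ _ _ hU2 C2)).
  eapply (bigO_ext _ _ _ _ _ 1);
    [|apply bigO_plus; [exact T1|apply bigO_plus; [exact T2|apply bigO_plus; [exact T3|exact T4]]]].
  intros x y hd hx hy. cbv beta.
  assert (y0 : y <> 0%C) by (apply Cmod_gt_0; lra).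
  assert (q1 : bsum (fun j => bsum (fun i => table1 a b c i (j - 2 * i) (x * y)%C) (S (j / 2))
      * (/ y) ^ j)%C N = bsum (fun k => coef1 a b c k (x * y) / y ^ k)%C N).
  { apply bsum_ext. intros j _. rewrite coef1_table, Cpow_inv by easy. reflexivity. }
  assert (q2 : bsum (fun j => bsum (fun i => table2 a b c i (j - 1 * i) (x * y)%C) (S (j / 1))
      * (/ y) ^ j)%C N = bsum (fun k => coef2 a b c k (x * y) / y ^ k)%C N).
  { apply bsum_ext. intros j _. rewrite coef2_table, Cpow_inv by easy. reflexivity. }
  rewrite q1, q2.
  assert (q3 : bsum (fun m => v m x * main m y)%C N =
    (U1 y * bsum (fun i => bsum (fun k => table1 a b c i k (x * y)%C * (/ y) ^ (2 * i + k)) N) N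
     + U2 y * bsum (fun i => bsum (fun k => table2 a b c i k (x * y)%C * (/ y) ^ (1 * i + k)) N) N)%C).
  { rewrite <- !bsum_scal, <- bsum_plus. apply bsum_ext. intros m _.
    rewrite <- !bsum_scal. unfold main. rewrite Cmult_plus_distr_l. f_equal.
    - transitivity (v m x * U1 y * (poch a m * (/ - y) ^ m) *
        bsum (fun k => ray_coef (c + INR m - (a + INR m)) (c + INR m) k * (/ - y) ^ k) N)%C; [ring|].
      rewrite <- bsum_scal. apply bsum_ext. intros k _. unfold v, table1.
      replace (/ - y)%C with (- / y)%C by (field; easy).
      rewrite !(Cpow_opp (/ y)).
      replace (x ^ m)%C with ((x * y) ^ m * (/ y) ^ m)%C.
      2:{ rewrite <- Cpow_mult_l. f_equal. field. easy. }
      replace (2 * m + k)%nat with (m + (m + k))%nat by lia. rewrite !Cpow_add_r.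
      field. repeat split; first [exact y0|apply INR_fact_neq_0_C].
    - transitivity (v m x * U2 y *
        bsum (fun k => ray_coef (a + INR m) (c + INR m) k * (/ y) ^ k) N)%C; [ring|].
      rewrite <- bsum_scal. apply bsum_ext. intros k _. unfold v, table2.
      replace (x ^ m)%C with ((x * y) ^ m * (/ y) ^ m)%C.
      2:{ rewrite <- Cpow_mult_l. f_equal. field. easy. }
      rewrite Nat.mul_1_l, !Cpow_add_r.
      field. repeat split; first [exact y0|apply INR_fact_neq_0_C]. }
  rewrite (bsum_ext (fun m => v m x * (kummer_deriv a c m y - main m y))%C
    (fun m => v m x * kummer_deriv a c m y - v m x * main m y)%C) by (intros; ring).
  rewrite bsum_minus, q3. ring.
Qed.

(** * The two expansions *)

Lemma Cexp_Clog (z : C) : z <> 0%C -> Cexp (Clog z) = z.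
Proof.
  intros hz. assert (hm := Cmod_gt_0 z). destruct z as [X Y].
  assert (hR : 0 < X * X + Y * Y).
  { assert (h : 0 < Cmod (X, Y)) by now apply hm. rewrite Cmod_pair in h.
    apply Rnot_le_lt. intros h'. rewrite sqrt_neg_0 in h by easy. lra. }
  destruct (Rle_lt_dec 0 Y) as [h|h].
  - rewrite Clog_upper, Cexp_hlog by (try easy; now left). f_equal. ring.
  - replace Y with (- - Y) by ring. rewrite Clog_lower, Cexp_hlog by (try easy; try (now right); nra).
    f_equal. ring.
Qed.

Lemma Cpower_sub_nat (z w : C) (m : nat) : z <> 0%C ->
  Cpower z (w - INR m) = (Cpower z w * (/ z) ^ m)%C.
Proof.
  intros hz. induction m as [|m IH].
  - simpl. unfold Cminus. rewrite Copp_0, Cplus_0_r. ring.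
  - rewrite INR_C_S. simpl Cpow.
    replace (Cpower z w * (/ z * (/ z) ^ m))%C with ((Cpower z w * (/ z) ^ m) * / z)%C by ring.
    rewrite <- IH. rewrite <- (Cexp_Clog z hz) at 3. rewrite <- Cexp_opp. unfold Cpower.
    rewrite <- Cexp_add. f_equal. ring.
Qed.

Lemma Cmod_Cpower_le (z w : C) :
  Cmod (Cpower z w) <= exp (4 * Cmod w) * exp (Re w * ln (Cmod z)).
Proof.
  unfold Cpower. rewrite Cmod_Cexp, <- exp_plus. apply exp_le_compat.
  replace (Re (w * Clog z)%C) with (Re w * ln (Cmod z) - Im w * Arg z) by reflexivity.
  assert (h : Rabs (Arg z) <= 4).
  { pose proof PI_4. unfold Arg. pose proof (acos_bound (Re z / Cmod z)).
    destruct (Rle_dec 0 (Im z)); split_Rabs; lra. }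
  assert (h2 : Rabs (Im w * Arg z) <= Cmod w * 4).
  { rewrite Rabs_mult. apply Rmult_le_compat; try apply Rabs_pos; [apply Im_le_Cmod|exact h]. }
  split_Rabs; lra.
Qed.

Lemma kummer_coef_Gamma (a c : C) (m : nat) : not_nonpos_int a -> not_nonpos_int c ->
  (kummer_coef a c m * (Gamma (c + INR m) / Gamma (a + INR m)) = Gamma c / Gamma a)%C.
Proof.
  intros ha hc. rewrite !poch_Gamma by easy. unfold kummer_coef.
  field. repeat split; first [now apply Gamma_neq_0|now apply poch_neq_0].
Qed.

Lemma exp_neg_le_power (w : R) :
  exists B, 0 < B /\ forall r, 1 <= r -> exp (- 2 * r) <= B * exp (w * ln r).
Proof.
  destruct (ln_le_linear (- w) 1 Rlt_0_1) as (B & hB & h).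
  exists (exp B). split; [apply exp_pos|]. intros r hr. specialize (h r hr).
  rewrite <- exp_plus. apply exp_le_compat. lra.
Qed.

Lemma Phi1_expansion_slit (a b c : C) (eta2 : R) (n : nat) : not_nonpos_int a ->
  not_nonpos_int c -> not_nonpos_int (c - a)%C -> 0 <= eta2 ->
  bigO (fun y => slit_plane (- y)) eta2 (fun x y => Phi1 a b c x y
      - (Gamma c / Gamma (c - a) * Cpower (- y) (- a)
           * bsum (fun k => coef1 a b c k (x * y) / y ^ k) (S n)
         + Gamma c / Gamma a * Cpower y (a - c) * Cexp y
           * bsum (fun k => coef2 a b c k (x * y) / y ^ k) (S n)))%C
    (fun y => (/ Cmod y) ^ S n * kummer_weight a c y).
Proof.
  intros ha hc hca heta.
  assert (hw : forall y, 0 <= kummer_weight a c y).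
  { intros y. unfold kummer_weight. apply Rplus_le_le_0_compat; left; apply exp_pos. }
  apply (Phi1_expansion_of_kummer a b c eta2 (S n)
    (fun y => Gamma c / Gamma (c - a) * Cpower (- y) (- a))%C
    (fun y => Gamma c / Gamma a * Cpower y (a - c) * Cexp y)%C); try assumption.
  - intros m.
    assert (ha' := not_nonpos_int_add_INR a m ha). assert (hc' := not_nonpos_int_add_INR c m hc).
    assert (e : (c + INR m - (a + INR m))%C = (c - a)%C) by ring.
    destruct (kummer_plane_expansion (a + INR m) (c + INR m) n ha' hc' ltac:(now rewrite e))
      as (K & R0 & hK & hR0 & H).
    exists (Cmod (kummer_coef a c m) * K), R0. intros _ y hs _ hy. specialize (H y hs hy).
    assert (y0 : y <> 0%C) by (apply Cmod_gt_0; lra).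
    rewrite kummer_deriv_eq by easy.
    replace (Cpower (- y) (- (a + INR m))) with (Cpower (- y) (- a) * (/ - y) ^ m)%C in H.
    2:{ rewrite <- Cpower_sub_nat by now apply Copp_neq_0. f_equal. ring. }
    replace (a + INR m - (c + INR m))%C with (a - c)%C in H by ring.
    set (S1 := bsum (fun k => ray_coef (c + INR m - (a + INR m)) (c + INR m) k * (/ - y) ^ k)%C (S n)) in *.
    set (S2 := bsum (fun k => ray_coef (a + INR m) (c + INR m) k * (/ y) ^ k)%C (S n)) in *.
    rewrite e in H. set (M := egf (kummer_coef (a + INR m) (c + INR m)) y) in *.
    replace (kummer_coef a c m * M - (Gamma c / Gamma (c - a) * Cpower (- y) (- a)
        * (poch a m * (/ - y) ^ m * S1) + Gamma c / Gamma a * Cpower y (a - c) * Cexp y * S2))%C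
      with (kummer_coef a c m * (M - (Gamma (c + INR m) / Gamma (c - a)
        * (Cpower (- y) (- a) * (/ - y) ^ m) * S1
        + Gamma (c + INR m) / Gamma (a + INR m) * (Cpower y (a - c) * Cexp y) * S2)))%C.
    2:{ rewrite !poch_Gamma by easy. unfold kummer_coef. field.
        repeat split; first [now apply Gamma_neq_0|now apply poch_neq_0]. }
    rewrite Cmod_mult, Rmult_assoc. apply Rmult_le_compat_l; [apply Cmod_ge_0|].
    eapply Rle_trans; [exact H|]. rewrite Rmult_assoc. apply Rmult_le_compat_l; [easy|].
    apply Rmult_le_compat_l.
    { apply pow_le. left. apply Rinv_0_lt_compat. lra. }
    unfold kummer_weight. replace (a + INR m - (c + INR m))%C with (a - c)%C by ring.
    apply Rplus_le_compat_r, exp_le_compat.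
    replace (Re (a + INR m)%C) with (Re a + INR m) by reflexivity.
    assert (0 <= ln (Cmod y)) by (rewrite <- ln_1; apply ln_le; lra).
    pose proof (pos_INR m). nra.
  - exists (Cmod (Gamma c / Gamma (c - a))%C * exp (4 * Cmod (- a)%C)), 0. intros _ y _ _ _.
    rewrite Cmod_mult, Rmult_assoc. apply Rmult_le_compat_l; [apply Cmod_ge_0|].
    eapply Rle_trans; [apply Cmod_Cpower_le|].
    apply Rmult_le_compat_l; [left; apply exp_pos|].
    rewrite Cmod_opp. unfold kummer_weight. replace (Re (- a)%C) with (- Re a) by reflexivity.
    pose proof (exp_pos (Re (a - c)%C * ln (Cmod y) + Re y)). lra.
  - exists (Cmod (Gamma c / Gamma a)%C * exp (4 * Cmod (a - c)%C)), 0. intros _ y _ _ _.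
    rewrite !(Cmod_mult (Gamma c / Gamma a * Cpower y (a - c))), (Cmod_mult (Gamma c / Gamma a)).
    rewrite !Rmult_assoc. apply Rmult_le_compat_l; [apply Cmod_ge_0|].
    apply Rle_trans with (exp (4 * Cmod (a - c)%C) * exp (Re (a - c)%C * ln (Cmod y)) * Cmod (Cexp y)).
    { apply Rmult_le_compat_r; [apply Cmod_ge_0|apply Cmod_Cpower_le]. }
    rewrite Rmult_assoc, Cmod_Cexp, <- exp_plus.
    apply Rmult_le_compat_l; [left; apply exp_pos|].
    unfold kummer_weight. pose proof (exp_pos (- Re a * ln (Cmod y))). lra.
  - destruct (exp_neg_le_power (- Re a)) as (B & hB & h). exists B, 1. intros _ y _ _ hy.
    rewrite Cmod_R, Rabs_pos_eq by (left; apply exp_pos).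
    eapply Rle_trans; [apply (h _ hy)|]. apply Rmult_le_compat_l; [lra|].
    unfold kummer_weight. pose proof (exp_pos (Re (a - c)%C * ln (Cmod y) + Re y)). lra.
Qed.

(** On the positive axis the algebraic part is exponentially small relative to the other, so
    the ray expansion alone suffices. *)
Lemma Phi1_expansion_positive (a b c : C) (eta2 : R) (N : nat) : not_nonpos_int a ->
  not_nonpos_int c -> 0 <= eta2 ->
  bigO (fun y => exists r, 0 < r /\ y = RtoC r) eta2 (fun x y => Phi1 a b c x y
      - (0 * bsum (fun k => coef1 a b c k (x * y) / y ^ k) N
         + Gamma c / Gamma a * Cpower y (a - c) * Cexp y
         * bsum (fun k => coef2 a b c k (x * y) / y ^ k) N))%C
    (fun y => (/ Cmod y) ^ N * exp (Re (a - c)%C * ln (Cmod y) + Re y)).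
Proof.
  intros ha hc heta.
  apply (Phi1_expansion_of_kummer a b c eta2 N (fun _ => 0%C)
    (fun y => Gamma c / Gamma a * Cpower y (a - c) * Cexp y)%C
    (fun y => exp (Re (a - c)%C * ln (Cmod y) + Re y))); try assumption.
  - intros y. left. apply exp_pos.
  - intros m.
    assert (ha' := not_nonpos_int_add_INR a m ha). assert (hc' := not_nonpos_int_add_INR c m hc).
    destruct (kummer_ray_expansion (c + INR m) N hc' (a + INR m) _
      (kummer_limit_Gamma _ _ ha' hc')) as (K & R0 & hK & hR0 & H).
    exists (Cmod (kummer_coef a c m) * K), R0. intros _ y (r & hr & ->) _ hy.
    rewrite Cmod_R, (Rabs_pos_eq r) in * by lra.
    specialize (H r hy). rewrite kummer_deriv_eq by easy.
    unfold kummer_scaled in H. replace (a + INR m - (c + INR m))%C with (a - c)%C in H by ring.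
    rewrite Cpower_pos by easy. fold (rpow r (a - c)). rewrite Cexp_RtoC.
    set (S2 := bsum (fun k => ray_coef (a + INR m) (c + INR m) k * (/ r) ^ k)%C N) in *.
    set (M := egf (kummer_coef (a + INR m) (c + INR m)) r) in *.
    rewrite rpow_opp in H.
    assert (hE : RtoC (exp r) <> 0%C) by (apply RtoC_neq_0, Rgt_not_eq, exp_pos).
    replace (RtoC (exp (- r))) with (/ exp r)%C in H
      by (rewrite exp_Ropp, RtoC_inv; [easy|apply Rgt_not_eq, exp_pos]).
    rewrite Cmult_0_l, Cplus_0_l.
    replace (kummer_coef a c m * M - Gamma c / Gamma a * rpow r (a - c) * exp r * S2)%C
      with ((kummer_coef a c m * (rpow r (a - c) * exp r)) *
        (/ rpow r (a - c) * / exp r * M - Gamma (c + INR m) / Gamma (a + INR m) * S2))%C.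
    2:{ rewrite <- (kummer_coef_Gamma a c m ha hc). field.
        repeat split; first [exact hE|apply rpow_neq_0|now apply Gamma_neq_0]. }
    rewrite Cmod_mult, (Cmod_mult (kummer_coef a c m)), (Cmod_mult (rpow r (a - c))), Cmod_rpow.
    rewrite (Cmod_R (exp r)), Rabs_pos_eq, <- exp_plus by (left; apply exp_pos).
    replace (Re (RtoC r)) with r by reflexivity.
    set (E := exp (Re (a - c)%C * ln r + r)). assert (hE0 : 0 < E) by apply exp_pos.
    apply Rle_trans with (Cmod (kummer_coef a c m) * E * (K * (/ r) ^ N)).
    + apply Rmult_le_compat_l; [apply Rmult_le_pos; [apply Cmod_ge_0|lra]|exact H].
    + right. ring.
  - exists 0, 0. intros. rewrite Cmod_0. lra.
  - exists (Cmod (Gamma c / Gamma a)%C), 0. intros _ y (r & hr & ->) _ _. right.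
    rewrite Cpower_pos by easy. fold (rpow r (a - c)).
    rewrite !Cmod_mult, Cmod_rpow, Cmod_Cexp, Cmod_R, Rabs_pos_eq, exp_plus by lra. ring.
  - destruct (exp_neg_le_power (Re (a - c)%C)) as (B & hB & h). exists B, 1.
    intros _ y (r & hr & ->) _ hy.
    rewrite (Cmod_R (exp _)), Rabs_pos_eq by (left; apply exp_pos).
    eapply Rle_trans; [apply (h _ hy)|]. apply Rmult_le_compat_l; [lra|].
    apply exp_le_compat. replace (Re (RtoC r)) with r by reflexivity. lra.
Qed.

Theorem theorem3p11 (a b c : C) (eta1 eta2 : R)
  (ha : not_nonpos_int a) (hc : not_nonpos_int c)
  (hca : not_nonpos_int (c - a)%C)
  (heta1 : 0 < eta1) (heta12 : eta1 <= eta2) :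
  (forall (delta : R) (N : nat),
     0 < delta ->
     (1 <= N)%nat -> Cmod a <= INR N -> Cmod (a - c)%C <= INR N ->
     exists K M : R, forall x y : C,
       M <= Cmod y ->
       slit_plane (1 - x)%C -> slit_plane (- y)%C ->
       eta1 <= Cmod (x * y)%C <= eta2 ->
       (forall l : nat, delta <= Cmod (y - (a + INR l))%C) ->
       Cmod (Phi1 a b c x y
             - (Gamma c / Gamma (c - a) * Cpower (- y) (- a)
                * sum_n (fun k => coef1 a b c k (x * y) / y ^ k) (N - 1)
                + Gamma c / Gamma a * Cpower y (a - c) * Cexp y
                * sum_n (fun k => coef2 a b c k (x * y) / y ^ k) (N - 1)))%C
       <= K * (Rpower (Cmod y) (- Re a - INR N)
               + Rpower (Cmod y) (Re (a - c)%C - INR N) * exp (Re y)))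
  /\
  (forall N : nat,
     exists K M : R, forall (x : C) (y : R),
       0 < y -> M <= y ->
       slit_plane (1 - x)%C ->
       eta1 <= Cmod (x * y)%C <= eta2 ->
       Cmod (Phi1 a b c x y
             - Gamma c / Gamma a * Cpower y (a - c) * Cexp y
               * sum_n (fun k => coef2 a b c k (x * y) / y ^ k) N)%C
       <= K * (Cmod (Gamma c / Gamma a * Cpower y (a - c) * Cexp y)%C
               / y ^ (N + 1))).
Proof.
  assert (heta : 0 <= eta2) by lra. split.
  - intros delta N _ hN _ _. destruct N as [|n]; [lia|].
    destruct (Phi1_expansion_slit a b c eta2 n ha hc hca heta) as (K & M & H).
    exists K, (Rmax M 1). intros x y hy _ hs [_ hxy] _.
    assert (hyM : M <= Cmod y) by max_lra.
    assert (hy1 : 1 <= Cmod y) by max_lra.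
    specialize (H x y hs hxy hyM). rewrite !bsum_sum_n in H.
    replace (S n - 1)%nat with n by lia.
    replace (Rpower (Cmod y) (- Re a - INR (S n)) +
        Rpower (Cmod y) (Re (a - c)%C - INR (S n)) * exp (Re y))
      with ((/ Cmod y) ^ S n * kummer_weight a c y); [exact H|].
    rewrite inv_pow_exp by lra. unfold kummer_weight, Rpower.
    rewrite Rmult_plus_distr_l, <- !exp_plus. f_equal; f_equal; ring.
  - intros N. destruct (Phi1_expansion_positive a b c eta2 (S N) ha hc heta) as (K & M & H).
    assert (hG : (Gamma c / Gamma a)%C <> 0%C).
    { intros e. apply (Gamma_neq_0 c hc).
      replace (Gamma c) with (Gamma c / Gamma a * Gamma a)%C by (field; now apply Gamma_neq_0).
      rewrite e. ring. }
    assert (hG0 : 0 < Cmod (Gamma c / Gamma a)%C) by now apply Cmod_gt_0.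
    exists (K / Cmod (Gamma c / Gamma a)%C), M. intros x y hy hyM _ [_ hxy].
    assert (hm : Cmod y = y) by (rewrite Cmod_R, Rabs_pos_eq; lra).
    specialize (H x (RtoC y) ltac:(now exists y) hxy ltac:(lra)).
    rewrite !bsum_sum_n, hm in H.
    set (U := (Gamma c / Gamma a * Cpower y (a - c) * Cexp y)%C) in *.
    assert (hU : Cmod U = Cmod (Gamma c / Gamma a)%C * exp (Re (a - c)%C * ln y + y)).
    { unfold U. rewrite Cpower_pos by easy. fold (rpow y (a - c)).
      rewrite !(Cmod_mult (Gamma c / Gamma a * rpow y (a - c))), (Cmod_mult (Gamma c / Gamma a)).
      rewrite Cmod_rpow, Cmod_Cexp, exp_plus. simpl. ring. }
    rewrite hU. rewrite Cmult_0_l, Cplus_0_l in H.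
    eapply Rle_trans; [exact H|]. right.
    replace (Re (RtoC y)) with y by reflexivity.
    rewrite Nat.add_1_r, pow_inv. field. split; [apply pow_nonzero; lra|lra].
Qed.
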